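(* Let $\mathcal{O}\subset\mathbb{R}^{d}$ be a bounded domain and let $\boldsymbol{\Delta}$ be the Laplacian on $\mathcal{O}$ with homogeneous boundary conditions such that [A1] its eigenfunctions $\mathfrak{h}_k$, $k\ge 1$, form an orthonormal basis in $L_2(\mathcal{O})$, and [A2] its eigenvalues $-\lambda_k^2$, $k\geq 1$, satisfy $0<\lambda_1<\lambda_2\leq\lambda_3\leq\cdots$ and $\lambda_k\sim c_{\mathcal{O}}k^{1/d}$, $k\to\infty$, for some $c_{\mathcal{O}}>0$. Let $\nu>0$, $\sigma>0$, let $W$ be a cylindrical Brownian motion on $L_2(\mathcal{O})$, let $\gamma>d/2$, and let $\varphi\in L_2(\Omega;H^{-\gamma})$ be $\mathcal{F}_0$-measurable and independent of $W$. Then the equation $$u(t)=\varphi+\nu\int_0^t\boldsymbol{\Delta}u(s)\,ds+\sigma W(t),\quad t>0,$$ has a unique solution and, for every $T>0$, $$\mathbb{E}\sup_{0<t<T}\|u(t)\|_{-\gamma}^2+\mathbb{E}\int_0^T\|u(t)\|_{1-\gamma}^2\,dt\leq C(\gamma,T)\big(1+\mathbb{E}\|\varphi\|_{-\gamma}^2\big),$$ where $C(\gamma,T)$ is a number depending only on $T$ and $\gamma$ (for the fixed data $\mathcal{O},\boldsymbol{\Delta},\nu,\sigma$). Moreover: (1) For every $t>0$, $u(t)\in L_2(\Omega;H^{1-\gamma})$ and $$u(t)=S_t\varphi+\sum_{k=1}^{\infty}\bar u_k(t)\,\mathfrak{h}_k,$$ where $S_t$ is the heat semigroup and $\bar u_k(t)$,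 $k\ge1$, are independent Gaussian random variables with mean zero and variance $$\mathbb{E}\bar u_k^2(t)=\frac{\sigma^2}{2\nu\lambda_k^2}\Big(1-e^{-2\nu\lambda_k^2t}\Big).$$ (2) As $t\to+\infty$, the $H^{1-\gamma}$-valued random variables $u(t)$ converge weakly (in distribution) to $\sigma(2\nu)^{-1/2}\bar W$, where $\bar W$ is the $(\boldsymbol{\Delta},\mathcal{O})$-Gaussian free field.
   Context: A stochastic basis $(\Omega,\mathcal{F},\{\mathcal{F}_t\}_{t\ge0},\mathbb{P})$ satisfying the usual conditions and carrying countably many independent standard Brownian motions $w_k$ is fixed. Hilbert scale: $H=H^0=L_2(\mathcal{O})$, $f_k=(f,\mathfrak{h}_k)_{L_2(\mathcal{O})}$, $\|f\|_\gamma^2=\sum_{k\ge1}\lambda_k^{2\gamma}f_k^2$. For $\gamma>0$, $H^\gamma=\{f\in H:\|f\|_\gamma<\infty\}$; for $\gamma<0$, $H^\gamma$ is the completion of $H$ in the norm $\|\cdot\|_\gamma$. Elements of each $H^\gamma$ are written $f=\sum_k f_k\mathfrak{h}_k$ with $\sum_k\lambda_k^{2\gamma}f_k^2<\infty$, and $\boldsymbol{\Delta}f=-\sum_k\lambda_k^2f_k\mathfrak{h}_k$. Cylindrical Brownian motion on $L_2(\mathcal{O})$: $W(t)=\sum_{k\ge1}\mathfrak{h}_kw_k(t)$; the series defines an element of $L_2(\Omega;\mathcal{C}((0,T);H^{-\gamma}))$ for all $T>0$, $\gamma>d/2$. Heat semigroup: $S_tf=\sum_{k\ge1}e^{-\lambda_k^2\nu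 t}f_k\mathfrak{h}_k$. Solution: given $\varphi\in L_2(\Omega;H^r)$, a solution is an adapted process with values in $L_2(\Omega\times[0,T];H^{r+1})\cap L_2(\Omega;\mathcal{C}((0,T);H^r))$ (for every $T>0$) such that the equation holds in $H^{r-1}$ for all $t\ge0$ with probability one. Here $r=-\gamma$. The $(\boldsymbol{\Delta},\mathcal{O})$-Gaussian free field $\bar W$ is the isonormal Gaussian process on $H^1$; as a random element it is $\bar W=\sum_{k\ge1}\frac{\zeta_k}{\lambda_k}\mathfrak{h}_k$ with iid standard Gaussian random variables $\zeta_k$, the series converging in $L_2(\Omega;H^{1-\gamma})$ for every $\gamma>d/2$. *)

(* Defs.v *)
From HB Require Import structures.
From mathcomp Require Import all_boot all_order all_algebra.
From mathcomp Require Import all_classical all_reals all_analysis.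
Set Implicit Arguments.
Unset Strict Implicit.
Unset Printing Implicit Defensive.
Import Order.TTheory GRing.Theory Num.Theory.
Import numFieldNormedType.Exports.
Local Open Scope classical_set_scope.
Local Open Scope ring_scope.

Section lebesgue_tuple.
Context {R : realType}.

Definition tcons (n : nat) (p : n.-tuple R * measurableTypeR R) :
    n.+1.-tuple R :=
  [the n.+1.-tuple R of (p.2 : R) :: p.1].

Lemma measurable_tcons (n : nat) :
  measurable_fun [set: n.-tuple R * measurableTypeR R] (@tcons n).
Proof.
apply: measurable_cons; last exact: measurable_fst.
by move=> mT Y mY; exact: measurable_snd.
Qed.

Section step.
Variables (n : nat) (m : {measure set (n.-tuple R) -> \bar R}).

Definition lebesgue_tcons : set (n.+1.-tuple R) -> \bar R :=
  pushforward (m \x @lebesgue_measure R)%E (@tcons n).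

Let lebesgue_tcons0 : lebesgue_tcons set0 = 0%E.
Proof. by rewrite /lebesgue_tcons /pushforward preimage_set0 measure0. Qed.

Let lebesgue_tcons_ge0 A : (0 <= lebesgue_tcons A)%E.
Proof. by rewrite /lebesgue_tcons /pushforward measure_ge0. Qed.

Let lebesgue_tcons_sigma_additive : semi_sigma_additive lebesgue_tcons.
Proof.
apply: measure_semi_sigma_additive => //; exact: measurable_tcons.
Qed.

HB.instance Definition _ := isMeasure.Build _ _ _ lebesgue_tcons
  lebesgue_tcons0 lebesgue_tcons_ge0 lebesgue_tcons_sigma_additive.
End step.

Fixpoint lebesgue_tuple (n : nat) : {measure set (n.-tuple R) -> \bar R} :=
  match n with
  | 0 => \d_ [tuple]
  | n.+1 => lebesgue_tcons (lebesgue_tuple n)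
  end.

End lebesgue_tuple.

Section laplacian.
Context {R : realType} {d : nat}.
Implicit Types (O K : set 'rV[R]_d) (f g psi : 'rV[R]_d -> R).

(* Topology and derivatives are those of ['rV[R]_d], whereas the library puts
   the product sigma-algebra on [d.-tuple R]. *)
Definition rowt (t : d.-tuple R) : 'rV[R]_d := \row_i tnth t i.

Definition bounded_domain O :=
  [/\ open O, connected O, O !=set0 & bounded_set O].

(* Square-integrable functions on [O], as representatives: [O] is open and
   values outside [O] are irrelevant. *)
Definition L2O O f :=
  (fun t => f (rowt t) * \1_O (rowt t)) \in Lfun (lebesgue_tuple d) 2%:E.

Definition intO O f : R :=
  Rintegral (lebesgue_tuple d) (rowt @^-1` O) (f \o rowt).

Definition innerO O f g : R := intO O (f \* g).

Fixpoint dpartial (s : seq 'I_d) f : 'rV[R]_d -> R :=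
  if s is i :: s' then 'D_(delta_mx ord0 i) (dpartial s' f) else f.

Definition smooth f := forall s : seq 'I_d,
  continuous (dpartial s f) /\
  forall i x, derivable (dpartial s f) x (delta_mx ord0 i).

Definition test_function O psi := smooth psi /\
  exists K, [/\ compact K, K `<=` O & forall x, ~ K x -> psi x = 0].

Definition laplace f : 'rV[R]_d -> R :=
  fun x => \sum_(i < d) dpartial [:: i; i] f x.

(* [g] is the Laplacian of [f] in the sense of distributions on [O]. *)
Definition weak_laplacian O f g := forall psi, test_function O psi ->
  innerO O f (laplace psi) = innerO O g psi.

(* [Lap] with domain [D] is the Laplacian in [L_2(O)] with some homogeneous
   (i.e. linear, and void for functions vanishing near the boundary) boundary
   conditions; the boundary conditions are encoded in [D]. *)
Record homogeneous_laplacian O (D : set ('rV[R]_d -> R))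
    (Lap : ('rV[R]_d -> R) -> 'rV[R]_d -> R) : Prop := {
  hlap_linear : forall (a : R) f g, D f -> D g -> D (fun x => a * f x + g x) ;
  hlap_test : test_function O `<=` D ;
  hlap_L2 : forall f, D f -> L2O O f /\ L2O O (Lap f) ;
  hlap_laplacian : forall f, D f -> weak_laplacian O f (Lap f) }.

Record orthonormal_basis O (h : nat -> 'rV[R]_d -> R) : Prop := {
  onb_L2 : forall k, L2O O (h k) ;
  onb_orthonormal : forall j k, innerO O (h j) (h k) = (j == k)%:R ;
  onb_complete : forall f, L2O O f ->
    intO O (fun x => (f x - \sum_(k < n) innerO O f (h k) * h k x) ^+ 2)
      @[n --> \oo] --> (0 : R) }.

Definition eqO O f g :=
  {ae lebesgue_tuple d, forall t, O (rowt t) -> f (rowt t) = g (rowt t)}.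

(* Indices are shifted by one: [h k] and [lam k] stand for the eigenfunction
   and the number with index [k + 1]. *)
Definition eigenbasis O (D : set ('rV[R]_d -> R))
    (Lap : ('rV[R]_d -> R) -> 'rV[R]_d -> R)
    (h : nat -> 'rV[R]_d -> R) (lam : nat -> R) :=
  orthonormal_basis O h /\
  forall k, D (h k) /\ eqO O (Lap (h k)) (fun x => - lam k ^+ 2 * h k x).

End laplacian.

Definition eigenvalue_growth (R : realType) (d : nat) (lam : nat -> R) :=
  [/\ 0 < lam 0%N, lam 0%N < lam 1%N, (forall k, lam k.+1 <= lam k.+2) &
    exists2 c : R, 0 < c &
      (lam k / (c * k.+1%:R `^ d%:R^-1)) @[k --> \oo] --> (1 : R)].


(* The Hilbert scale.  An element [\sum_k f_k h_k] of [H^g], for any real [g],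
   is represented by its coefficients [f : nat -> R].  For [g >= 0] these are
   the coefficients in [L_2(O)] with respect to the orthonormal basis; for
   [g < 0] the completion of [L_2(O)] is the weighted [l^2] space itself. *)
Section hilbert_scale.
Context {R : realType}.
Variable lam : nat -> R.
Implicit Types (f g : nat -> R) (r : R) (U : set (nat -> R)).

Definition hnorm2 r f : \bar R :=
  (\sum_(0 <= k <oo) (lam k `^ (2 * r) * f k ^+ 2)%:E)%E.

Definition hnorm r f : \bar R := (hnorm2 r f `^ 2^-1)%E.

Definition hscale r : set (nat -> R) := [set f | (hnorm2 r f < +oo)%E].

Definition hbasis (k : nat) : nat -> R := fun j => (j == k)%:R.

Definition hlaplace f : nat -> R := fun k => - lam k ^+ 2 * f k.

Definition heat_semigroup (nu t : R) f : nat -> R :=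
  fun k => expR (- lam k ^+ 2 * nu * t) * f k.

Definition hopen r U := U `<=` hscale r /\
  forall f, U f -> exists2 e : R, 0 < e &
    forall g, hscale r g -> (hnorm r (g - f)%R < e%:E)%E -> U g.

Definition hcontinuous r (F : (nat -> R) -> R) :=
  forall f, hscale r f -> forall e : R, 0 < e -> exists2 d : R, 0 < d &
    forall g, hscale r g -> (hnorm r (g - f)%R < d%:E)%E -> `|F g - F f| < e.

(* [X] is Borel measurable as a map into [H^r], for the sigma-algebra [G]. *)
Definition hmeasurable (T : Type) (G : set (set T)) r (X : T -> nat -> R) :=
  forall U, hopen r U -> G (X @^-1` U).

(* [X] belongs to [L_2(D, mu; H^r)]. *)
Definition in_L2 dT (T : measurableType dT) (mu : {measure set T -> \bar R})
    (D : set T) r (X : T -> nat -> R) := exists Y : T -> nat -> R,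
  [/\ forall z, D z -> hscale r (Y z),
      forall U, hopen r U -> measurable (D `&` Y @^-1` U),
      {ae mu, forall z, D z -> X z = Y z} &
      (\int[mu]_(z in D) hnorm2 r (Y z) < +oo)%E].

(* The series [\sum_k a_k h_k] converges to [X] in [L_2(Omega; H^r)]. *)
Definition L2_series dT (T : measurableType dT) (P : probability T R) r
    (a : nat -> T -> R) (X : T -> nat -> R) :=
  in_L2 P setT r X /\
  (\int[P]_x hnorm2 r (X x - \sum_(k < n) a k x *: hbasis k)%R)%E
    @[n --> \oo] --> 0%E.

(* Step functions [\sum_i 1_{A_i} v_i] on the line, as lists of [(A_i, v_i)],
   and their integrals over [[0, t]]. *)
Definition step_in r (s : seq (set R * (nat -> R))) :=
  forall p, p \in s -> measurable p.1 /\ hscale r p.2.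

Definition step_val (s : seq (set R * (nat -> R))) (x : R) : nat -> R :=
  \sum_(p <- s) (\1_(p.1) x : R) *: p.2.

Definition step_int (t : R) (s : seq (set R * (nat -> R))) : nat -> R :=
  \sum_(p <- s) fine (lebesgue_measure (p.1 `&` `[0, t])) *: p.2.

(* [I] is the Bochner integral over [[0, t]] of the [H^r]-valued [g]. *)
Definition bochner_integral r (t : R) (g : R -> nat -> R) (I : nat -> R) :=
  hscale r I /\ exists s : nat -> seq (set R * (nat -> R)),
  [/\ forall n, step_in r (s n),
      {ae lebesgue_measure, forall x, `[0, t]%classic x ->
        hnorm r (g x - step_val (s n) x) @[n --> \oo] --> 0%E},
      (\int[lebesgue_measure]_(x in `[0%R, t])
        hnorm r (g x - step_val (s n) x)%R)%E @[n --> \oo] --> 0%E &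
      hnorm r (I - step_int t (s n)) @[n --> \oo] --> 0%E].

(* Weak convergence of the laws of the [H^r]-valued [X t], as [t --> +oo]. *)
Definition cvg_in_law dT (T : measurableType dT) (P : probability T R)
    dS (S : measurableType dS) (Q : probability S R) r
    (X : R -> T -> nat -> R) (Y : S -> nat -> R) :=
  forall F, hcontinuous r F ->
    (exists M : R, forall f, hscale r f -> `|F f| <= M) ->
  (\int[P]_x (F (X t x))%:E)%E @[t --> +oo] --> (\int[Q]_y (F (Y y))%:E)%E.

End hilbert_scale.

Section stochastic.
Context {R : realType} {dT : measure_display} {T : measurableType dT}.
Variable P : probability T R.
Implicit Types (F : R -> set (set T)) (G : set (set T)) (X : T -> R).

Definition sigma_of X : set (set T) := preimage_set_system setT X measurable.

Definition independent2 G1 G2 :=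
  forall A B, G1 A -> G2 B -> P (A `&` B) = (P A * P B)%E.

Definition mutually_independent (G : nat -> set (set T)) :=
  forall (J : seq nat) (A : nat -> set T), uniq J ->
    (forall j, j \in J -> G j (A j)) ->
    P (\bigcap_(j in [set` J]) A j) = (\prod_(j <- J) P (A j))%E.

(* [X] is centred Gaussian with variance [v > 0] (the second argument of
   [normal_prob] is the standard deviation). *)
Definition gaussian X (v : R) := [/\ 0 < v, measurable_fun setT X &
  forall B : set R, measurable B ->
    P (X @^-1` B) = normal_prob 0 (Num.sqrt v) B].

Record usual_stochastic_basis F : Prop := {
  sb_sigma_algebra : forall t : R, 0 <= t -> sigma_algebra setT (F t) ;
  sb_sub : forall t : R, 0 <= t -> F t `<=` measurable ;
  sb_nondecreasing : forall s t : R, 0 <= s -> s <= t -> F s `<=` F t ;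
  sb_complete : measure_is_complete P ;
  sb_null : P.-negligible `<=` F 0 ;
  sb_right_continuous : forall t : R, 0 <= t ->
    \bigcap_(s in `]t, +oo[) F s `<=` F t }.

(* Standard Brownian motion relative to the filtration [F]. *)
Record brownian_motion F (w : R -> T -> R) : Prop := {
  bm_zero : {ae P, forall x, w 0 x = 0} ;
  bm_adapted : forall t : R, 0 <= t -> sigma_of (w t) `<=` F t ;
  bm_increment : forall s t : R, 0 <= s -> s < t ->
    gaussian (fun x => w t x - w s x) (t - s) ;
  bm_independent : forall s t : R, 0 <= s -> s < t ->
    independent2 (F s) (sigma_of (fun x => w t x - w s x)) ;
  bm_continuous :
    {ae P, forall x, {within `[0, +oo[, continuous (w ^~ x)}} }.

Definition sigma_process (w : R -> T -> R) : set (set T) :=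
  <<s \bigcup_(t in `[0, +oo[) sigma_of (w t) >>.

(* The coordinates [w_k] of [W(t) = \sum_k w_k(t) h_k]. *)
Definition cylindrical_brownian_motion F (w : nat -> R -> T -> R) :=
  (forall k, brownian_motion F (w k)) /\
  mutually_independent (fun k => sigma_process (w k)).

Definition sigma_cylindrical (w : nat -> R -> T -> R) : set (set T) :=
  <<s \bigcup_k sigma_process (w k) >>.

Record initial_condition (lam : nat -> R) F (w : nat -> R -> T -> R) (r : R)
    (phi : T -> nat -> R) : Prop := {
  ic_L2 : in_L2 lam P setT r phi ;
  ic_measurable : hmeasurable lam (F 0) r phi ;
  ic_independent :
    independent2 <<s preimage_set_system setT phi (hopen lam r) >>
      (sigma_cylindrical w) }.

(* [sol_L2] is [L_2(Omega x [0,T]; H^(r+1))]; [sol_continuous] and [sol_sup]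
   are [L_2(Omega; C((0,T); H^r))], with continuity on the open interval only. *)
Record is_solution (lam : nat -> R) (nu sigma : R) F (w : nat -> R -> T -> R)
    (r : R) (phi : T -> nat -> R) (u : R -> T -> nat -> R) : Prop := {
  sol_adapted : forall t : R, 0 <= t -> hmeasurable lam (F t) r (u t) ;
  sol_L2 : forall t1 : R, 0 < t1 ->
    in_L2 lam (P \x @lebesgue_measure R)%E (setT `*` `[0, t1]) (r + 1)
      (fun z => u z.2 z.1) ;
  sol_continuous : {ae P, forall x, forall t : R, 0 < t ->
    hscale lam r (u t x) /\
    hnorm lam r (u s x - u t x) @[s --> t] --> 0%E} ;
  sol_sup : forall t1 : R, 0 < t1 ->
    (\int[P]_x ereal_sup [set hnorm2 lam r (u t x) | t in `]0%R, t1[]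
      < +oo)%E ;
  sol_equation : {ae P, forall x, forall t : R, 0 <= t ->
    hscale lam (r - 1) (u t x) /\
    exists2 I, bochner_integral lam (r - 1) t (fun s => hlaplace lam (u s x)) I &
      u t x = phi x + nu *: I + sigma *: (fun k => w k t x)} }.

(* The Gaussian free field as a random element of [H^(1-g)] for [g > d/2]. *)
Definition gaussian_free_field (d : nat) (lam : nat -> R) (X : T -> nat -> R) :=
  (exists zeta : nat -> T -> R,
    [/\ forall k, gaussian (zeta k) 1,
        mutually_independent (fun k => sigma_of (zeta k)) &
        forall g : R, d%:R / 2 < g ->
          L2_series lam P (1 - g) (fun k x => zeta k x / lam k) X]) /\
  forall g : R, d%:R / 2 < g ->
    (forall x, hscale lam (1 - g) (X x)) /\
    hmeasurable lam measurable (1 - g) X.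

End stochastic.

(* Main.v *)
(* In the eigenbasis the equation splits into scalar equations
   u_k(t) = phi_k - a_k int_0^t u_k ds + sigma w_k(t), with a_k = nu lam_k^2.
   A scalar Volterra equation has at most one solution, so every solution has
   the coordinates exp(-a_k t) phi_k + sigma z_k(t), where the
   Ornstein-Uhlenbeck path z_k is defined path by path (integration by parts in
   int_0^t exp(-a_k (t - s)) dw_k(s)) and is a limit of Riemann-Stieltjes sums.
   Conversely these coordinates form a solution: |z_k| <= 2 sup |w_k| with
   Doob's inequality and the summability of lam_k^(-2 gamma) give a summable
   bound that is uniform on [0, T], and E z_k^2 <= 3 / a_k gives the energy
   estimate.  The Riemann-Stieltjes sums are Gaussian with explicit variance,
   which passes to the limit.  For the convergence in law, phi is independent of
   the noise, so in the expectation of F(u(t)) the noise may be replaced by the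
   field sqrt(1 - exp(-2 a_k t)) sigma (2 nu)^(-1/2) zeta_k / lam_k living on the
   probability space of the free field; there the argument of F converges
   pointwise, and dominated convergence concludes. *)
Require Import Defs.
From mathcomp Require Import all_boot all_order all_algebra.
From mathcomp Require Import all_classical all_reals all_analysis.
From mathcomp Require Import measurable_realfun ring lra.
Set Implicit Arguments.
Unset Strict Implicit.
Unset Printing Implicit Defensive.
Import Order.TTheory GRing.Theory Num.Theory.
Import numFieldNormedType.Exports.
Local Open Scope classical_set_scope.
Local Open Scope ring_scope.

(** * Eigenvalues and the Hilbert scale *)

(** Elements of H^r are bare sequences, so Borel measurability is tested on open sets of H^r and
    reduced to coordinates through separability; a process may take any value off H^r, whence the
    cut-offs. The coordinates of an arbitrary solution are known to be continuous only at positive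
    times, so Volterra uniqueness must start from integrability up to time 0, which the Bochner
    integral in the equation provides. The path functional replaces the Ito integral: it is defined
    for every continuous path, which gives bounds uniform in k, while adaptedness and Gaussian laws
    come from the sums approximating it. Two versions of the noise are used. The one built on
    continuous modifications of the paths is adapted thanks to the null sets in the filtration;
    independence, however, is assumed for the sigma-algebras generated by the paths themselves, so a
    second version is made from upper limits of sums over the unmodified paths. Suprema over time
    and the solution itself come without measurability, hence the comparison lemmas for integrals of
    arbitrary nonnegative functions. *)

Section eigenvalues.
Context {R : realType}.
Implicit Types (lam : nat -> R) (k : nat).

Lemma nneseries_le_bound (f : nat -> \bar R) (M : \bar R) :
  (forall k, 0 <= f k)%E -> (forall n, \sum_(0 <= k < n) f k <= M)%E ->
  (\sum_(0 <= k <oo) f k <= M)%E.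
Proof.
move=> f0 fM; apply: lime_le; first exact: is_cvg_nneseries.
exact: nearW.
Qed.

Lemma eigenvalue_ge_first d lam k : eigenvalue_growth d lam -> lam 0%N <= lam k.
Proof.
move=> [l0 l1 ln _]; elim: k => [|[|k] IH]; rewrite ?lexx ?(ltW l1)//.
by rewrite (le_trans IH).
Qed.

Lemma eigenvalue_gt0 d lam k : eigenvalue_growth d lam -> 0 < lam k.
Proof.
by move=> lamP; have [l0 _ _ _] := lamP; exact: lt_le_trans l0 (eigenvalue_ge_first k lamP).
Qed.

(* With [x = k.+1] and [y = k.+2], the ratio of the two terms on the right is
   [exp (q ln (y / x)) >= 1 + q / y]. *)
Lemma powR_telescope (q : R) k : 0 < q ->
  k.+2%:R `^ (- (1 + q)) <= q^-1 * (k.+1%:R `^ (- q) - k.+2%:R `^ (- q)) :> R.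
Proof.
move=> q0; set x : R := k.+1%:R; set y : R := k.+2%:R.
have x0 : 0 < x by rewrite ltr0n.
have y0 : 0 < y by rewrite ltr0n.
have yx : y = x + 1 by rewrite /y /x -natr1.
clearbody x y.
rewrite ler_pdivlMl// opprD powRD; last by rewrite (gt_eqF y0) implybT.
have -> : y `^ (- 1) = y^-1 by rewrite powRN powRr1 // ltW.
have yq0 : 0 < y `^ (- q) by exact: powR_gt0.
have : 1 + q / y <= x `^ (- q) / y `^ (- q).
  rewrite -powRN opprK /powR !gt_eqF//= -expRD.
  apply: le_trans (expR_ge1Dx _); rewrite lerD2l.
  rewrite mulNr addrC -mulrBr ler_pM2l//.
  have -> : y^-1 = 1 - x / y by rewrite yx; field; lra.
  have xy : ln (x / y) <= x / y - 1.
    by rewrite -[in leLHS](subrK 1 (x / y)) addrC le_ln1Dx// ltrBrDr addNr divr_gt0.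
  move: xy; rewrite ln_div ?posrE//; lra.
rewrite ler_pdivlMr// mulrDl mul1r => h.
rewrite lerBrDl; apply: le_trans h.
by rewrite lerD2l mulrA.
Qed.

(** The telescoping bound with q = p - 1 keeps every partial sum below 1 + 1 / (p - 1). *)
Lemma riemann_series_lty (p : R) : 1 < p ->
  (\sum_(0 <= k <oo) (k.+1%:R `^ (- p))%:E < +oo)%E.
Proof.
move=> p1; have q0 : 0 < p - 1 by rewrite subr_gt0.
apply: (@le_lt_trans _ _ (1 + (p - 1)^-1)%:E); last by rewrite ltry.
apply: nneseries_le_bound => [k|n]; first by rewrite lee_fin powR_ge0.
rewrite sumEFin lee_fin.
case: n => [|n]; first by rewrite big_nil addr_ge0 ?invr_ge0 ?(ltW q0).
suff : \sum_(0 <= k < n.+1) k.+1%:R `^ (- p) <=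
    1 + (p - 1)^-1 * (1 - n.+1%:R `^ (- (p - 1))) :> R.
  move=> h; apply: (le_trans h); rewrite lerD2l -[leRHS]mulr1.
  by rewrite ler_wpM2l ?invr_ge0 ?(ltW q0)// gerBl powR_ge0.
elim: n => [|n IH].
  by rewrite big_nat1 !powR1 subrr mulr0 addr0.
rewrite big_nat_recr//=.
have := powR_telescope n q0; rewrite [1 + _]addrC subrK => h.
apply: le_trans (lerD IH h) _.
by rewrite -addrA -mulrDr addrA subrK.
Qed.

(** Eventually [lam k] is at least (c / 2) (k + 1)^(1/d), so the terms are dominated by those of a
    Riemann series of exponent p = 2 g / d; the condition g > d/2 says exactly that p > 1. The
    finitely many remaining terms are split off. *)
Lemma eigenvalue_series_lty d lam (g : R) : (0 < d)%N ->
  eigenvalue_growth d lam -> d%:R / 2 < g ->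
  (\sum_(0 <= k <oo) (lam k `^ (- (2 * g)))%:E < +oo)%E.
Proof.
move=> d0 lamP dg; have [_ _ _ [c c0 lamc]] := lamP.
have d0' : 0 < d%:R :> R by rewrite ltr0n.
have g0 : 0 < g by rewrite (le_lt_trans _ dg)// divr_ge0.
pose p := 2 * g / d%:R.
have p1 : 1 < p by rewrite /p ltr_pdivlMr// mul1r; lra.
have : \forall k \near \oo, 2^-1 < lam k / (c * k.+1%:R `^ d%:R^-1).
  by apply: (cvgr_gt _ lamc); lra.
move=> [N _ HN].
rewrite (nneseries_split 0 N); last by move=> k _; rewrite lee_fin powR_ge0.
rewrite sumEFin lte_add_pinfty// ?ltry//.
pose C := (c / 2) `^ (- (2 * g)).
apply: (@le_lt_trans _ _ (\sum_(0 + N <= k <oo) (C%:E * (k.+1%:R `^ (- p))%:E))%E).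
  rewrite -(@nneseries_addn _ (fun k => (lam k `^ (- (2 * g)))%:E) (0 + N)); last first.
    by move=> k; rewrite lee_fin powR_ge0.
  rewrite -(@nneseries_addn _ (fun k => C%:E * (k.+1%:R `^ (- p))%:E)%E (0 + N)); last first.
    by move=> k; rewrite -EFinM lee_fin mulr_ge0 ?powR_ge0.
  apply: lee_nneseries => [k _ _|k _]; first by rewrite lee_fin powR_ge0.
  rewrite -EFinM lee_fin.
  set m := (k + (0 + N))%N.
  have := HN m; rewrite /= /m add0n leq_addl => /(_ isT).
  move=> H; move: (k + N)%N H => {}m H.
  have m0 : 0 < m.+1%:R :> R by rewrite ltr0n.
  have mp : 0 < m.+1%:R `^ d%:R^-1 :> R by rewrite powR_gt0.
  have {}H : c / 2 * m.+1%:R `^ d%:R^-1 <= lam m.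
    move: H; rewrite ltr_pdivlMr ?mulr_gt0// => /ltW; apply: le_trans.
    by rewrite mulrA (mulrC c).
  rewrite /C [in leRHS]/p.
  have -> : m.+1%:R `^ (- (2 * g / d%:R)) = (m.+1%:R `^ d%:R^-1) `^ (- (2 * g)) :> R.
    by rewrite -powRrM mulrN mulrC.
  have c20 : 0 < c / 2 by rewrite divr_gt0.
  have lm0 := eigenvalue_gt0 m lamP.
  rewrite -powRM ?(ltW c20) ?(ltW mp)// !powRN lef_pV2 ?posrE ?powR_gt0 ?mulr_gt0//.
  have cm0 := mulr_gt0 c20 mp.
  by apply: ge0_ler_powR; rewrite ?nnegrE ?(ltW lm0) ?(ltW cm0)//; lra.
rewrite nneseriesZl; last by move=> k _; rewrite lee_fin powR_ge0.
rewrite lte_mul_pinfty ?lee_fin ?powR_ge0//.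
apply: le_lt_trans (riemann_series_lty p1).
rewrite [leRHS](nneseries_split 0 (0 + N)); last by move=> k _; rewrite lee_fin powR_ge0.
by rewrite add0n leeDr// sume_ge0// => k _; rewrite lee_fin powR_ge0.
Qed.

End eigenvalues.

(** For nonnegative extended values, being eventually below a real number already contains eventual
    finiteness, so one inequality suffices. *)
Lemma cvge0P {R : realType} (I : Type) (F : set_system I) {FF : Filter F} (h : I -> \bar R) :
  (forall i, 0 <= h i)%E ->
  (h i @[i --> F] --> 0%E) <-> forall e : R, 0 < e -> \forall i \near F, (h i < e%:E)%E.
Proof.
move=> h0; split=> [hF e e0|hF].
  have : nbhs (0%E : \bar R) [set y | (y < e%:E)%E].
    by apply: open_nbhs_nbhs; split; [exact: open_ereal_lt_ereal|rewrite /= lte_fin].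
  by move=> /hF.
apply/fine_cvgP; split.
  have := hF 1 ltr01; apply: filterS => i hi.
  by rewrite ge0_fin_numE// (lt_trans hi) ?ltry.
apply/cvgrPdist_lt => e e0; have := hF e e0; apply: filterS => i hi.
rewrite sub0r normrN ger0_norm ?fine_ge0//=.
rewrite -lte_fin fineK// ge0_fin_numE// (lt_trans hi) ?ltry//.
Qed.

Section hilbert_norm.
Context {R : realType}.
Variable lam : nat -> R.
Implicit Types (f g : nat -> R) (r e : R) (k n : nat).

Local Notation hn := (hnorm2 lam).

Lemma hterm_ge0 r f k : (0 <= (lam k `^ (2 * r) * f k ^+ 2)%:E)%E.
Proof. by rewrite lee_fin mulr_ge0 ?powR_ge0 ?sqr_ge0. Qed.
Hint Resolve hterm_ge0 : core.

Lemma hnorm2_ge0 r f : (0 <= hn r f)%E.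
Proof. by apply: nneseries_ge0. Qed.
Hint Resolve hnorm2_ge0 : core.

Lemma hnorm2_ge_term r f k : ((lam k `^ (2 * r) * f k ^+ 2)%:E <= hn r f)%E.
Proof.
rewrite /hnorm2 (nneseriesD1 (n := k))//= leeDl//.
by apply: nneseries_ge0.
Qed.

Lemma hnorm2_split r f n : hn r f =
  ((\sum_(0 <= k < n) lam k `^ (2 * r) * f k ^+ 2)%:E +
   \sum_(n <= k <oo) (lam k `^ (2 * r) * f k ^+ 2)%:E)%E.
Proof. by rewrite /hnorm2 (nneseries_split 0 n)// add0n sumEFin. Qed.

(** From (x + y)^2 <= 2 x^2 + 2 y^2 termwise. This quasi-triangle inequality stands in for
    Minkowski's: finiteness and convergence to 0 do not see the factor 2. *)
Lemma hnorm2D_le r f g : (hn r (f + g)%R <= 2%:E * hn r f + 2%:E * hn r g)%E.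
Proof.
rewrite -!nneseriesZl// -nneseriesD//.
  apply: lee_nneseries => // k _.
  rewrite -!EFinM -EFinD lee_fin !fctE.
  have := powR_ge0 (lam k) (2 * r); set a := _ `^ _; move=> a0.
  have -> : 2 * (a * f k ^+ 2) + 2 * (a * g k ^+ 2) =
    a * (2 * f k ^+ 2 + 2 * g k ^+ 2) by ring.
  rewrite ler_wpM2l//; have := sqr_ge0 (f k - g k); rewrite !expr2; lra.
all: by move=> k _ _; rewrite mule_ge0.
Qed.

Lemma hnorm2Z r c f : hn r (c *: f) = ((c ^+ 2)%:E * hn r f)%E.
Proof.
rewrite -nneseriesZl//; apply: eq_eseriesr => k _.
by rewrite -EFinM !fctE exprMn mulrCA.
Qed.

Lemma hnorm2N r f : hn r (- f) = hn r f.
Proof. by rewrite -scaleN1r hnorm2Z sqrrN expr1n mul1e. Qed.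

Lemma hnorm2BC r f g : hn r (f - g) = hn r (g - f).
Proof. by rewrite -hnorm2N opprB. Qed.

Lemma hnorm2_0 r : hn r (0 : nat -> R) = 0%E.
Proof. by rewrite /hnorm2 eseries0// => k _ _; rewrite [X in X ^+ 2](_ : _ = 0)// expr0n mulr0. Qed.

Lemma hscale0 r : hscale lam r (0 : nat -> R).
Proof. by rewrite /hscale/= hnorm2_0. Qed.

Lemma hscaleD r f g : hscale lam r f -> hscale lam r g -> hscale lam r (f + g).
Proof.
rewrite /hscale/= => hf hg; apply: (le_lt_trans (hnorm2D_le r f g)).
by rewrite lte_add_pinfty// lte_mul_pinfty.
Qed.

Lemma hscaleZ r c f : hscale lam r f -> hscale lam r (c *: f).
Proof.
rewrite /hscale/= => hf; rewrite hnorm2Z lte_mul_pinfty ?lee_fin ?sqr_ge0//.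
Qed.

Lemma hscaleB r f g : hscale lam r f -> hscale lam r g -> hscale lam r (f - g).
Proof. by move=> hf hg; rewrite -scaleN1r; apply: hscaleD => //; exact: hscaleZ. Qed.

Lemma hnorm_ltE r f e : 0 < e -> (hnorm lam r f < e%:E)%E = (hn r f < (e ^+ 2)%:E)%E.
Proof.
move=> e0; rewrite /hnorm poweR12_sqrt//.
have := hnorm2_ge0 r f; case: (hn r f) => [x||]//=; rewrite lee_fin => x0.
rewrite !lte_fin -[in RHS](sqr_sqrtr x0) ltr_pXn2r// nnegrE//.
exact: ltW.
Qed.

Lemma hnorm_ge0 r f : (0 <= hnorm lam r f)%E.
Proof. exact: poweR_ge0. Qed.

Lemma hnorm_cvg0 (I : Type) (F : set_system I) {FF : Filter F} r (f : I -> nat -> R) :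
  (hn r (f i) @[i --> F] --> 0%E) <-> (hnorm lam r (f i) @[i --> F] --> 0%E).
Proof.
rewrite !cvge0P; [|by move=> i; exact: hnorm_ge0|by move=> i; exact: hnorm2_ge0].
split=> H e e0.
- by have := H (e ^+ 2) (exprn_gt0 _ e0); apply: filterS => i; rewrite hnorm_ltE.
- have s0 : 0 < Num.sqrt e by rewrite sqrtr_gt0.
  have := H _ s0; apply: filterS => i.
  by rewrite hnorm_ltE// sqr_sqrtr ?ltW.
Qed.

(** Young's inequality y <= e + y^2 / e. It bounds integrals of the norm by integrals of its square,
    in place of Cauchy-Schwarz. *)
Lemma hnorm_le_hnorm2 r f e : 0 < e ->
  (hnorm lam r f <= e%:E + (e^-1)%:E * hn r f)%E.
Proof.
move=> e0; rewrite /hnorm poweR12_sqrt//.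
have := hnorm2_ge0 r f; case: (hn r f) => [x||]//=.
  rewrite lee_fin => x0; rewrite -EFinM -EFinD lee_fin.
  rewrite -(ler_pM2l e0) mulrDr mulrA divff ?gt_eqF// mul1r.
  rewrite -{2}(sqr_sqrtr x0); set y := Num.sqrt x.
  have := sqr_ge0 (e - y); have := sqr_ge0 e; have := sqr_ge0 y.
  by rewrite !expr2; nra.
by move=> _; rewrite mulry gtr0_sg ?invr_gt0// mul1e addey// leey.
Qed.

(** Continuity of the coordinate functionals on H^r, through which statements in H^r become scalar
    ones. *)
Lemma hterm_le_hnorm r f k : 0 < lam k ->
  ((lam k `^ r * `|f k|)%:E <= hnorm lam r f)%E.
Proof.
move=> lk; rewrite /hnorm poweR12_sqrt//.
have -> : (lam k `^ r * `|f k|)%:E = sqrte (lam k `^ (2 * r) * f k ^+ 2)%:E.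
  congr (_%:E); rewrite [2 * r]mulrC powRrM (powR_mulrn 2) ?powR_ge0//.
  by rewrite -exprMn sqrtr_sqr normrM (ger0_norm (powR_ge0 _ _)).
by rewrite lee_sqrt// hnorm2_ge_term.
Qed.

Lemma hnorm2_tail_cvg r f : hscale lam r f ->
  (\sum_(n <= k <oo) (lam k `^ (2 * r) * f k ^+ 2)%:E)%E @[n --> \oo] --> 0%E.
Proof. by move=> hf; exact: nneseries_tail_cvg. Qed.

(* Weierstrass M-test: coordinatewise convergence under a summable bound. *)
Lemma hnorm2_cvg_dominated (I : Type) (F : set_system I) {FF : Filter F} r
    (f : I -> nat -> R) (b : nat -> R) :
  (\sum_(0 <= k <oo) (lam k `^ (2 * r) * b k)%:E < +oo)%E ->
  (\forall i \near F, forall k, f i k ^+ 2 <= b k) ->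
  (forall k, f i k @[i --> F] --> 0) ->
  hn r (f i) @[i --> F] --> 0%E.
Proof.
move=> blt fb f0.
(* That [b] is nonnegative is read off at some index in the filter, so the improper filter, for
   which everything converges, is treated apart. *)
have [F0|nF] := pselect (F set0).
  move=> A _.
  exact: (@filterS I F FF set0 ((fun i => hn r (f i)) @^-1` A) (@sub0set _ _) F0).
have {nF}PF : ProperFilter F by [].
have b0 k : 0 <= b k.
  by have [i /(_ k)] := filter_ex fb; apply: le_trans; exact: sqr_ge0.
have tb0 k : (0 <= (lam k `^ (2 * r) * b k)%:E)%E by rewrite lee_fin mulr_ge0 ?powR_ge0.
have tl := nneseries_tail_cvg blt (fun k _ => tb0 k).
have E (e : R) : 0 < e -> \forall i \near F, (hn r (f i) <= e%:E)%E.
  move=> e0; have e20 : 0 < e / 2 by rewrite divr_gt0.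
  have [n _ /(_ n (leqnn n))/= Hn] := (cvge0P (fun n => nneseries_ge0 (fun k _ _ => tb0 k))).1 tl _ e20.
  have hd : (\sum_(0 <= k < n) lam k `^ (2 * r) * f i k ^+ 2) @[i --> F] --> (0 : R).
    rewrite [X in _ --> X](_ : 0 = \sum_(0 <= k < n) lam k `^ (2 * r) * 0 ^+ 2); last first.
      by rewrite big1// => k _; rewrite expr0n mulr0.
    apply: cvg_big => [|k _]; [exact: add_continuous|apply: cvgM; [exact: cvg_cst|];
    exact: (cvg_comp _ _ (f0 k) (@exprn_continuous _ 2 0))].
  near=> i.
  rewrite (hnorm2_split _ _ n) [e in (_ <= e%:E)%E]splitr EFinD leeD//.
    by rewrite lee_fin ltW//; near: i; exact: (cvgr_lt _ hd).
  apply: le_trans (ltW Hn).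
  have Hi : forall k, f i k ^+ 2 <= b k by near: i.
  apply: lee_nneseries => // k _.
  by rewrite lee_fin ler_wpM2l ?powR_ge0.
apply/cvge0P => // e e0; have e20 : 0 < e / 2 by rewrite divr_gt0.
have := E _ e20; apply: filterS => i /le_lt_trans; apply.
by rewrite lte_fin ltr_pdivrMr// ltr_pMr// ltr1n.
Unshelve. all: by end_near. Qed.

(** The exponent 2 (r - s) is nonpositive, so a positive lower bound on the eigenvalues bounds the
    ratio of the weights: this is the embedding of H^s into H^r. *)
Lemma hnorm2_le_scale r s (l : R) f : 0 < l -> (forall k, l <= lam k) -> r <= s ->
  (hn r f <= (l `^ (2 * (r - s)))%:E * hn s f)%E.
Proof.
move=> l0 ll rs; rewrite -nneseriesZl//; apply: lee_nneseries => // k _.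
rewrite -EFinM lee_fin [leRHS]mulrA ler_wpM2r ?sqr_ge0//.
have lk : 0 < lam k by exact: lt_le_trans (ll k).
have -> : 2 * r = 2 * (r - s) + 2 * s by ring.
rewrite powRD; last by rewrite (gt_eqF lk) implybT.
rewrite ler_wpM2r ?powR_ge0// -[r - s]opprB mulrN !powRN lef_pV2 ?posrE ?powR_gt0//.
by apply: ge0_ler_powR; rewrite ?nnegrE ?(ltW l0) ?(ltW lk)// mulr_ge0// subr_ge0.
Qed.

Lemma hscale_le r s (l : R) f : 0 < l -> (forall k, l <= lam k) -> r <= s ->
  hscale lam s f -> hscale lam r f.
Proof.
move=> l0 ll rs hf; apply: (le_lt_trans (hnorm2_le_scale f l0 ll rs)).
by rewrite lte_mul_pinfty ?lee_fin ?powR_ge0.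
Qed.

End hilbert_norm.
#[export] Hint Resolve hterm_ge0 hnorm2_ge0 : core.

Section hilbert_measurability.
Context {R : realType}.
Variable lam : nat -> R.
Hypothesis lam_gt0 : forall k, 0 < lam k.
Implicit Types (f g : nat -> R) (r e : R) (k n : nat).

Local Notation hn := (hnorm2 lam).

Lemma measurable_hnorm2 d (T : measurableType d) (D : set T) r (X : T -> nat -> R) :
  (forall k, measurable_fun D (X ^~ k)) -> measurable_fun D (fun x => hn r (X x)).
Proof.
move=> mX; apply: (ge0_emeasurable_sum (P := xpredT)) => [//|k _].
by apply/measurable_EFinP; apply: measurable_funM => //; exact: measurable_funX.
Qed.

(** Finitely supported rational sequences, indexed by a countable type; they are dense in every
    H^r. *)
Let center (c : seq rat) : nat -> R := fun k => ratr (nth 0 c k).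

Let center_hscale r (c : seq rat) : hscale lam r (center c).
Proof.
rewrite /hscale/= (hnorm2_split _ _ _ (size c)) (_ : (\sum_(_ <= k <oo) _)%E = 0%E) ?adde0 ?ltry//.
rewrite -(@nneseries_addn _ (fun k => (lam k `^ (2 * r) * center c k ^+ 2)%:E))//.
rewrite eseries0// => k _ _.
by rewrite /center nth_default ?leq_addl// rmorph0 expr0n mulr0.
Qed.

(** Half of [e] pays for the tail beyond n, and each of the first n coordinates may spend e / 2 / (n
    + 1) of the other half. *)
Let center_dense r f e : hscale lam r f -> 0 < e ->
  exists c, (hn r (f - center c)%R < e%:E)%E.
Proof.
move=> hf e0; have e20 : 0 < e / 2 by rewrite divr_gt0.
have [n _ /(_ n (leqnn n))/= Hn] := (cvge0P
  (fun n => nneseries_ge0 (fun k _ _ => hterm_ge0 lam r f k))).1 (hnorm2_tail_cvg hf) _ e20.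
have [q Hq] : {q : nat -> rat & forall k,
    lam k `^ (2 * r) * (f k - ratr (q k)) ^+ 2 <= e / 2 / n.+1%:R}.
  apply: (@choice _ _ (fun k y => lam k `^ (2 * r) * (f k - ratr y) ^+ 2 <= e / 2 / n.+1%:R)) => k.
  set a := _ `^ _; set b := e / 2 / _.
  have a0 : 0 <= a by exact: powR_ge0.
  have b0 : 0 < b by rewrite divr_gt0.
  have c0 : 0 < b / (a + 1) by rewrite divr_gt0// ltr_wpDl.
  have h0 : 0 < Num.sqrt (b / (a + 1)) by rewrite sqrtr_gt0.
  have [q] : exists q, ratr q \in `](f k - Num.sqrt (b / (a + 1))), (f k + Num.sqrt (b / (a + 1)))[.
    by apply: rat_in_itvoo; lra.
  rewrite in_itv/= => /andP[q1 q2]; exists q.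
  have : (f k - ratr q) ^+ 2 <= b / (a + 1).
    rewrite -(sqr_sqrtr (ltW c0)) -ler_sqrt ?exprn_ge0 ?sqrtr_ge0// !sqrtr_sqr.
    rewrite [leRHS]ger0_norm ?sqrtr_ge0// ler_norml; apply/andP.
    by split; move: q1 q2; set s := Num.sqrt _ => q1 q2; clearbody s; lra.
  move=> /(ler_wpM2l a0) /le_trans; apply.
  by rewrite mulrCA ger_pMr// ler_pdivrMr ?ltr_wpDl// mul1r lerDl.
exists (mkseq q n); rewrite (hnorm2_split _ _ _ n) [e]splitr EFinD.
rewrite lee_ltD//.
  rewrite lee_fin (@le_trans _ _ (\sum_(0 <= k < n) (e / 2 / n.+1%:R)))//.
    rewrite !big_nat; apply: ler_sum => k /andP[_ kn].
    by rewrite !fctE /center nth_mkseq.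
  rewrite sumr_const_nat subn0 -[leLHS]mulr_natl mulrA ler_pdivrMr ?ltr0n//.
  by rewrite mulrC ler_pM2l// ler_nat.
apply: le_lt_trans Hn; set h := f - _.
rewrite -(@nneseries_addn _ (fun k => (lam k `^ (2 * r) * h k ^+ 2)%:E))//.
rewrite -(@nneseries_addn _ (fun k => (lam k `^ (2 * r) * f k ^+ 2)%:E))// /h.
apply: lee_nneseries => // k _.
by rewrite lee_fin !fctE /center nth_default ?size_mkseq ?leq_addl// rmorph0 subr0.
Qed.

(** Separability: an open set of H^r is the union of the countably many rational balls it contains,
    and the preimage of a ball is a sublevel set of a series of measurable functions. This reduces
    measurability into H^r to that of the coordinates. *)
Lemma hopen_measurable d (T : measurableType d) r (X : T -> nat -> R) :
  (forall k, measurable_fun setT (X ^~ k)) ->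
  forall U, hopen lam r U -> measurable (X @^-1` U).
Proof.
move=> mX U [Us Uo].
pose B (c : seq rat) (m : nat) := [set f | hn r (f - center c)%R < (m.+1%:R^-1)%:E]%E.
pose F (p : seq rat * nat) : set T :=
  if `[< B p.1 p.2 `<=` U >] then X @^-1` (B p.1 p.2) else set0.
have -> : X @^-1` U = \bigcup_p F p.
  apply/seteqP; split=> [x /= Ux|x [[c m] _]]; last first.
    by rewrite /F/=; case: ifPn => // /asboolP; apply.
  have [e e0 He] := Uo _ Ux; have hx := Us _ Ux.
  (* The quasi-triangle inequality doubles each of two squared distances below 1 / (m + 1), whence
     the 4. *)
  have [m Hm] : exists m : nat, 4 * m.+1%:R^-1 < e ^+ 2.
    have e4 : 0 < e ^+ 2 / 4 by rewrite divr_gt0 ?exprn_gt0.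
    have [m _ /(_ m (leqnn m))/= H] := near_infty_natSinv_lt (PosNum e4).
    by exists m; rewrite mulrC -ltr_pdivlMr.
  have m0 : 0 < m.+1%:R^-1 :> R by rewrite invr_gt0.
  have [c Hc] := center_dense hx m0.
  exists (c, m) => //; rewrite /F/=; case: ifPn => [_ //|/asboolP[]].
  move=> g Bg; apply: He.
    rewrite -(subrK (center c) g); apply: hscaleD => //.
    by rewrite /hscale/=; apply: (lt_trans Bg); rewrite ltry.
  rewrite hnorm_ltE//.
  have -> : g - X x = (g - center c) + (center c - X x) by rewrite addrA subrK.
  apply: (le_lt_trans (hnorm2D_le _ _ _ _)).
  apply: (@le_lt_trans _ _ (4 * m.+1%:R^-1)%:E); last by rewrite lte_fin.
  have -> : 4 * m.+1%:R^-1 = 2 * m.+1%:R^-1 + 2 * m.+1%:R^-1 :> R by ring.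
  rewrite [leRHS]EFinD leeD// EFinM lee_pmul2l// ltW//.
  by rewrite hnorm2BC.
apply: countable_bigcupT_measurable => // p.
rewrite /F; case: ifPn => // _; rewrite /B.
have mXc : measurable_fun setT (fun x => hn r (X x - center p.1)%R).
  by apply: measurable_hnorm2 => k; exact: measurable_funB.
rewrite -[X in measurable X]setTI.
exact: (emeasurable_fun_infty_o _ mXc).
Qed.

(** Open subsets of H^r do not see how a map behaves where it leaves H^r, so its coordinates could
    be wild there; sending such values to 0 removes this freedom. *)
Definition hcut r f : nat -> R := if `[< hscale lam r f >] then f else 0.

Lemma hcut_hscale r f : hscale lam r (hcut r f).
Proof. by rewrite /hcut; case: ifPn => [/asboolP//|_]; exact: hscale0. Qed.

Lemma hcutE r f : hscale lam r f -> hcut r f = f.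
Proof. by rewrite /hcut => hf; case: asboolP. Qed.

Lemma hopen_hscale r : hopen lam r (hscale lam r).
Proof. by split => // f hf; exists 1. Qed.

Lemma hopen_coord_gt r k (a : R) : hopen lam r [set f | hscale lam r f /\ a < f k].
Proof.
split=> [f []//|f [hf afk]].
have l0 : 0 < lam k `^ r by rewrite powR_gt0.
exists (lam k `^ r * (f k - a)); first by rewrite mulr_gt0// subr_gt0.
move=> g hg /(le_lt_trans (hterm_le_hnorm _ _ (lam_gt0 k))).
rewrite lte_fin ltr_pM2l// !fctE ltr_norml => /andP[h _]; split => //; lra.
Qed.

Lemma measurable_hcut_coord d (T : measurableType d) r (X : T -> nat -> R) k :
  (forall U, hopen lam r U -> measurable (X @^-1` U)) ->
  measurable_fun setT (fun x => hcut r (X x) k).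
Proof.
move=> mX; apply: (measurability _ (RGenOInfty.measurableE R)) => _ [_ [a ->] <-].
rewrite setTI; set A := [set f | hscale lam r f /\ a < f k].
have mA : measurable (X @^-1` A) by apply: mX; exact: hopen_coord_gt.
have mH : measurable (X @^-1` hscale lam r) by apply: mX; exact: hopen_hscale.
(* Off H^r the cut value is 0, which exceeds [a] exactly when [a] is negative. *)
rewrite [X in measurable X](_ : _ = X @^-1` A `|` (if a < 0 then ~` (X @^-1` hscale lam r) else set0)).
  by apply: measurableU => //; case: ifP => // _; exact: measurableC.
apply/seteqP; split=> x /=; rewrite in_itv/= andbT /hcut.
  case: asboolP => [hx ax|hx ax]; first by left.
  by right; rewrite ax.
case: asboolP => [hx [[]//|]|hx [[]//|]]; by case: ifP.
Qed.

End hilbert_measurability.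

(** * Gaussian variables, independence and the maximal inequality *)

Section integral_facts.
Context {R : realType} {d : measure_display} {T : measurableType d}.
Implicit Types (mu nu : {measure set T -> \bar R}) (f g : T -> \bar R).
Local Open Scope ereal_scope.
Import HBNNSimple.

(* The integral of a nonnegative function is the supremum over the simple
   functions below it, even when the function is not measurable. *)
Lemma ae_le_integral_nonneg mu (D : set T) f g : measurable D ->
  (forall x, D x -> 0 <= f x) -> (forall x, D x -> 0 <= g x) ->
  measurable_fun D g -> {ae mu, forall x, D x -> f x <= g x} ->
  \int[mu]_(x in D) f x <= \int[mu]_(x in D) g x.
Proof.
move=> mD f0 g0 mg fg.
rewrite integral_mkcond [leRHS]integral_mkcond ge0_integralTE; last first.
  by move=> x; exact: erestrict_ge0.
apply: ge_ereal_sup => _ [h/= hf <-]; rewrite -integralT_nnsfun.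
apply: ae_ge0_le_integral => //.
- by move=> x _; rewrite lee_fin.
- exact/measurable_EFinP.
- by move=> x _; exact: erestrict_ge0.
- exact/(measurable_restrictT _ mD).
apply: filterS fg => x fg _; apply: le_trans (hf x) _.
by rewrite !patchE; case: ifPn => // /set_mem /fg.
Qed.

(** A simple function below [f] is also below [g], so the suprema compare without measurability on
    either side. *)
Lemma le_integral_nonneg mu (D : set T) f g :
  (forall x, D x -> 0 <= f x) -> (forall x, D x -> f x <= g x) ->
  \int[mu]_(x in D) f x <= \int[mu]_(x in D) g x.
Proof.
move=> f0 fg.
have g0 x : D x -> 0 <= g x by move=> Dx; rewrite (le_trans (f0 _ Dx)) ?fg.
rewrite integral_mkcond [leRHS]integral_mkcond !ge0_integralTE; last 2 first.
- by move=> x; exact: erestrict_ge0.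
- by move=> x; exact: erestrict_ge0.
apply: le_ereal_sup => _ [h/= hf <-]; exists h => // x.
by apply: (le_trans (hf x)); rewrite !patchE; case: ifPn => // /set_mem; exact: fg.
Qed.

Let integral_density_nnsfun mu nu (p : T -> R) (h : {nnsfun T >-> R}) :
  (forall x, 0 <= p x)%R -> measurable_fun setT p ->
  (forall A, measurable A -> nu A = \int[mu]_(x in A) (p x)%:E) ->
  \int[nu]_x (h x)%:E = \int[mu]_x ((h x)%:E * (p x)%:E).
Proof.
move=> p0 /measurable_EFinP mp nuE.
under [LHS]eq_integral do rewrite fimfunE -fsumEFin//.
rewrite [LHS]ge0_integral_fsum//; last 2 first.
  - by move=> r; exact/measurable_EFinP/measurableT_comp.
  - by move=> n x _; rewrite EFinM nnfun_muleindic_ge0.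
under [RHS]eq_integral.
  move=> x xD; rewrite fimfunE -fsumEFin// ge0_mule_fsuml; last first.
    by move=> r; rewrite EFinM nnfun_muleindic_ge0.
  over.
rewrite [RHS]ge0_integral_fsum//; last 2 first.
  - move=> r; apply: emeasurable_funM => //.
    exact/measurable_EFinP/measurableT_comp.
  - by move=> n x _; rewrite mule_ge0 ?lee_fin ?p0// -lee_fin EFinM nnfun_muleindic_ge0.
apply: eq_fsbigr => r _.
rewrite integralZl_indic_nnsfun//= integral_indic// setIT nuE//.
under [RHS]eq_integral do rewrite EFinM -muleA.
have [r0|r0] := ltP r 0%R.
  rewrite preimage_nnfun0// integral_set0 mule0 integral0_eq// => x _.
  by rewrite indic0 mul0e mule0.
rewrite [RHS]ge0_integralZl//; last 2 first.
  - by apply: emeasurable_funM => //; apply/measurable_EFinP.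
  - by move=> x _; rewrite mule_ge0 ?lee_fin.
congr (_ * _); rewrite integral_mkcond; apply: eq_integral => x _.
by rewrite patchE indicE; case: ifP => _; rewrite (mul1e,mul0e).
Qed.

Lemma integral_density mu nu (p : T -> R) f :
  (forall x, 0 <= p x)%R -> measurable_fun setT p ->
  (forall A, measurable A -> nu A = \int[mu]_(x in A) (p x)%:E) ->
  (forall x, 0 <= f x) -> measurable_fun setT f ->
  \int[nu]_x f x = \int[mu]_x (f x * (p x)%:E).
Proof.
move=> p0 mp nuE f0 mf; pose f_ := nnsfun_approx measurableT mf.
transitivity (limn (fun n => \int[nu]_x (f_ n x)%:E)).
  rewrite -monotone_convergence//=.
  - apply: eq_integral => x _; apply/esym/cvg_lim => //=.
    exact: cvg_nnsfun_approx.
  - by move=> n; exact/measurable_EFinP.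
  - by move=> n x _; rewrite lee_fin.
  - by move=> x _ a b ab; rewrite lee_fin//; exact/lefP/nd_nnsfun_approx.
rewrite (_ : \int[mu]_x _ = limn (fun n => \int[mu]_x ((f_ n x)%:E * (p x)%:E))); last first.
  rewrite -monotone_convergence//=.
  - apply: eq_integral => x _; apply/esym/cvg_lim => //.
    apply: cvgeZr => //.
    exact: cvg_nnsfun_approx.
  - by move=> n; apply: emeasurable_funM => //; exact/measurable_EFinP.
  - by move=> n x _; rewrite mule_ge0 ?lee_fin.
  - by move=> x _ a b ab; rewrite lee_wpmul2r// lee_fin//; exact/lefP/nd_nnsfun_approx.
by congr (limn _); apply/funext => n /=; exact: integral_density_nnsfun.
Qed.

End integral_facts.

Section independence.
Context {R : realType} {d : measure_display} {T : measurableType d}.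
Variable P : probability T R.
Local Open Scope ereal_scope.

Lemma integral_law d' (S : measurableType d') (X : T -> S) (f : S -> \bar R)
    (mX : measurable_fun setT X) :
  measurable_fun setT f -> (forall x, 0 <= f x) ->
  \int[distribution P (mfun_Sub (mem_set mX))]_y f y = \int[P]_x f (X x).
Proof.
move=> mf f0; rewrite ge0_integral_pushforward//; exact: measurable_fun.
Qed.

(** Rectangles determine a product measure, so independence identifies the joint law with the
    product of the marginal laws; Tonelli's theorem splits the integral. *)
Lemma integral_independent d1 d2 (S1 : measurableType d1) (S2 : measurableType d2)
    (X : T -> S1) (Y : T -> S2) (f : S1 * S2 -> \bar R) :
  measurable_fun setT X -> measurable_fun setT Y ->
  (forall A B, measurable A -> measurable B ->
    P (X @^-1` A `&` Y @^-1` B) = P (X @^-1` A) * P (Y @^-1` B)) ->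
  measurable_fun setT f -> (forall x, 0 <= f x) ->
  \int[P]_x f (X x, Y x) = \int[P]_x \int[P]_y f (X x, Y y).
Proof.
move=> mX mY XY mf f0.
have mXY : measurable_fun setT (fun x => (X x, Y x)) by exact/measurable_fun_pair.
rewrite -(integral_law mXY)//.
set m1 := distribution P (mfun_Sub (mem_set mX)).
set m2 := distribution P (mfun_Sub (mem_set mY)).
rewrite (eq_measure_integral (m1 \x m2)); last first.
  move=> A mA _; symmetry; apply: product_measure_unique => //.

rewrite fubini_tonelli1// /m1 integral_law//; last 2 first.
- exact: measurable_fun_fubini_tonelli_F.
- by move=> x; apply: integral_ge0.
apply: eq_integral => x _; rewrite /fubini_F integral_law//.
exact: (measurableT_comp mf (pair1_measurable _)).
Qed.

End independence.

Section normal_law.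
Context {R : realType}.
Implicit Types (v m x y a b c : R).
Local Notation mu := (@lebesgue_measure R).
Local Notation npdf v := (normal_pdf 0 (Num.sqrt v)).

Lemma normal_pdf_sqrtE v m x : 0 < v ->
  normal_pdf m (Num.sqrt v) x =
  (Num.sqrt v * Num.sqrt (pi *+ 2))^-1 * expR (- (x - m) ^+ 2 / (v *+ 2)).
Proof.
move=> v0; rewrite normal_pdfE ?gt_eqF ?sqrtr_gt0//.
rewrite /normal_peak /normal_fun sqr_sqrtr ?ltW//; congr (_^-1 * _).
by rewrite -mulrnAr sqrtrM ?ltW.
Qed.

Lemma normal_pdfN v x : 0 < v -> npdf v (- x) = npdf v x.
Proof. by move=> v0; rewrite !normal_pdf_sqrtE// !subr0 sqrrN. Qed.

Lemma integral_lebesgueN (G : R -> \bar R) :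
  measurable_fun setT G -> (forall x, 0 <= G x)%E ->
  (\int[mu]_x G (- x)%R = \int[mu]_x G x)%E.
Proof.
move=> mG G0.
have := @ge0_integral_pushforward _ _ (measurableTypeR R) (measurableTypeR R) R
  (-%R) (@oppr_measurable R setT) mu setT G measurableT mG (fun y _ => G0 y).
rewrite preimage_setT => <-.
by apply: eq_measure_integral => A mA _; exact: lebesgue_measureN.
Qed.

Lemma integral_affine_ray (G : R -> R) a b c : 0 < c -> continuous G ->
  (forall x, 0 <= G x) ->
  (\int[mu]_(x in `[(c * a + b)%R, +oo[) (G x)%:E =
   \int[mu]_(x in `[a, +oo[) (G (c * x + b) * c)%:E)%E.
Proof.
move=> c0 cG G0; pose F x := c * x + b.
have dF x : is_derive x 1 F c.
  by apply: is_derive_eq; rewrite addr0 scaler1.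
have F'E : F^`()%classic = cst c.
  by apply/funext => x; rewrite derive1E; apply: derive_val.
have := @increasing_ge0_integration_by_substitutiony R F G a.
rewrite F'E; apply => //.
- by move=> x y _ _ xy; rewrite /F ltrD2r ltr_pM2l.
- by move=> x _; exact: cvg_cst.
- exact: is_cvg_cst.
- exact: is_cvg_cst.
- split=> [x _|]; first exact: ex_derive.
  apply: cvg_at_right_filter; apply: differentiable_continuous.
  exact/derivable1_diffP/ex_derive.
- apply: cvg_comp (cvg_addrr _).
  by apply/gt0_cvgMry => //; exact: cvg_id.
- exact: continuous_subspaceT.
Qed.

(** Closed rays are stable under intersection, generate the Borel sets and exhaust the line. Laws
    are compared on rays throughout, because affine maps send rays to rays and continuous ramps
    approximate their indicators. *)
Lemma eq_measure_rays (m1 m2 : probability (measurableTypeR R) R) :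
  (forall a, m1 `[a, +oo[%classic = m2 `[a, +oo[%classic) ->
  forall B, measurable B -> m1 B = m2 B.
Proof.
move=> H B mB; refine (@measure_unique _ R (measurableTypeR R) (@RGenCInfty.G R) (fun k => `[- k%:R, +oo[%classic) _ _ _ _ m1 m2 _ _ B mB).
- exact: RGenCInfty.measurableE.
- move=> _ _ [x ->] [y ->]; exists (Num.max x y).
  apply/seteqP; split=> z /=; rewrite !in_itv/= !andbT ge_max.
    by move=> [-> ->].
  by move=> /andP[].
- by move=> i; exists (- i%:R).
- apply/seteqP; split=> // x _; exists (Num.trunc `|x|).+1 => //=.
  rewrite in_itv/= andbT lerNl (le_trans (ler_norm _))// normrN.
  by rewrite ltW// truncnS_gt.
- by move=> _ [x ->]; exact: H.
- move=> k; rewrite (le_lt_trans (probability_le1 _ _)) ?ltry//.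

Qed.

(* Completing the square: [N(0,v)] and [N(0,w)] convolve to [N(0,v+w)]. *)
Lemma normal_pdf_mul v w x y : 0 < v -> 0 < w ->
  npdf w (y - x) * npdf v x = npdf (v + w) y *
    normal_pdf (y * v / (v + w)) (Num.sqrt (v * w / (v + w))) x.
Proof.
move=> v0 w0; have vw0 : 0 < v + w by rewrite addr_gt0.
have z0 : 0 < v * w / (v + w) by rewrite divr_gt0 ?mulr_gt0.
rewrite !normal_pdf_sqrtE//.
rewrite mulrACA [RHS]mulrACA -!invfM -!expRD !subr0; congr (_^-1 * expR _).
  rewrite mulrACA [RHS]mulrACA -sqrtrM ?(ltW w0)// -sqrtrM ?(ltW vw0)//.
  have -> // : w * v = (v + w) * (v * w / (v + w)) by field; rewrite gt_eqF.
    by rewrite (sqrtrM (v * w / (v + w)) (ltW vw0)).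
  by rewrite mulrn_wge0// pi_ge0.
by field; rewrite !gt_eqF.
Qed.

Lemma integral_normal_pdf_mul v w y : 0 < v -> 0 < w ->
  (\int[mu]_x (npdf w (y - x) * npdf v x)%:E = (npdf (v + w) y)%:E)%E.
Proof.
move=> v0 w0; under eq_integral do rewrite normal_pdf_mul// EFinM.
rewrite ge0_integralZl// ?integral_normal_pdf ?mule1//.
- by apply/measurable_EFinP; exact: measurable_normal_pdf.
- by move=> x _; rewrite lee_fin normal_pdf_ge0.
- by rewrite lee_fin normal_pdf_ge0.
Qed.

End normal_law.

Section gaussian_facts.
Context {R : realType} {d : measure_display} {T : measurableType d}.
Variable P : probability T R.
Implicit Types (X Y : T -> R) (v c : R).
Local Notation mu := (@lebesgue_measure R).
Local Notation npdf v := (normal_pdf 0 (Num.sqrt v)).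

Lemma integral_gaussian X v (f : R -> \bar R) : gaussian P X v ->
  measurable_fun setT f -> (forall x, 0 <= f x)%E ->
  (\int[P]_x f (X x) = \int[mu]_x (f x * (npdf v x)%:E))%E.
Proof.
move=> [v0 mX PX] mf f0; rewrite -(@integral_law _ _ _ P _ (measurableTypeR R) X f mX)//.
apply: integral_density => //.
- exact: normal_pdf_ge0.
- exact: measurable_normal_pdf.
Qed.

(* The constant comes from [x^2 exp (- x^2 / 2v) <= 4v exp (- x^2 / 4v)] and
   [4 sqrt 2 <= 6]. *)
Lemma gaussian_sqr_le X v : gaussian P X v ->
  (\int[P]_x ((X x) ^+ 2)%:E <= (6 * v)%:E)%E.
Proof.
move=> gX; have [v0 mX _] := gX.
rewrite (integral_gaussian (f := fun x => (x ^+ 2)%:E) gX); last 2 first.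
- by apply/measurable_EFinP; exact: measurable_funX.
- by move=> x; rewrite lee_fin sqr_ge0.
have v20 : 0 < 2 * v by rewrite mulr_gt0.
apply: (@le_trans _ _ (\int[mu]_x ((6 * v)%:E * (npdf (2 * v) x)%:E))%E); last first.
  rewrite ge0_integralZl//= ?integral_normal_pdf ?mule1//.
  - by apply/measurable_EFinP; exact: measurable_normal_pdf.
  - by move=> x _; rewrite lee_fin normal_pdf_ge0.
  - by rewrite lee_fin mulr_ge0// ltW.
apply: ge0_le_integral => //.
- by move=> x _; rewrite mule_ge0// lee_fin ?sqr_ge0 ?normal_pdf_ge0.
- apply: emeasurable_funM; apply/measurable_EFinP; [exact: measurable_funX|].
  exact: measurable_normal_pdf.
- by apply: emeasurable_funM => //; apply/measurable_EFinP; exact: measurable_normal_pdf.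
move=> x _; rewrite -!EFinM lee_fin !normal_pdf_sqrtE// !subr0 sqrtrM// !invfM.
set s := Num.sqrt v; set K := Num.sqrt (pi *+ 2).
have s0 : 0 < s by rewrite sqrtr_gt0.
have K0 : 0 < K by rewrite sqrtr_gt0 mulrn_wgt0// pi_gt0.
have t0 : 0 < Num.sqrt 2 :> R by rewrite sqrtr_gt0.
pose w := x ^+ 2 / (4 * v).
have w0 : 0 <= w by rewrite divr_ge0 ?sqr_ge0// mulr_ge0// ltW.
have -> : - x ^+ 2 / (v *+ 2) = - w - w by rewrite /w; field; rewrite gt_eqF.
have -> : - x ^+ 2 / ((2 * v) *+ 2) = - w by rewrite /w; field; rewrite gt_eqF.
have -> : x ^+ 2 = 4 * v * w by rewrite /w; field; rewrite gt_eqF.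
rewrite expRD; set E := expR (- w).
have E0 : 0 < E by exact: expR_gt0.
have wE : w * E <= 1.
  rewrite /E expRN ler_pdivrMr ?expR_gt0// mul1r (le_trans _ (expR_ge1Dx _))//.
  by rewrite lerDr.
have t32 : 2 / 3 <= (Num.sqrt 2)^-1 :> R.
  rewrite -[leLHS]invrK lef_pV2 ?posrE// ?invr_gt0 ?divr_gt0//.
  rewrite -(ler_pXn2r (n := 2)) ?nnegrE ?ltW ?invr_gt0 ?divr_gt0// sqr_sqrtr//.
  by rewrite exprVn; lra.
have -> : 4 * v * w * (s^-1 * K^-1 * (E * E)) = (w * E) * (4 * (v * (s^-1 * K^-1 * E))) by ring.
have -> : 6 * v * ((Num.sqrt 2)^-1 * s^-1 * K^-1 * E) = (6 * (Num.sqrt 2)^-1) * (v * (s^-1 * K^-1 * E)) by ring.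
have A0 : 0 < v * (s^-1 * K^-1 * E) by rewrite !mulr_gt0 ?invr_gt0.
apply: (@le_trans _ _ (4 * (v * (s^-1 * K^-1 * E)))).
  by rewrite ler_piMl// mulr_ge0// ltW.
by rewrite ler_pM2r//; lra.
Qed.

(** Symmetry of the density. Comparing positive and negative parts keeps both sides nonnegative, so
    the identity can be used inside a Tonelli argument. *)
Lemma gaussian_centered X v c : gaussian P X v ->
  (\int[P]_x (Num.max (c * X x) 0)%:E = \int[P]_x (Num.max (- (c * X x)) 0)%:E)%E.
Proof.
move=> gX; have [v0 mX _] := gX.
have mf e : measurable_fun setT (fun x : R => (Num.max (e * x) 0)%:E).
  by apply/measurable_EFinP; apply: measurable_maxr => //; exact: measurable_funM.
have f0 (e x : R) : (0 <= (Num.max (e * x) 0)%:E)%E by rewrite lee_fin; case: (leP 0 (e * x)).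
under [RHS]eq_integral do rewrite -mulNr.
rewrite (integral_gaussian (f := fun x => (Num.max (c * x) 0)%:E) gX)//.
rewrite (integral_gaussian (f := fun x => (Num.max (- c * x) 0)%:E) gX)//.
rewrite -[LHS]integral_lebesgueN.
- by apply: eq_integral => x _; rewrite normal_pdfN// mulrN mulNr.
- by apply: emeasurable_funM => //; apply/measurable_EFinP; exact: measurable_normal_pdf.
- by move=> x; rewrite mule_ge0// lee_fin normal_pdf_ge0.
Qed.

Lemma gaussian_rayP X v : 0 < v -> measurable_fun setT X ->
  (forall a : R, P (X @^-1` `[a, +oo[) = normal_prob 0 (Num.sqrt v) `[a, +oo[) ->
  gaussian P X v.
Proof.
move=> v0 mX H; split => // B mB.
pose X' := @mfun_Sub _ _ T (measurableTypeR R) X (mem_set mX).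
exact: (@eq_measure_rays _ (distribution P X') (normal_prob 0 (Num.sqrt v))).
Qed.

Lemma gaussian_ray X v (a : R) : gaussian P X v ->
  P (X @^-1` `[a, +oo[) = normal_prob 0 (Num.sqrt v) `[a, +oo[.
Proof. by move=> [_ _ ->]. Qed.

Lemma gaussian_scale X v c : 0 < c -> gaussian P X v ->
  gaussian P (fun x => c * X x) (c ^+ 2 * v).
Proof.
move=> c0 gX; have [v0 mX _] := gX.
have cv0 : 0 < c ^+ 2 * v by rewrite mulr_gt0 ?exprn_gt0.
apply: gaussian_rayP => //; first exact: measurable_funM.
move=> a.
have -> : (fun x => c * X x) @^-1` `[a, +oo[ = X @^-1` `[a / c, +oo[.
  by apply/seteqP; split=> x /=; rewrite !in_itv/= !andbT ler_pdivrMr// mulrC.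
rewrite (gaussian_ray _ gX) /normal_prob.
have {2}-> : a = c * (a / c) + 0 by rewrite addr0; field; rewrite gt_eqF.
rewrite integral_affine_ray//; last 2 first.
- by apply: continuous_normal_pdf; rewrite gt_eqF// sqrtr_gt0.
- exact: normal_pdf_ge0.
apply: eq_integral => x _; congr (_%:E); rewrite addr0.
rewrite !normal_pdf_sqrtE// !subr0 sqrtrM ?sqr_ge0// sqrtr_sqr gtr0_norm// exprMn.
have -> : - (c ^+ 2 * x ^+ 2) / ((c ^+ 2 * v) *+ 2) = - x ^+ 2 / (v *+ 2).
  by field; rewrite !gt_eqF.
set s := Num.sqrt v; set K := Num.sqrt (pi *+ 2).
have s0 : 0 < s by rewrite sqrtr_gt0.
have K0 : 0 < K by rewrite sqrtr_gt0 mulrn_wgt0// pi_gt0.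
by field; rewrite !gt_eqF.
Qed.

(** With the value of [X] frozen, the probability of a ray is an integral of the density of [Y]
    translated by that value; exchanging the integrals leaves the convolution of the two
    densities. *)
Lemma gaussian_add X Y v w : gaussian P X v -> gaussian P Y w ->
  (forall A B, measurable A -> measurable B ->
    P (X @^-1` A `&` Y @^-1` B) = P (X @^-1` A) * P (Y @^-1` B))%E ->
  gaussian P (fun x => X x + Y x) (v + w).
Proof.
move=> gX gY XY; have [v0 mX _] := gX; have [w0 mY _] := gY.
apply: gaussian_rayP; [exact: addr_gt0|exact: measurable_funD|move=> a].
have mA : measurable (`[a, +oo[%classic : set R) by exact: measurable_itv.
have mN e : measurable_fun setT (fun x : R => npdf e x) by exact: measurable_normal_pdf.
pose f (p : R * R) : \bar R := (\1_(`[a, +oo[%classic : set R) (p.1 + p.2))%:E.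
have mf : measurable_fun setT f.
  apply/measurable_EFinP; apply: measurableT_comp; first exact: measurable_indic.
  exact: measurable_funD.
have f0 p : (0 <= f p)%E by rewrite lee_fin.
transitivity (\int[P]_x f (X x, Y x))%E.
  rewrite -[X in P X]setIT -integral_indic//; last first.
    by rewrite -[X in measurable X]setTI; exact: measurable_funD.
rewrite (integral_independent mX mY XY mf f0).
pose k (s y : R) : R := \1_(`[a, +oo[%classic : set R) y * npdf w (y - s).
have kE s : (\int[P]_y f (s, Y y) = \int[mu]_y (k s y)%:E)%E.
  transitivity (P (Y @^-1` `[a - s, +oo[)).
    rewrite -[X in P X]setIT -integral_indic//; last first.
      by rewrite -[X in measurable X]setTI; exact: mY.
    apply: eq_integral => y _; rewrite /f/=; congr (_%:E).
    by rewrite !indicE; congr (_%:R); congr nat_of_bool; apply/idP/idP;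
      rewrite !inE/= !in_itv/= !andbT lerBlDl.
  rewrite (gaussian_ray _ gY) /normal_prob.
  have -> : a - s = 1 * a + - s by rewrite mul1r.
  rewrite integral_affine_ray//; last 2 first.
  - by apply: continuous_normal_pdf; rewrite gt_eqF// sqrtr_gt0.
  - exact: normal_pdf_ge0.
  rewrite integral_mkcond; apply: eq_integral => y _.
  rewrite patchE /k indicE; case: ifP => _; last by rewrite mul0r.
  by rewrite !mul1r mulr1.
under eq_integral do rewrite kE.
have mk : measurable_fun setT (fun p : R * R => (k p.1 p.2)%:E).
  apply/measurable_EFinP; apply: measurable_funM.
    by apply: measurableT_comp; [exact: measurable_indic|exact: measurable_snd].
  by apply: (measurableT_comp (mN w)); exact: measurable_funB.
have k0 s y : 0 <= k s y by rewrite mulr_ge0 ?normal_pdf_ge0.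
rewrite (integral_gaussian (f := fun s => \int[mu]_y (k s y)%:E)%E gX); last 2 first.
- refine (@measurable_fun_fubini_tonelli_F _ _ (measurableTypeR R) (measurableTypeR R) R mu (fun p => (k p.1 p.2)%:E) _ _).
    exact: mk.
  by move=> p; rewrite lee_fin.
- by move=> s; apply: integral_ge0 => y _; rewrite lee_fin.
transitivity (\int[mu]_s \int[mu]_y (k s y * npdf v s)%:E)%E.
  apply: eq_integral => s _; rewrite -ge0_integralZr//.
  - by apply: (measurableT_comp mk (pair1_measurable _)).
  - by move=> y _; rewrite lee_fin.
  - by rewrite lee_fin normal_pdf_ge0.
rewrite (@fubini_tonelli _ _ (measurableTypeR R) (measurableTypeR R) R mu mu (fun p => (k p.1 p.2 * npdf v p.1)%:E)); last 2 first.
- apply/measurable_EFinP; apply: measurable_funM; first exact/measurable_EFinP.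
  by apply: (measurableT_comp (mN v)); exact: measurable_fst.
- by move=> p; rewrite lee_fin mulr_ge0 ?normal_pdf_ge0.
rewrite /normal_prob [RHS]integral_mkcond; apply: eq_integral => y _.
rewrite patchE /= /k indicE; case: ifP => ya.
  under eq_integral do rewrite mul1r.
  exact: integral_normal_pdf_mul.
by rewrite integral0_eq// => x _; rewrite !mul0r.
Qed.

(** A continuous majorant of the indicator of [a, +oo[: it is 1 on the ray and, for positive m,
    vanishes left of a - 1/m. It carries pointwise convergence of variables over to probabilities of
    rays. *)
Let ramp (a : R) (m : nat) (x : R) : R := Num.min 1 (Num.max 0 (m%:R * (x - a) + 1)).

Let ramp_ge0 a m x : 0 <= ramp a m x.
Proof. by rewrite /ramp /Num.min /Num.max; case: ifP => _; [|case: ifP => // h]; lra. Qed.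

Let ramp_le1 a m x : ramp a m x <= 1.
Proof. by rewrite /ramp; case: (leP 1 (Num.max 0 (m%:R * (x - a) + 1))) => // /ltW. Qed.

Let ramp_continuous a m : continuous (ramp a m).
Proof.
rewrite (_ : ramp a m = (fun=> 1) \min ((fun=> 0) \max (fun x => m%:R * (x - a) + 1)))//.
move=> x; apply: continuous_min; first exact: cvg_cst.
apply: continuous_max; first exact: cvg_cst.
by apply: cvgD; [apply: cvgM; [exact: cvg_cst|apply: cvgB; [exact: cvg_id|exact: cvg_cst]]|exact: cvg_cst].
Qed.

Let ramp_cvg a x : ramp a m x @[m --> \oo] --> (\1_(`[a, +oo[%classic : set R) x : R).
Proof.
rewrite indicE; case: (boolP (x \in _)).
  rewrite inE/= in_itv/= andbT => ax.
  rewrite (_ : ramp a ^~ x = cst 1); first exact: cvg_cst.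
  apply/funext => m /=; rewrite /ramp.
  have h : 1 <= m%:R * (x - a) + 1 by rewrite lerDr mulr_ge0// subr_ge0.
  by rewrite max_r ?(le_trans _ h)// min_l.
rewrite notin_setE/= in_itv/= andbT => /negP; rewrite -ltNge => xa.
apply: cvg_near_cst.
exists (Num.trunc ((a - x)^-1)).+1 => // m /= hm.
have ax0 : 0 < a - x by rewrite subr_gt0.
have h : m%:R * (x - a) + 1 <= 0.
  have : (a - x)^-1 <= m%:R.
    by rewrite (le_trans (ltW (truncnS_gt _)))// ler_nat.
  rewrite -(ler_pM2r ax0) mulVf ?gt_eqF// => h.
  have -> : m%:R * (x - a) = - (m%:R * (a - x)) by ring.
  by lra.
by rewrite /ramp max_l// min_r.
Qed.

Let ramp_integral_cvg (Q : probability (measurableTypeR R) R) a :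
  (\int[Q]_x (ramp a m x)%:E)%E @[m --> \oo] --> Q `[a, +oo[%classic.
Proof.
have mr m : measurable_fun setT (ramp a m) by apply: continuous_measurable_fun.
have -> : Q `[a, +oo[%classic = (\int[Q]_x (\1_(`[a, +oo[%classic : set R) x)%:E)%E.
  by rewrite integral_indic// setIT.
have [] := @dominated_convergence _ (measurableTypeR R) R Q setT measurableT
  (fun m x => (ramp a m x)%:E) (fun x => (\1_(`[a, +oo[%classic : set R) x)%:E) (cst 1%E) => //.
- by move=> m; apply/measurable_EFinP; exact: mr.
- by apply/measurable_EFinP; exact: measurable_indic.
- by apply: aeW => x _; apply/fine_cvgP; split; [exact: nearW|exact: ramp_cvg].
- exact: finite_measure_integrable_cst.
- by apply: aeW => x n _; rewrite /= lee_fin ger0_norm ?ramp_ge0 ?ramp_le1.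
Qed.

(** An integrable majorant common to all variances between v / 2 and 2 v: the exponential factor
    grows with the variance, and (v / 2)^(-1/2) = 2 (2 v)^(-1/2). *)
Let npdf_dominated v w x : 0 < v -> v / 2 < w -> w < 2 * v -> npdf w x <= 2 * npdf (2 * v) x.
Proof.
move=> v0 vw wv; have w0 : 0 < w by rewrite (lt_trans _ vw)// divr_gt0.
have v20 : 0 < 2 * v by rewrite mulr_gt0.
have K0 : 0 < Num.sqrt (pi *+ 2) :> R by rewrite sqrtr_gt0 mulrn_wgt0// pi_gt0.
rewrite !normal_pdf_sqrtE// !subr0 mulrA; apply: ler_pM; rewrite ?invr_ge0 ?mulr_ge0 ?sqrtr_ge0 ?expR_ge0//.
  rewrite !invfM mulrA ler_pM2r ?invr_gt0//.
  have -> : 2 * (Num.sqrt (2 * v))^-1 = (Num.sqrt (v / 2))^-1 :> R.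
    have -> : 2 * v = 2 ^+ 2 * (v / 2) by field.
    rewrite [in LHS]sqrtrM// sqrtr_sqr gtr0_norm// invfM mulrA divff ?mul1r//.
  rewrite lef_pV2 ?posrE ?sqrtr_gt0// ?divr_gt0//.
  by rewrite ler_sqrt ?ltW// divr_gt0.
rewrite ler_expR !mulNr lerN2 ler_wpM2l ?sqr_ge0// lef_pV2 ?posrE ?mulrn_wgt0//.
by rewrite ler_pMn2r// ltW.
Qed.

(** The mean of a ramp of [X n] is an integral against a normal density; dominated convergence
    applies to both expressions as n grows, and letting the ramp steepen recovers the rays. *)
Lemma gaussian_cvg (X : nat -> T -> R) (Y : T -> R) (v_ : nat -> R) v :
  (forall n, gaussian P (X n) (v_ n)) -> 0 < v -> v_ @ \oo --> v ->
  measurable_fun setT Y -> {ae P, forall x, X n x @[n --> \oo] --> Y x} ->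
  gaussian P Y v.
Proof.
move=> gX v0 vv mY XY; have v20 : 0 < 2 * v by rewrite mulr_gt0.
have mN e : measurable_fun setT (fun x : R => npdf e x) by exact: measurable_normal_pdf.
have mr a m : measurable_fun setT (ramp a m) by apply: continuous_measurable_fun.
(* Sequences are shifted by [N] below so that every variance lies in the range of the common
   majorant. *)
have [N _ HN] : \forall n \near \oo, v / 2 < v_ n /\ v_ n < 2 * v.
  near=> n; split; near: n; [apply: (cvgr_gt _ vv)|apply: (cvgr_lt _ vv)]; lra.
have E a m : (\int[P]_x (ramp a m (Y x))%:E = \int[mu]_x ((ramp a m x)%:E * (npdf v x)%:E))%E.
  have h1 : (\int[P]_x (ramp a m (X (n + N)%N x))%:E)%E @[n --> \oo] --> (\int[P]_x (ramp a m (Y x))%:E)%E.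
    have [] := @dominated_convergence _ T R P setT measurableT
      (fun n x => (ramp a m (X (n + N)%N x))%:E) (fun x => (ramp a m (Y x))%:E) (cst 1%E) => //.
    - move=> n; apply/measurable_EFinP; apply: (measurableT_comp (mr a m)).
      by have [_ + _] := gX (n + N)%N.
    - by apply/measurable_EFinP; exact: (measurableT_comp (mr a m)).
    - apply: filterS XY => x XYx _; apply/fine_cvgP; split; first exact: nearW.
      have XN : X (n + N)%N x @[n --> \oo] --> Y x by rewrite (cvg_shiftn N (X ^~ x)).
      exact: (cvg_comp _ _ XN (@ramp_continuous a m (Y x))).
    - exact: finite_measure_integrable_cst.
    - by apply: aeW => x n _; rewrite /= lee_fin ger0_norm ?ramp_ge0 ?ramp_le1.
  have h2 : (\int[mu]_x ((ramp a m x)%:E * (npdf (v_ (n + N)%N) x)%:E))%E @[n --> \oo] -->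
      (\int[mu]_x ((ramp a m x)%:E * (npdf v x)%:E))%E.
    have [] := @dominated_convergence _ (measurableTypeR R) R mu setT measurableT
      (fun n x => (ramp a m x * npdf (v_ (n + N)%N) x)%:E) (fun x => (ramp a m x * npdf v x)%:E)
      (fun x => 2%:E * (npdf (2 * v) x)%:E)%E => //.
    - by move=> n; apply/measurable_EFinP; apply: measurable_funM; [exact: mr|exact: mN].
    - by apply/measurable_EFinP; apply: measurable_funM; [exact: mr|exact: mN].
    - apply: aeW => x _; apply/fine_cvgP; split; first exact: nearW.
      apply: cvgM; first exact: cvg_cst.
      rewrite (cvg_shiftn N (fun n => npdf (v_ n) x)).
      have -> : (fun n => npdf (v_ n) x) = (fun n => (Num.sqrt (v_ n) * Num.sqrt (pi *+ 2))^-1 *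
          expR (- x ^+ 2 / (v_ n *+ 2))).
        by apply/funext => n; rewrite normal_pdf_sqrtE ?subr0//; have [] := gX n.
      rewrite normal_pdf_sqrtE// subr0.
      have K0 : 0 < Num.sqrt (pi *+ 2) :> R by rewrite sqrtr_gt0 mulrn_wgt0// pi_gt0.
      apply: cvgM.
        apply: cvgV; first by rewrite mulf_neq0// gt_eqF// sqrtr_gt0.
        apply: cvgM; last exact: cvg_cst.
        exact: (cvg_comp _ _ vv (@sqrt_continuous _ v)).
      have E1 : - (x : R) ^+ 2 / (v_ n *+ 2) @[n --> \oo] --> - (x : R) ^+ 2 / (v *+ 2).
        apply: cvgM; first exact: cvg_cst.
        apply: cvgV; first by rewrite gt_eqF// mulrn_wgt0.
        by rewrite mulr2n; under eq_fun do rewrite mulr2n; apply: cvgD.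
      exact: (cvg_comp _ _ E1 (@continuous_expR _ _)).
    - by apply: integrableZl => //; exact: integrable_normal_pdf.
    - apply: aeW => x n _; rewrite /= -EFinM lee_fin ger0_norm ?mulr_ge0 ?ramp_ge0 ?normal_pdf_ge0//.
      have [/= g1 g2] := HN (n + N)%N (leq_addl _ _).
      apply: le_trans (npdf_dominated x v0 g1 g2).
      by rewrite ler_piMl ?normal_pdf_ge0 ?ramp_le1.
  have h3 : (fun n => \int[P]_x (ramp a m (X (n + N)%N x))%:E)%E =
      (fun n => \int[mu]_x ((ramp a m x)%:E * (npdf (v_ (n + N)%N) x)%:E))%E.
    apply/funext => n; rewrite (integral_gaussian (f := fun x => (ramp a m x)%:E) (gX (n + N)%N))//.
    - by apply/measurable_EFinP; exact: mr.
    - by move=> x; rewrite lee_fin ramp_ge0.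
  by move: h1; rewrite h3 => h1; exact: (cvg_unique _ h1 h2).
have mY' : measurable_fun setT (Y : T -> measurableTypeR R) := mY.
pose Y' := @mfun_Sub _ _ T (measurableTypeR R) Y (mem_set mY').
apply: gaussian_rayP => // a.
have h1 := @ramp_integral_cvg (distribution P Y') a.
have h2 := @ramp_integral_cvg (normal_prob 0 (Num.sqrt v)) a.
have h3 : (fun m => \int[distribution P Y']_x (ramp a m x)%:E)%E =
  (fun m => \int[normal_prob 0 (Num.sqrt v)]_x (ramp a m x)%:E)%E.
  apply/funext => m.
  rewrite (@integral_law _ _ _ P _ (measurableTypeR R) Y (fun x => (ramp a m x)%:E) mY')//; last 2 first.
  - by apply/measurable_EFinP; exact: mr.
  - by move=> x; rewrite lee_fin ramp_ge0.
  rewrite E; symmetry; apply: integral_density => //.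
  - exact: normal_pdf_ge0.
  - exact: mN.
  - by move=> x; rewrite lee_fin ramp_ge0.
  - by apply/measurable_EFinP; exact: mr.
by move: h1; rewrite h3 => h1; exact: (cvg_unique _ h1 h2).
Unshelve. all: by end_near. Qed.

End gaussian_facts.

Section sub_sigma_algebra.
Context {R : realType} {d : measure_display} {T : measurableType d}.
Implicit Types (G : set (set T)) (X : T -> R).

(** Passing through the type generated by [G] gives access to the usual closure properties for a
    varying sigma-algebra; when [G] is a sigma-algebra, the generated one is [G] itself. *)
Definition measurable_wrt G X := measurable_fun (setT : set (g_sigma_algebraType G)) X.

Lemma measurable_wrt_sigma_of G X : sigma_of X `<=` G -> measurable_wrt G X.
Proof. by move=> XG _ B mB; apply: sub_sigma_algebra; apply: XG; exists B. Qed.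

Lemma measurable_wrt_preimage G X B : sigma_algebra setT G ->
  measurable_wrt G X -> measurable B -> G (X @^-1` B).
Proof.
move=> sG mX mB; have := mX measurableT B mB; rewrite setTI.
by rewrite /measurable/= sigma_algebra_id.
Qed.

Lemma sub_measurable_wrt G G' X : G `<=` G' -> measurable_wrt G X -> measurable_wrt G' X.
Proof.
move=> GG' mX _ B mB; apply: (sub_smallest2r _ GG'); first exact: smallest_sigma_algebra.
exact: mX.
Qed.

Lemma measurable_wrt_measurable G X : G `<=` measurable -> measurable_wrt G X ->
  measurable_fun setT X.
Proof.
move=> Gm mX _ B mB; apply: (smallest_sub (@sigma_algebra_measurable _ T) Gm).
exact: mX.
Qed.

End sub_sigma_algebra.

Section doob.
Context {R : realType}.
Implicit Type s : nat -> R.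

Fixpoint running_max s n : R :=
  if n is n'.+1 then Num.max (running_max s n') (s n) else s 0%N.

Lemma le_running_max s i n : (i <= n)%N -> s i <= running_max s n.
Proof.
elim: n => [|n IH] /=; first by rewrite leqn0 => /eqP ->.
rewrite leq_eqVlt => /predU1P[->|/IH h]; rewrite le_max ?lexx ?orbT//.
by rewrite h.
Qed.

(* The pathwise form of Doob's inequality: the sum is a discrete stochastic
   integral, which has mean zero when [s] is a martingale. *)
Lemma running_max_sqr s n :
  (running_max s n) ^+ 2 + 4 * \sum_(i < n) running_max s i * (s i.+1 - s i)
  <= 4 * (s n) ^+ 2.
Proof.
(* This form survives the induction, and it implies the claim: with M the maximum and y the last
   value, M^2 + 4 (M y - M^2 / 2) = 4 M y - M^2 <= 4 y^2 because (M - 2 y)^2 >= 0. *)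
suff : \sum_(i < n) running_max s i * (s i.+1 - s i) <=
    running_max s n * s n - (running_max s n) ^+ 2 / 2.
  have := sqr_ge0 (running_max s n - 2 * s n).
  by move: (\sum_(i < n) _) (running_max s n) (s n) => A m y; nra.
elim: n => [|n IH]; first by rewrite big_ord0 /= expr2; have := sqr_ge0 (s 0%N); rewrite expr2; lra.
rewrite big_ord_recr /=; apply: le_trans (lerD IH (lexx _)) _.
move: (running_max s n) (s n) (s n.+1) => m y z.
case: (leP m z) => h; last by lra.
by have := sqr_ge0 (m - z); nra.
Qed.

Lemma sqr_le_running_max s i n : (i <= n)%N ->
  s i ^+ 2 <= (running_max s n) ^+ 2 + (running_max (fun j => - s j) n) ^+ 2.
Proof.
move=> ni; have h1 := le_running_max s ni.
have h2 := le_running_max (fun j => - s j) ni; rewrite /= in h2.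
have [s0|s0] := leP 0 (s i).
  by apply: le_trans (_ : running_max s n ^+ 2 <= _); [rewrite ler_sqr ?nnegrE// (le_trans s0)|rewrite lerDl sqr_ge0].
rewrite -sqrrN; apply: le_trans (_ : running_max (fun j => - s j) n ^+ 2 <= _); last by rewrite lerDr sqr_ge0.
by rewrite ler_sqr ?nnegrE// ?(le_trans _ h2)// oppr_ge0 ltW.
Qed.

(** A crude bound, serving only to make the second moment of the running maximum finite. *)
Lemma running_max_sqr_le s n : running_max s n ^+ 2 <= \sum_(i < n.+1) s i ^+ 2.
Proof.
elim: n => [|n IH] /=; first by rewrite big_ord_recl big_ord0 addr0.
rewrite big_ord_recr /=; case: (leP (running_max s n) (s n.+1)) => h.
  by rewrite lerDr sumr_ge0// => i _; rewrite sqr_ge0.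
by apply: le_trans IH _; rewrite lerDl sqr_ge0.
Qed.

End doob.

Section gaussian_independent.
Context {R : realType} {d : measure_display} {T : measurableType d}.
Variable P : probability T R.
Implicit Types (X Y : T -> R).
Local Open Scope ereal_scope.

Lemma independent2_preimages G X Y A B : sigma_algebra setT G ->
  independent2 P G (sigma_of Y) -> measurable_wrt G X ->
  measurable A -> measurable B ->
  P (X @^-1` A `&` Y @^-1` B) = P (X @^-1` A) * P (Y @^-1` B).
Proof.
move=> sG GY mX mA mB; apply: GY; first exact: measurable_wrt_preimage mX mA.
by exists B => //; rewrite setTI.
Qed.

Lemma integrable_mul X Y : measurable_fun setT X -> measurable_fun setT Y ->
  \int[P]_x (X x ^+ 2)%:E < +oo -> \int[P]_x (Y x ^+ 2)%:E < +oo ->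
  P.-integrable setT (fun x => (X x * Y x)%:E).
Proof.
move=> mX mY X2 Y2; apply/integrableP; split.
  by apply/measurable_EFinP; exact: measurable_funM.
apply: (@le_lt_trans _ _ (\int[P]_x ((X x ^+ 2)%:E + (Y x ^+ 2)%:E))).
  apply: ge0_le_integral => //.
  - apply/measurable_EFinP; apply: measurableT_comp => //; exact: measurable_funM.
  - by apply: emeasurable_funD; apply/measurable_EFinP; exact: measurable_funX.
  - move=> x _; rewrite /= lee_fin normrM.
    rewrite -(real_normK (num_real (X x))) -(real_normK (num_real (Y x))).
    move: (normr_ge0 (X x)) (normr_ge0 (Y x)).
    by move: `|X x|%R `|Y x|%R => a b a0 b0; have := sqr_ge0 (a - b)%R; nra.
rewrite ge0_integralD//.
- by rewrite lte_add_pinfty.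
- by move=> x _; rewrite lee_fin sqr_ge0.
- by apply/measurable_EFinP; exact: measurable_funX.
- by move=> x _; rewrite lee_fin sqr_ge0.
- by apply/measurable_EFinP; exact: measurable_funX.
Qed.

(** For each frozen value of [X] the positive and negative parts of the product have equal means by
    symmetry of [Y]. Independence integrates this over [X], and square integrability allows the two
    parts to be subtracted. *)
Lemma gaussian_mul_centered X Y v :
  measurable_fun setT X -> gaussian P Y v ->
  (forall A B, measurable A -> measurable B ->
    P (X @^-1` A `&` Y @^-1` B) = P (X @^-1` A) * P (Y @^-1` B)) ->
  \int[P]_x (X x ^+ 2)%:E < +oo ->
  \int[P]_x (X x * Y x)%:E = 0.
Proof.
move=> mX gY XY X2; have [v0 mY _] := gY.
have Y2 : \int[P]_x (Y x ^+ 2)%:E < +oo by rewrite (le_lt_trans (gaussian_sqr_le gY))// ltry.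
have iXY := integrable_mul mX mY X2 Y2.
rewrite integralE.
have -> : \int[P]_x ((fun x => (X x * Y x)%:E)^\+ x) = \int[P]_x ((fun x => (X x * Y x)%:E)^\- x).
  have mf c : measurable_fun setT (fun p : R * R => (Num.max (c * (p.1 * p.2)) 0)%:E).
    apply/measurable_EFinP; apply: measurable_maxr => //.
    by apply: measurable_funM => //; exact: measurable_funM.
  have f0 (c : R) (p : R * R) : 0 <= (Num.max (c * (p.1 * p.2)) 0)%:E.
    by rewrite lee_fin; case: (leP 0%R (c * (p.1 * p.2))%R).
  transitivity (\int[P]_x (Num.max (1 * (X x * Y x)) 0)%:E).
    by apply: eq_integral => x _; rewrite funeposE EFin_max mul1r.
  rewrite (integral_independent mX mY XY (mf 1%R) (f0 1%R)).
  transitivity (\int[P]_x (Num.max (-1 * (X x * Y x)) 0)%:E); last first.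
    by apply: eq_integral => x _; rewrite funenegE EFin_max mulN1r.
  rewrite (integral_independent mX mY XY (mf (-1)%R) (f0 (-1)%R)).
  apply: eq_integral => x _.
  under eq_integral do rewrite mul1r; rewrite (gaussian_centered _ gY).
  by under [RHS]eq_integral do rewrite mulN1r.
rewrite subee//; apply: (integrable_neg_fin_num _ iXY) => //.
Qed.

End gaussian_independent.

Lemma measurable_bigmax {R : realType} d (T : measurableType d) (I : finType)
    (f : I -> T -> R) : (forall i, measurable_fun setT (f i)) ->
  measurable_fun setT (fun x => \big[Num.max/0]_i f i x).
Proof.
move=> mf; rewrite unlock; elim: (index_enum I) => [|i s IH] /=; first exact: measurable_cst.
exact: measurable_maxr.
Qed.

Section dyadic_supremum.
Context {R : realType}.
Implicit Types (f : R -> R) (t : R).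

(** Only countably many times enter, so the limit over n is measurable in the path; continuity makes
    it dominate the square at every time. The base value 0 of the maximum is harmless for
    squares. *)
Definition dyadic_sup f t n : R :=
  \big[Num.max/0]_(i < (2 ^ n).+1) (f (t * i%:R / (2 ^ n)%:R)) ^+ 2.

Lemma dyadic_sup_ge0 f t n : 0 <= dyadic_sup f t n.
Proof. exact: bigmax_ge_id. Qed.

Lemma dyadic_sup_nd f t : {homo dyadic_sup f t : m n / (m <= n)%N >-> m <= n}.
Proof.
apply/nondecreasing_seqP => n; apply: bigmax_le; first exact: dyadic_sup_ge0.
move=> i _; have hi : (2 * i < (2 ^ n.+1).+1)%N.
  by rewrite ltnS expnS leq_mul2l/= -ltnS.
apply: le_trans (le_bigmax _ _ (Ordinal hi)) => /=.
rewrite (_ : t * (2 * i)%:R / (2 ^ n.+1)%:R = t * i%:R / (2 ^ n)%:R)//.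
by rewrite expnS !natrM; field; rewrite pnatr_eq0 -lt0n expn_gt0.
Qed.

(** The time [s] is the limit of its dyadic roundings from the left, at each of which the bound
    holds by definition. *)
Lemma sqr_le_dyadic_sup f t s : 0 < t -> continuous f -> 0 <= s -> s <= t ->
  ((f s ^+ 2)%:E <= ereal_sup (range (fun n => (dyadic_sup f t n)%:E)))%E.
Proof.
move=> t0 cf s0 st.
pose k n := Num.trunc (s / t * (2 ^ n)%:R).
have p0 n : 0 < (2 ^ n)%:R :> R by rewrite ltr0n expn_gt0.
have st0 n : 0 <= s / t * (2 ^ n)%:R by rewrite mulr_ge0// divr_ge0// ltW.
have kn n : (k n < (2 ^ n).+1)%N.
  rewrite ltnS -(ler_nat R) (@le_trans _ _ (s / t * (2 ^ n)%:R)) ?truncn_le//.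
  by rewrite ger_pMl// ler_pdivrMr// mul1r.
pose u n := t * (k n)%:R / (2 ^ n)%:R.
have us : u n @[n --> \oo] --> s.
  apply/cvgrPdist_lt => e e0.
  have te : 0 < e / t by rewrite divr_gt0.
  have [N _ HN] := near_infty_natSinv_lt (PosNum te).
  exists N => // n Nn; have /= h := HN n Nn.
  have -> : s - u n = t / (2 ^ n)%:R * (s / t * (2 ^ n)%:R - (k n)%:R).
    by rewrite /u; field; rewrite !gt_eqF.
  rewrite normrM ger0_norm ?divr_ge0 ?ltW// ger0_norm; last first.
    by rewrite subr_ge0 truncn_le.
  apply: (@le_lt_trans _ _ (t / (2 ^ n)%:R * 1)).
    rewrite ler_wpM2l ?divr_ge0 ?(ltW t0)// lerBlDl natr1.
    exact/ltW/truncnS_gt.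
  rewrite mulr1 mulrC -ltr_pdivlMr//; apply: le_lt_trans h.
  by rewrite lef_pV2 ?posrE// ler_nat ltn_expl.
have fu : f (u n) ^+ 2 @[n --> \oo] --> f s ^+ 2.
  have fu := cvg_comp _ _ us (cf s).
  exact: (cvg_comp _ _ fu (@exprn_continuous _ 2 (f s))).
set M := ereal_sup _.
have uM n : ((f (u n) ^+ 2)%:E <= M)%E.
  apply: le_trans (ereal_sup_ubound _); last by exists n.
  by rewrite lee_fin; exact: (le_bigmax _ _ (Ordinal (kn n))).
have : (f (u n) ^+ 2)%:E @[n --> \oo] --> (f s ^+ 2)%:E.
  by apply/fine_cvgP; split => //; exact: nearW.
move=> h; rewrite -(cvg_lim _ h)//; apply: lime_le; last exact: nearW.
by apply/cvg_ex; eexists; exact: h.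
Qed.

End dyadic_supremum.

Section brownian_maximal.
Context {R : realType} {d : measure_display} {T : measurableType d}.
Variables (P : probability T R) (F : R -> set (set T)) (w : R -> T -> R).
Hypothesis sigF : forall t : R, 0 <= t -> sigma_algebra setT (F t).
Hypothesis subF : forall t : R, 0 <= t -> F t `<=` measurable.
Hypothesis monoF : forall s t : R, 0 <= s -> s <= t -> F s `<=` F t.
Hypothesis wB : brownian_motion P F w.

Lemma brownian_adapted (s t : R) : 0 <= s -> s <= t -> measurable_wrt (F t) (w s).
Proof.
move=> s0 st; apply: measurable_wrt_sigma_of; apply: subset_trans (monoF s0 st).
exact: bm_adapted wB _ s0.
Qed.

Lemma brownian_measurable (s : R) : 0 <= s -> measurable_fun setT (w s).
Proof.
by move=> s0; apply: (measurable_wrt_measurable (subF s0)); exact: brownian_adapted.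
Qed.

Lemma brownian_sqr_le (t : R) : 0 <= t -> (\int[P]_x (w t x ^+ 2)%:E <= (6 * t)%:E)%E.
Proof.
rewrite le_eqVlt => /predU1P[<-|t0].
  rewrite mulr0 (ge0_ae_eq_integral (g := cst 0%E)) ?integral0//.
  - by apply/measurable_EFinP; apply: measurable_funX; exact: brownian_measurable.
  - by move=> x _; rewrite lee_fin sqr_ge0.
  - by apply: filterS (bm_zero wB) => x -> _; rewrite expr0n.
have := gaussian_sqr_le (bm_increment wB (lexx 0) t0); rewrite subr0; apply: le_trans.
apply: ae_le_integral_nonneg => //.
- by move=> x _; rewrite lee_fin sqr_ge0.
- by move=> x _; rewrite lee_fin sqr_ge0.
- apply/measurable_EFinP; apply: measurable_funX; apply: measurable_funB;
    by apply: brownian_measurable => //; exact: ltW.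
- by apply: filterS (bm_zero wB) => x -> _; rewrite subr0.
Qed.

Section time_grid.
Variables (tau : nat -> R).
Hypothesis tau0 : 0 <= tau 0%N.
Hypothesis tau_incr : forall i, tau i < tau i.+1.

Let tau_mono i j : (i <= j)%N -> tau i <= tau j.
Proof.
elim: j => [|j IH]; first by rewrite leqn0 => /eqP ->.
by rewrite leq_eqVlt => /predU1P[->//|/IH /le_trans]; apply; exact: ltW.
Qed.

Let tau_ge0 i : 0 <= tau i.
Proof. exact: le_trans tau0 (tau_mono (leq0n i)). Qed.

Let rm (e : R) n x := running_max (fun i => e * w (tau i) x) n.

Let rm_adapted e n : measurable_wrt (F (tau n)) (rm e n).
Proof.
elim: n => [|n IH]; first by apply: measurable_funM => //; exact: brownian_adapted.
apply: measurable_maxr; first by apply: sub_measurable_wrt IH; apply: monoF => //; exact/ltW.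
by apply: measurable_funM => //; exact: brownian_adapted.
Qed.

Let sqr_lty e i : (\int[P]_x ((e * w (tau i) x) ^+ 2)%:E < +oo)%E.
Proof.
under eq_integral do rewrite exprMn EFinM.
rewrite ge0_integralZl//.
- by rewrite lte_mul_pinfty ?lee_fin ?sqr_ge0// (le_lt_trans (brownian_sqr_le _)) ?ltry.
- by apply/measurable_EFinP; apply: measurable_funX; exact: brownian_measurable.
- by move=> x _; rewrite lee_fin sqr_ge0.
- by rewrite lee_fin sqr_ge0.
Qed.

Let rm_sqr_lty e n : (\int[P]_x (rm e n x ^+ 2)%:E < +oo)%E.
Proof.
apply: (@le_lt_trans _ _ (\int[P]_x (\sum_(i < n.+1) ((e * w (tau i) x) ^+ 2)%:E))%E).
  apply: le_integral_nonneg => x _; first by rewrite lee_fin sqr_ge0.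
  by rewrite sumEFin lee_fin; exact: running_max_sqr_le.
rewrite ge0_integral_sum//.
- by apply: lte_sum_pinfty => i _; exact: sqr_lty.
- move=> i; apply/measurable_EFinP; apply: measurable_funX.
  by apply: measurable_funM => //; exact: brownian_measurable.
- by move=> i x _; rewrite lee_fin sqr_ge0.
Qed.

Let rm_measurable e n : measurable_fun setT (rm e n).
Proof. by apply: (measurable_wrt_measurable (subF (tau_ge0 n))); exact: rm_adapted. Qed.

Let incr_measurable i : measurable_fun setT (fun x => w (tau i.+1) x - w (tau i) x).
Proof. by apply: measurable_funB; exact: brownian_measurable. Qed.

Let rm_incr_integrable e i :
  P.-integrable setT (fun x => (rm e i x * (w (tau i.+1) x - w (tau i) x))%:E).
Proof.
apply: integrable_mul => //.
apply: le_lt_trans (ltry (6 * (tau i.+1 - tau i))).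
by apply: gaussian_sqr_le; exact: (bm_increment wB).
Qed.

(** The martingale property without conditional expectations: the running maximum is known at time
    [tau i], and the next increment is independent of [F (tau i)] and centred. *)
Let rm_incr_centered e i :
  (\int[P]_x (rm e i x * (w (tau i.+1) x - w (tau i) x))%:E = 0)%E.
Proof.
apply: (gaussian_mul_centered (v := tau i.+1 - tau i)) => //.
  exact: (bm_increment wB).
move=> A B; apply: (independent2_preimages (sigF (tau_ge0 i))) => //.
exact: (bm_independent wB).
Qed.

(** Taking means in the pathwise inequality removes the stochastic sum and leaves four times the
    last second moment. The pathwise inequality is one-sided, so it is used for the path and for its
    opposite. *)
Lemma brownian_running_max n :
  (\int[P]_x (running_max (fun i => w (tau i) x) n ^+ 2 +
              running_max (fun i => - w (tau i) x) n ^+ 2)%:E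
   <= (48 * tau n)%:E)%E.
Proof.
have H (e : R) : e ^+ 2 = 1 -> (\int[P]_x (rm e n x ^+ 2)%:E <= (24 * tau n)%:E)%E.
  move=> e1.
  pose A x := 4 * (w (tau n) x) ^+ 2.
  pose B x := \sum_(i < n) (4 * e) * (rm e i x * (w (tau i.+1) x - w (tau i) x)).
  have iA : P.-integrable setT (fun x => (A x)%:E).
    apply/integrableP; split.
      by apply/measurable_EFinP; apply: measurable_funM => //; apply: measurable_funX; exact: brownian_measurable.
    have A0 x : 0 <= A x by rewrite mulr_ge0 ?sqr_ge0.
    under eq_integral do rewrite /= ger0_norm ?A0// /A EFinM.
    rewrite ge0_integralZl//.
    - by rewrite lte_mul_pinfty// (le_lt_trans (brownian_sqr_le _)) ?ltry.
    - by apply/measurable_EFinP; apply: measurable_funX; exact: brownian_measurable.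
    - by move=> x _; rewrite lee_fin sqr_ge0.
  have iBi i : P.-integrable setT (fun x => ((4 * e) * (rm e i x * (w (tau i.+1) x - w (tau i) x)))%:E).
    by under eq_fun do rewrite EFinM; apply: integrableZl => //; exact: rm_incr_integrable.
  have iB : P.-integrable setT (fun x => (B x)%:E).
    under eq_fun do rewrite /B -sumEFin.
    by apply: integrable_sum => // i _; exact: iBi.
  have AB x : rm e n x ^+ 2 <= A x - B x.
    have := running_max_sqr (fun i => e * w (tau i) x) n.
    rewrite exprMn e1 mul1r -/(rm e n x) -/(A x) -lerBrDr => /le_trans; apply.
    rewrite lerD2l lerN2 mulr_sumr /B; apply: ler_sum => i _.
    by rewrite -/(rm e i x); lra.
  apply: (@le_trans _ _ (\int[P]_x ((A x)%:E - (B x)%:E))%E).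
    apply: ge0_le_integral => //.
    - by move=> x _; rewrite lee_fin sqr_ge0.
    - by apply/measurable_EFinP; apply: measurable_funX.
    - by apply: emeasurable_funB; [case/integrableP: iA|case/integrableP: iB].
    - by move=> x _; rewrite -EFinB lee_fin.
  rewrite integralB// (_ : \int[P]_x (B x)%:E = 0)%E.
    rewrite sube0 /A; under eq_integral do rewrite EFinM.
    rewrite ge0_integralZl//.
    - have -> : 24 * tau n = 4 * (6 * tau n) by ring.
      by rewrite EFinM lee_pmul2l//; exact: brownian_sqr_le.
    - by apply/measurable_EFinP; apply: measurable_funX; exact: brownian_measurable.
    - by move=> x _; rewrite lee_fin sqr_ge0.
  under eq_integral do rewrite /B -sumEFin.
  rewrite integral_sum// big1// => i _.
  under eq_integral do rewrite EFinM.
  by rewrite integralZl// ?rm_incr_centered ?mule0//; exact: rm_incr_integrable.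
have E1 x : running_max (fun i => w (tau i) x) n = rm 1 n x.
  by rewrite /rm; congr running_max; apply/funext => i; rewrite mul1r.
have EN1 x : running_max (fun i => - w (tau i) x) n = rm (-1) n x.
  by rewrite /rm; congr running_max; apply/funext => i; rewrite mulN1r.
under eq_integral do rewrite E1 EN1 EFinD.
rewrite ge0_integralD//.
- have -> : 48 * tau n = 24 * tau n + 24 * tau n by ring.
  by rewrite EFinD; apply: leeD; apply: H; rewrite ?sqrrN expr1n.
- by move=> x _; rewrite lee_fin sqr_ge0.
- by apply/measurable_EFinP; apply: measurable_funX.
- by move=> x _; rewrite lee_fin sqr_ge0.
- by apply/measurable_EFinP; apply: measurable_funX.
Qed.

End time_grid.

(* [48 = 6 * 4 * 2]: the moment bound, Doob's constant, and both signs. *)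
Lemma brownian_dyadic_sup (t : R) : 0 < t ->
  (\int[P]_x ereal_sup (range (fun n => (dyadic_sup (w ^~ x) t n)%:E))
   <= (48 * t)%:E)%E.
Proof.
move=> t0.
have md n : measurable_fun setT (fun x => (dyadic_sup (w ^~ x) t n)%:E).
  apply/measurable_EFinP; rewrite /dyadic_sup.
  apply: measurable_bigmax => i; apply: measurable_funX; apply: brownian_measurable.
  by rewrite divr_ge0// mulr_ge0// ltW.
have nd x : {homo (fun n => (dyadic_sup (w ^~ x) t n)%:E) : m n / (m <= n)%N >-> (m <= n)%E}.
  by move=> m n mn; rewrite lee_fin; exact: dyadic_sup_nd.
have ->: (fun x => ereal_sup (range (fun n => (dyadic_sup (w ^~ x) t n)%:E))) =
    (fun x => limn (fun n => (dyadic_sup (w ^~ x) t n)%:E)).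
  by apply/funext => x; apply/esym/cvg_lim => //; exact: ereal_nondecreasing_cvgn.
rewrite monotone_convergence//; last by move=> n x _; rewrite lee_fin dyadic_sup_ge0.
apply: lime_le.
  apply: ereal_nondecreasing_is_cvgn => m n mn; apply: le_integral_nonneg => x _.
    by rewrite lee_fin dyadic_sup_ge0.
  exact: nd.
apply: nearW => n.
have p0 : 0 < (2 ^ n)%:R :> R by rewrite ltr0n expn_gt0.
pose tau i := t * i%:R / (2 ^ n)%:R : R.
have tau0 : 0 <= tau 0%N by rewrite /tau mulr0 mul0r.
have tauS i : tau i < tau i.+1.
  by rewrite /tau ltr_pM2r ?invr_gt0// ltr_pM2l// ltr_nat.
have := brownian_running_max tau0 tauS (2 ^ n).
have -> : tau (2 ^ n)%N = t by rewrite /tau mulfK// gt_eqF.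
apply: le_trans; apply: le_integral_nonneg => x _; first by rewrite lee_fin dyadic_sup_ge0.
rewrite lee_fin; apply: bigmax_le; first by rewrite addr_ge0 ?sqr_ge0.
by move=> i _; apply: (sqr_le_running_max (fun i => w (tau i) x)); rewrite -ltnS.
Qed.

End brownian_maximal.

(** * Ornstein-Uhlenbeck paths, Volterra uniqueness and Bochner integrals *)

Section ornstein_uhlenbeck.
Context {R : realType}.
Implicit Types (a s t : R) (f w : R -> R).
Local Notation mu := (@lebesgue_measure R).

Lemma continuous_segment_integrable f s t : continuous f ->
  mu.-integrable `[s, t] (EFin \o f).
Proof.
move=> cf; apply: continuous_compact_integrable; first exact: segment_compact.
exact: continuous_subspaceT.
Qed.

(* The lower bound [-1] makes [0] an interior point; the integrands will vanish
   for negative times. *)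
Definition primitive f t : R := \int[mu]_(s in `[-1, t]) f s.

Lemma is_derive_primitive f t : continuous f -> -1 < t ->
  is_derive t 1 (primitive f) (f t).
Proof.
move=> cf t1.
have [] := @continuous_FTC1_closed R f (-1) t (t + 1) _ (continuous_segment_integrable _ _ cf) t1 (cf t).
  by rewrite ltrDl.
by move=> dF FE; rewrite -FE derive1E; exact: derivableP.
Qed.

Lemma primitive0 f : (forall s, s <= 0 -> f s = 0) -> primitive f 0 = 0.
Proof.
move=> f0; rewrite /primitive /Rintegral integral0_eq//.
by move=> s; rewrite /= in_itv/= => /andP[_ /f0 ->].
Qed.

Definition ou_weight a w := primitive (fun s => expR (a * s) * w s).

Definition ou_drift a w t := expR (- (a * t)) * ou_weight a w t.

(* The Ornstein-Uhlenbeck path [int_0^t exp (- a (t - s)) dw(s)], integrated by parts. *)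
Definition ou a w t := w t - a * ou_drift a w t.

Variables (a : R) (w : R -> R).
Hypothesis a_gt0 : 0 < a.
Hypothesis cw : continuous w.
Hypothesis w_le0 : forall s, s <= 0 -> w s = 0.

Let cew : continuous (fun s => expR (a * s) * w s).
Proof.
move=> s; apply: cvgM; last exact: cw.
apply: continuous_comp; last exact: continuous_expR.
by apply: cvgM; [exact: cvg_cst|exact: cvg_id].
Qed.

Let dexp (c : R) t : is_derive t 1 (fun s => expR (c * s)) (c * expR (c * t)).
Proof.
have h : is_derive t 1 (fun s => c * s) c by apply: is_derive_eq; rewrite /GRing.scale/=; ring.
by have := is_derive1_comp (is_derive_expR (c * t)) h; rewrite mulrC.
Qed.

Lemma is_derive_ou_weight t : -1 < t ->
  is_derive t 1 (ou_weight a w) (expR (a * t) * w t).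
Proof. exact: is_derive_primitive. Qed.

Lemma ou_weight0 : ou_weight a w 0 = 0.
Proof. by apply: primitive0 => s /w_le0 ->; rewrite mulr0. Qed.

(** The drift y solves y' = w - a y, and the right-hand side is the Ornstein-Uhlenbeck path;
    integrating gives the integral equation of that path. *)
Lemma is_derive_ou_drift t : -1 < t -> is_derive t 1 (ou_drift a w) (ou a w t).
Proof.
move=> t1; have h1 := is_derive_ou_weight t1; have h2 := dexp (- a) t.
have -> : ou_drift a w = (fun s => expR (- a * s)) * ou_weight a w.
  by apply/funext => s; rewrite /ou_drift fctE mulNr.
apply: is_derive_eq; rewrite /GRing.scale/= /ou /ou_drift -[w t]mul1r -[in X in _ = X * _ - _]expR0.
by rewrite -(addNr (a * t)) expRD mulNr; ring.
Qed.

Lemma ou_drift0 : ou_drift a w 0 = 0.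
Proof. by rewrite /ou_drift ou_weight0 mulr0. Qed.

Lemma ou_le0 : ou a w 0 = 0.
Proof. by rewrite /ou ou_drift0 mulr0 w_le0// subrr. Qed.

Lemma ou_drift_continuous t : -1 < t -> {for t, continuous (ou_drift a w)}.
Proof.
move=> t1; apply: differentiable_continuous; apply/derivable1_diffP.
by have := is_derive_ou_drift t1 => h; exact: ex_derive.
Qed.

Lemma ou_continuous t : -1 < t -> {for t, continuous (ou a w)}.
Proof.
move=> t1; apply: cvgB; first exact: cw.
by apply: cvgM; [exact: cvg_cst|exact: ou_drift_continuous].
Qed.

Lemma segment_continuous_within (f : R -> R) s t :
  (forall x, s <= x -> {for x, continuous f}) -> {within `[s, t], continuous f}.
Proof.
move=> cf; apply/continuous_in_subspaceT => x.
by rewrite inE/= in_itv/= => /andP[sx _]; exact: cf.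
Qed.

(** The difference of the two sides has derivative exp(a s) (M - e w(s)) >= 0, where [e] is a sign
    covering both inequalities for the absolute value. *)
Let ou_weight_bound t (M e : R) : e ^+ 2 = 1 -> 0 <= t ->
  (forall s, 0 <= s -> s <= t -> `|w s| <= M) ->
  e * ou_weight a w t <= M / a * (expR (a * t) - 1).
Proof.
move=> e1 t0 wM; have aN0 : a != 0 by rewrite gt_eqF.
pose k s := M / a * expR (a * s) - e * ou_weight a w s.
pose dk s := expR (a * s) * (M - e * w s).
have dkE s : -1 < s -> is_derive s 1 k (dk s).
  move=> s1; have h1 := is_derive_ou_weight s1; have h2 := dexp a s.
  by apply: is_derive_eq; rewrite /dk /GRing.scale/=; field.
have ck : {within `[0, t], continuous k}.
  apply: segment_continuous_within => x x0; apply: differentiable_continuous.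
  apply/derivable1_diffP; have h := @dkE x (lt_le_trans (ltrN10 R) x0); exact: ex_derive.
have [|c] := @MVT_segment R k dk 0 t t0 _ ck.
  by move=> x; rewrite in_itv/= => /andP[x0 _]; apply: dkE; rewrite (lt_trans _ x0)// ltrN10.
rewrite in_itv/= => /andP[c0 ct] kE.
have : 0 <= k t - k 0.
  rewrite kE subr0 mulr_ge0// mulr_ge0 ?expR_ge0// subr_ge0.
  apply: le_trans (ler_norm _) _; rewrite normrM.
  have -> : `|e| = 1.
    by apply/eqP; rewrite -(eqrXn2 (n := 2)) ?normr_ge0// real_normK ?num_real// e1 expr1n.
  by rewrite mul1r wM.
by rewrite /k ou_weight0 mulr0 expR0; lra.
Qed.

(** Both [w] and [a] times the drift are bounded by the square root of [M]. The bound does not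
    involve [a], so it is the same for all coordinates of the equation. *)
Lemma ou_sqr_le t (M : R) : 0 <= t -> (forall s, 0 <= s -> s <= t -> w s ^+ 2 <= M) ->
  ou a w t ^+ 2 <= 4 * M.
Proof.
move=> t0 wM; have M0 : 0 <= M by rewrite (le_trans _ (wM 0 _ _)) ?sqr_ge0.
set m := Num.sqrt M; have m0 : 0 <= m by exact: sqrtr_ge0.
have wm s : 0 <= s -> s <= t -> `|w s| <= m.
  by move=> s0 st; rewrite -sqrtr_sqr ler_sqrt// wM.
have aN0 : a != 0 by rewrite gt_eqF.
have H e : e ^+ 2 = 1 -> e * (a * ou_drift a w t) <= m.
  move=> e1; have h := ou_weight_bound e1 t0 wm.
  have -> : e * (a * ou_drift a w t) = a * expR (- (a * t)) * (e * ou_weight a w t).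
    by rewrite /ou_drift; ring.
  have ae0 : 0 < a * expR (- (a * t)) by rewrite mulr_gt0// expR_gt0.
  apply: le_trans (_ : a * expR (- (a * t)) * (m / a * (expR (a * t) - 1)) <= _).
    by rewrite ler_pM2l.
  have -> : a * expR (- (a * t)) * (m / a * (expR (a * t) - 1)) =
     m * (expR (- (a * t)) * expR (a * t) - expR (- (a * t))) by field.
  rewrite -expRD addNr expR0; rewrite ler_piMr// gerBl; exact: expR_ge0.
have h1 := H 1 (expr1n _ 2); have h2 : -1 * (a * ou_drift a w t) <= m by apply: H; rewrite sqrrN expr1n.
have : `|ou a w t| <= 2 * m.
  apply: le_trans (ler_normB _ _) _.
  have -> : 2 * m = m + m by ring.
  by apply: lerD; [exact: wm|rewrite ler_norml; apply/andP; split; lra].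
rewrite -(ler_sqr) ?nnegrE ?mulr_ge0// real_normK ?num_real// => /le_trans; apply.
by rewrite exprMn sqr_sqrtr// -natrX.
Qed.

(** Heine's theorem, with [y] free to leave the segment: continuity is assumed two-sided at every
    point of the segment. *)
Lemma segment_uniform_continuous (f : R -> R) s t (e : R) :
  (forall x, s <= x -> x <= t -> {for x, continuous f}) -> 0 < e ->
  exists2 r : R, 0 < r &
    forall x y, s <= x -> x <= t -> `|x - y| < r -> `|f x - f y| <= e.
Proof.
move=> cf e0.
have /compact_near_coveringP := @segment_compact R s t.
move=> /(_ R (0^'+) (fun r x => forall y, `|x - y| < r -> `|f x - f y| <= e)) [].
  move=> x /=; rewrite in_itv/= => /andP[sx xt].
  have e20 : 0 < e / 2 by rewrite divr_gt0.
  have /cvgrPdist_lt /(_ _ e20) /nbhs_ballP[r /= r0 Hr] := cf _ sx xt.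
  have r20 : 0 < r / 2 by rewrite divr_gt0.
  exists (ball x (r / 2), [set q | q < r / 2]); first split => /=.
  - exact: nbhsx_ballx.
  - exact: nbhs_right_lt.
  move=> [z q] /= [xz qr] y zy.
  have h1 := Hr z; have h2 := Hr y.
  have xz' : `|x - z| < r / 2 by [].
  have {}h1 : `|f x - f z| < e / 2 by apply: h1; rewrite /ball/= (lt_le_trans xz')// ler_pdivrMr// ler_peMr ?ltW//; lra.
  have {}h2 : `|f x - f y| < e / 2.
    apply: h2; rewrite /ball/= (_ : x - y = (x - z) + (z - y)); last by ring.
    by rewrite (le_lt_trans (ler_normD _ _))//; lra.
  rewrite (_ : f z - f y = (f x - f y) - (f x - f z)); last by ring.
  by rewrite (le_trans (ler_normB _ _))//; lra.
move=> r /= r0 Hr.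
have r20 : 0 < r / 2 by rewrite divr_gt0.
exists (r / 2) => // x y sx xt; apply: (Hr (r / 2)) => //=.
  by rewrite sub0r normrN gtr0_norm// ltr_pdivrMr// ltr_pMr// ltr1n.
by rewrite in_itv/= sx xt.
Qed.

Definition ou_sum t n : R := \sum_(i < n)
  expR (- (a * (t - t * i%:R / n%:R))) * (w (t * i.+1%:R / n%:R) - w (t * i%:R / n%:R)).

(** Telescoping the integrated-by-parts formula along the grid writes the error as a sum of
    increments of [k s = K s - c s * w (tau i.+1)]. Its derivative is a c(s) (w(s) - w(tau i.+1)),
    small by uniform continuity, so a cell costs at most a e' t / (n + 1). The choice e' = e / (a t
    + 1) makes the total at most e, also when t = 0. *)
Lemma ou_sum_cvg t : 0 <= t -> ou_sum t n.+1 @[n --> \oo] --> ou a w t.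
Proof.
move=> t0; apply/cvgrPdist_le => e e0.
pose e' := e / (a * t + 1).
have at0 : 0 <= a * t by rewrite mulr_ge0// ltW.
have e'0 : 0 < e' by rewrite divr_gt0// ltr_wpDl.
have [r r0 Hr] := @segment_uniform_continuous w 0 t e' (fun x _ _ => @cw x) e'0.
have rt : 0 < r / (t + 1) by rewrite divr_gt0// ltr_wpDl.
have [N _ HN] := near_infty_natSinv_lt (PosNum rt).
exists N => // n Nn; have /= hn := HN n Nn.
have n0 : 0 < n.+1%:R :> R by rewrite ltr0n.
have mesh : t / n.+1%:R < r.
  rewrite mulrC; move: hn; rewrite ltr_pdivlMr ?ltr_wpDl// => hn; apply: le_lt_trans hn.
  by rewrite ler_wpM2l ?invr_ge0 ?(ltW n0)// lerDl.
pose tau i := t * i%:R / n.+1%:R.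
have tau0 : tau 0%N = 0 by rewrite /tau mulr0 mul0r.
have taun : tau n.+1 = t by rewrite /tau mulfK// gt_eqF.
have tauS i : tau i.+1 - tau i = t / n.+1%:R.
  by rewrite /tau -mulrBl -mulrBr -natr1 addrC addKr mulr1.
pose c s := expR (- (a * (t - s))).
pose K s := a * expR (- (a * t)) * ou_weight a w s.
have telescope : ou a w t = \sum_(i < n.+1)
    ((c (tau i.+1) * w (tau i.+1) - K (tau i.+1)) - (c (tau i) * w (tau i) - K (tau i))).
  rewrite -(big_mkord xpredT (fun i => (c (tau i.+1) * w (tau i.+1) - K (tau i.+1)) - (c (tau i) * w (tau i) - K (tau i)))).
  rewrite (telescope_sumr (fun i => c (tau i) * w (tau i) - K (tau i)))// taun tau0.
  rewrite /c /K ou_weight0 (w_le0 (lexx 0)) subrr !mulr0 oppr0 expR0 mul1r /ou /ou_drift.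
  ring.
have -> : ou a w t - ou_sum t n.+1 = \sum_(i < n.+1)
    ((K (tau i) - c (tau i) * w (tau i.+1)) - (K (tau i.+1) - c (tau i.+1) * w (tau i.+1))).
  rewrite telescope /ou_sum -sumrB; apply: eq_bigr => i _.
  by rewrite -/(tau i) -/(tau i.+1) -/(c (tau i)); ring.
apply: le_trans (ler_norm_sum _ _ _) _.
apply: (@le_trans _ _ (\sum_(i < n.+1) (a * e' * (t / n.+1%:R)))); last first.
  rewrite sumr_const card_ord -[leLHS]mulr_natl /e'.
  have -> : n.+1%:R * (a * (e / (a * t + 1)) * (t / n.+1%:R)) = e * ((a * t) / (a * t + 1)).
    by field; rewrite !gt_eqF// ltr_wpDl.
  by rewrite ger_pMr// ler_pdivrMr ?ltr_wpDl// mul1r lerDl.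
apply: ler_sum => i _.
have ti0 : 0 <= tau i by rewrite /tau divr_ge0// mulr_ge0.
have tin : tau i.+1 <= t.
  by rewrite /tau ler_pdivrMr// ler_wpM2l// ler_nat.
pose k s := K s - c s * w (tau i.+1).
pose dk s := a * c s * (w s - w (tau i.+1)).
have dkE s : -1 < s -> is_derive s 1 k (dk s).
  move=> s1; have h1 := is_derive_ou_weight s1; have h2 := dexp a s.
  have cE : c = fun s => expR (- (a * t)) * expR (a * s).
    by apply/funext => x; rewrite /c -expRD; congr expR; ring.
  rewrite /k /K /dk cE.
  by apply: is_derive_eq; rewrite /GRing.scale/=; ring.
have tiS : tau i <= tau i.+1 by rewrite -subr_ge0 tauS divr_ge0// ltW.
have ck : {within `[tau i, tau i.+1], continuous k}.
  apply: segment_continuous_within => x x0; apply: differentiable_continuous.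
  apply/derivable1_diffP; have h := @dkE x (lt_le_trans (ltrN10 R) (le_trans ti0 x0)); exact: ex_derive.
have [|x] := @MVT_segment R k dk _ _ tiS _ ck.
  by move=> x; rewrite in_itv/= => /andP[x0 _]; apply: dkE; rewrite (lt_trans _ (le_lt_trans ti0 x0))// ltrN10.
rewrite in_itv/= => /andP[x0 x1] kE.
rewrite -/(k (tau i)) -/(k (tau i.+1)) distrC kE tauS normrM.
rewrite [X in _ * X]ger0_norm ?divr_ge0// ?(ltW n0)// ler_wpM2r ?divr_ge0 ?(ltW n0)//.
rewrite /dk !normrM (gtr0_norm a_gt0) -mulrA ler_pM2l//.
rewrite ger0_norm ?expR_ge0// -[leRHS]mul1r ler_pM ?expR_ge0//.
  by rewrite -expR0 ler_expR oppr_le0 mulr_ge0 ?(ltW a_gt0)// subr_ge0 (le_trans x1).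
apply: Hr; rewrite ?(le_trans ti0 x0) ?(le_trans x1 tin)//.
rewrite distrC ger0_norm ?subr_ge0//; apply: le_lt_trans mesh.
by rewrite -(tauS i) lerD2l lerN2.
Qed.

(** The integrand has the explicit primitive -(y0 / a) exp(-a s) + c times the drift, so the
    fundamental theorem of calculus evaluates the integral. *)
Lemma ou_equation t (y0 c : R) : 0 <= t ->
  expR (- (a * t)) * y0 + c * ou a w t =
  y0 - a * (\int[mu]_(s in `[0, t]) (expR (- (a * s)) * y0 + c * ou a w s)) + c * w t.
Proof.
rewrite le_eqVlt => /predU1P[<-|t0].
  rewrite set_itv1 Rintegral_set1 mulr0 subr0 ou_le0 w_le0// mulr0 !addr0.
  by rewrite oppr0 expR0 mul1r.
pose y s := expR (- (a * s)) * y0 + c * ou a w s.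
pose Y s := - (y0 / a) * expR (- a * s) + c * ou_drift a w s.
have aN0 : a != 0 by rewrite gt_eqF.
have dY s : -1 < s -> is_derive s 1 Y (y s).
  move=> s1; have h1 := is_derive_ou_drift s1; have h2 := dexp (- a) s.
  by apply: is_derive_eq; rewrite /y /GRing.scale/= !mulNr; field.
have cY s : -1 < s -> {for s, continuous Y}.
  move=> s1; apply: differentiable_continuous; apply/derivable1_diffP.
  by have h := dY s s1; exact: ex_derive.
have N10 (s : R) : 0 <= s -> -1 < s by apply: lt_le_trans; exact: ltrN10.
have cy : {within `[0, t], continuous y}.
  apply: segment_continuous_within => s s0.
  have h := ou_continuous (N10 _ s0).
  apply: cvgD; apply: cvgM; [|exact: cvg_cst|exact: cvg_cst|exact: h].
  apply: continuous_comp; last exact: continuous_expR.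
  by apply: cvgN; apply: cvgM; [exact: cvg_cst|exact: cvg_id].
have := @continuous_FTC2 R y Y 0 t t0 cy _ _.
rewrite -/y /Rintegral => ->.
- rewrite /= /Y ou_drift0 !mulr0 expR0 /ou !mulNr; field.
  exact: aN0.
- split.
  + move=> s; rewrite in_itv/= => /andP[s0 _].
    by have h := dY s (N10 _ (ltW s0)); exact: ex_derive.
  + by apply: cvg_at_right_filter; apply: cY; exact: N10.
  + by apply: cvg_at_left_filter; apply: cY; apply: N10; exact: ltW.
- move=> s; rewrite in_itv/= => /andP[s0 _]; rewrite derive1E.
  by have h := dY s (N10 _ (ltW s0)); exact: derive_val.
Qed.

End ornstein_uhlenbeck.

Section volterra.
Context {R : realType}.
Local Notation mu := (@lebesgue_measure R).

(** Integrability makes the primitive [D] continuous, the equation passes continuity on to [f] at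
    positive times, and thus D' = -a D there. Hence exp(a s) D(s) is constant, equal to its value 0
    at the origin. *)
Lemma volterra_unique (a : R) (f : R -> R) :
  (forall t, 0 < t -> mu.-integrable `[0, t] (EFin \o f)) ->
  (forall t, 0 <= t -> f t = - (a * \int[mu]_(s in `[0, t]) f s)) ->
  forall t, 0 <= t -> f t = 0.
Proof.
move=> intf fE t; rewrite le_eqVlt => /predU1P[<-|t0].
  by rewrite fE// set_itv1 Rintegral_set1 mulr0 oppr0.
pose D s := \int[mu]_(x in `[0, s]) f x.
have cD (s : R) : 0 < s -> {for s, continuous D}.
  move=> s0; have s20 : 0 < s + 1 by rewrite addr_gt0.
  have cw := @parameterized_integral_continuous R 0 (s + 1) f (ltW s20) (intf _ s20).
  have /continuous_within_itvP[//|ci _ _] := cw.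
  have /= h := ci s; apply: h.
  by rewrite in_itv/= s0 ltrDl ltr01.
have cDt : {within `[0, t], continuous D}.
  exact: (@parameterized_integral_continuous R 0 t f (ltW t0) (intf _ t0)).
have dD (s : R) : 0 < s -> is_derive s 1 D (- a * D s).
  move=> s0; have s20 : 0 < s + 1 by rewrite addr_gt0.
  have cf : {for s, continuous f}.
    apply: (@cvg_trans _ ((fun x => - (a * D x)) @ s)).
      apply: near_eq_cvg; exists s => //= x /=; rewrite ltr_distlC => /andP[h _].
      by rewrite fE//; lra.
    have h : - (a * D x) @[x --> s] --> - (a * D s).
      by apply: cvgN; apply: cvgM; [exact: cvg_cst|exact: cD].
    by rewrite fE ?ltW.
  have [] := @continuous_FTC1_closed R f 0 s (s + 1) _ (intf _ s20) s0 cf.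
    by rewrite ltrDl.
  move=> dF FE; have -> : - a * D s = f s by rewrite mulNr -fE// ltW.
  by rewrite -FE derive1E; exact: derivableP.
pose k s := expR (a * s) * D s.
have dk (s : R) : s \in `]0, t[%R -> is_derive s 1 k 0.
  rewrite in_itv/= => /andP[s0 _]; have h1 := dD s s0.
  have h : is_derive s 1 (fun s => a * s) a by apply: is_derive_eq; rewrite /GRing.scale/=; ring.
  have h2 := is_derive1_comp (is_derive_expR (a * s)) h.
  apply: is_derive_eq; rewrite /GRing.scale/=; ring.
have ck : {within `[0, t], continuous k}.
  move=> s; apply: cvgM; last exact: cDt.
  apply: (@continuous_subspaceT _ _ _ (fun s => expR (a * s))) => x.
  apply: continuous_comp; last exact: continuous_expR.
  by apply: cvgM; [exact: cvg_cst|exact: cvg_id].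
have [x _] := MVT t0 dk ck.
rewrite mul0r /k /D set_itv1 Rintegral_set1 mulr0 subr0 => /eqP.
rewrite mulf_eq0 gt_eqF ?expR_gt0//= => /eqP h.
by rewrite fE ?ltW// h mulr0 oppr0.
Qed.

End volterra.

Section bochner.
Context {R : realType}.
Variable lam : nat -> R.
Hypothesis lam_gt0 : forall k, 0 < lam k.
Local Notation mu := (@lebesgue_measure R).
Implicit Types (r t x : R) (k n : nat) (s : seq (set R * (nat -> R))).

Lemma fct_sumZE (I : Type) (u : seq I) (c : I -> R) (v : I -> nat -> R) k :
  (\sum_(p <- u) c p *: v p) k = \sum_(p <- u) c p * v p k.
Proof. by rewrite fct_sumE. Qed.

Lemma lebesgue_segment_lty t : (mu `[0%R, t]%classic < +oo)%E.
Proof.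
apply: (@le_lt_trans _ _ (lebesgue_measure [set` `[0, t]%R])) => //.
by rewrite lebesgue_measure_itv/=; case: ifP => _; rewrite ?ltry// -EFinB ltry.
Qed.

Let step_integrable1 (A : set R) (c : R) t : measurable A ->
  mu.-integrable `[0, t] (fun x => (\1_A x * c)%:E).
Proof.
move=> mA.
have mf : measurable_fun `[0, t] (fun x => \1_A x * c).
  by apply: measurable_funM => //; apply: measurable_funTS; exact: measurable_indic.
apply/integrableP; split; first exact/measurable_EFinP.
apply: (@le_lt_trans _ _ (\int[mu]_(x in `[0%R, t]) (cst `|c|%:E x))%E).
  apply: ge0_le_integral => //=.
  - by apply/measurable_EFinP; exact: measurableT_comp.
  - move=> x _; rewrite lee_fin normrM ler_piMl// indicE.
    by case: (x \in A); rewrite ?normr1 ?normr0.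
rewrite integral_cst// lte_mul_pinfty// ?lee_fin//.
exact: lebesgue_segment_lty.
Qed.

Lemma step_val_integrable r s t k : step_in lam r s ->
  mu.-integrable `[0, t] (fun x => (step_val s x k)%:E).
Proof.
move=> hs; rewrite (_ : (fun x => _) = (fun x => \sum_(p <- s) (\1_(p.1) x * p.2 k)%:E)%E); last first.
  by apply/funext => x; rewrite /step_val fct_sumZE sumEFin.
rewrite (_ : (fun x => _) = (fun x => \sum_(p <- s | p \in s) (\1_(p.1) x * p.2 k)%:E)%E); last first.
  by apply/funext => x; rewrite big_seq.
apply: (@integrable_sum _ _ _ mu _ _ _ s (mem s) (fun p x => (\1_(p.1) x * p.2 k)%:E)) => // p ps.
by have [mp _] := hs p ps; exact: step_integrable1.
Qed.

Lemma step_intE r s t k : step_in lam r s ->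
  step_int t s k = \int[mu]_(x in `[0, t]) step_val s x k.
Proof.
elim: s => [|p s IH] hs.
  rewrite /step_int big_nil /Rintegral integral0_eq// => x _.
  by rewrite /step_val big_nil.
have hs' : step_in lam r s by move=> q qs; apply: hs; rewrite inE qs orbT.
have [mp _] := hs p (mem_head _ _).
have -> : (fun x => step_val (p :: s) x k) = (fun x => \1_(p.1) x * p.2 k + step_val s x k).
  by apply/funext => x; rewrite /step_val big_cons.
rewrite /step_int big_cons fctE -/(step_int t s) IH//.
rewrite RintegralD//; [|exact: step_integrable1|exact: (step_val_integrable _ _ hs')].
congr (_ + _); rewrite RintegralZr//.
  by rewrite /Rintegral integral_indic// mulrC.
have := @step_integrable1 p.1 1 t mp; congr (integrable _ _ _).
by apply/funext => x; rewrite /= mulr1.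
Qed.

(** A coordinate is a bounded functional on H^r: applied to the approximating step functions, it
    turns the defining limits into scalar ones. Integrability follows from a single approximant at
    finite L^1 distance. *)
Lemma bochner_integral_coord r t (g : R -> nat -> R) (I : nat -> R) k :
  bochner_integral lam r t g I -> measurable_fun `[0, t] (g ^~ k) ->
  mu.-integrable `[0, t] (fun x => (g x k)%:E) /\ I k = \int[mu]_(x in `[0, t]) g x k.
Proof.
move=> [hI [s [hs _ hg hIs]]] mg.
have lk : 0 < lam k `^ r by rewrite powR_gt0.
have is_ n := step_val_integrable t k (hs n).
have mgs n : measurable_fun `[0, t] (fun x => g x k - step_val (s n) x k).
  by apply: measurable_funB => //; have /integrableP[/measurable_EFinP] := is_ n.
have gs n : ((lam k `^ r)%:E * \int[mu]_(x in `[0%R, t]) `|g x k - step_val (s n) x k|%:E <=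
    \int[mu]_(x in `[0%R, t]) hnorm lam r (g x - step_val (s n) x)%R)%E.
  rewrite -ge0_integralZl//; last 2 first.
  - by apply/measurable_EFinP; apply: measurableT_comp => //; exact: mgs.
  - by rewrite lee_fin powR_ge0.
  apply: le_integral_nonneg => x _; first by rewrite mule_ge0// lee_fin ?powR_ge0.
  by rewrite -EFinM; exact: hterm_le_hnorm.
have small (e : R) : 0 < e -> \forall n \near \oo,
    (\int[mu]_(x in `[0%R, t]) `|g x k - step_val (s n) x k|%:E < e%:E)%E.
  move=> e0; have el : 0 < lam k `^ r * e by rewrite mulr_gt0.
  have hn0 n : (0 <= \int[mu]_(x in `[0%R, t]) hnorm lam r (g x - step_val (s n) x)%R)%E.
    by apply: integral_ge0 => x _; exact: hnorm_ge0.
  have := (@cvge0P _ _ \oo eventually_filter _ hn0).1 hg _ el; apply: filterS => n hn.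
  have lk' : (lam k `^ r)%:E \is a fin_num by [].
  by rewrite -(lte_pmul2l lk')// ?lte_fin// -EFinM (le_lt_trans (gs n)).
have igs : \forall n \near \oo, mu.-integrable `[0, t] (fun x => (g x k - step_val (s n) x k)%:E).
  have := small 1 ltr01; apply: filterS => n hn; apply/integrableP; split; first by apply/measurable_EFinP; exact: mgs.
  by apply: (lt_trans _ (ltry 1)).
have ig : mu.-integrable `[0, t] (fun x => (g x k)%:E).
  have [n hn] := filter_ex igs.
  rewrite (_ : (fun x => _) = (fun x => (g x k - step_val (s n) x k)%:E + (step_val (s n) x k)%:E)%E).
    exact: integrableD.
  by apply/funext => x; rewrite -EFinD subrK.
split => //.
have h1 : `|I k - step_int t (s n) k| @[n --> \oo] --> (0 : R).
  apply/cvgrPdist_lt => e e0; have el : 0 < lam k `^ r * e by rewrite mulr_gt0.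
  have := (@cvge0P _ _ \oo eventually_filter _ (fun n => hnorm_ge0 lam r (I - step_int t (s n)))).1 hIs _ el.
  apply: filterS => n hn.
  rewrite sub0r normrN normr_id -(ltr_pM2l lk) -lte_fin.
  exact: le_lt_trans (hterm_le_hnorm r (I - step_int t (s n)) (lam_gt0 k)) hn.
have h2 : `|\int[mu]_(x in `[0, t]) g x k - step_int t (s n) k| @[n --> \oo] --> (0 : R).
  apply/cvgrPdist_lt => e e0; have := small e e0; apply: filterS2 igs => n hn1 hn2.
  rewrite sub0r normrN normr_id (step_intE _ _ (hs n)) -RintegralB//; last exact: is_.
  apply: le_lt_trans (le_normr_Rintegral _ _) _ => //.
  rewrite -lte_fin /Rintegral fineK//.
  rewrite ge0_fin_numE; first exact: lt_trans hn2 (ltry _).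
  by apply: integral_ge0 => x _; rewrite lee_fin.
have h12 : (fun n => `|I k - step_int t (s n) k| +
    `|\int[mu]_(x in `[0, t]) g x k - step_int t (s n) k|) @ \oo --> (0 : R).
  by rewrite -[X in _ --> X]addr0; exact: cvgD.
have h3 : (fun _ : nat => `|I k - \int[mu]_(x in `[0, t]) g x k|) @ \oo --> (0 : R).
  apply: (squeeze_cvgr _ (cvg_cst 0) h12).
  apply: nearW => n; rewrite normr_ge0/=.
  set J := \int[mu]_(x in _) _; rewrite -(subrKA (step_int t (s n) k)).
  by rewrite (le_trans (ler_normD _ _))// lerD2l distrC.
have hc : (fun _ : nat => `|I k - \int[mu]_(x in `[0, t]) g x k|) @ \oo -->
    `|I k - \int[mu]_(x in `[0, t]) g x k| by exact: cvg_cst.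
have hE : `|I k - \int[mu]_(x in `[0, t]) g x k| = 0.
  by rewrite -(cvg_lim (@norm_hausdorff _ R) hc); exact: (cvg_lim (@norm_hausdorff _ R) h3).
by move/eqP: hE; rewrite normr_eq0 subr_eq0 => /eqP.
Qed.

(** The half-open cells partition ]0, t]; the point 0 lies in none of them, which is why later
    comparisons on [0, t] hold almost everywhere. *)
Lemma cells_cover t m j x : 0 <= t ->
  \sum_(0 <= i < j) (\1_(`](t * i%:R / m%:R), (t * i.+1%:R / m%:R)]%classic : set R) x : R) =
  \1_(`]0, (t * j%:R / m%:R)]%classic : set R) x.
Proof.
move=> t0; elim: j => [|j IH].
  rewrite big_nil mulr0 mul0r indicE; case: (boolP (_ \in _)) => //.
  by rewrite inE/= in_itv/= => /andP[/lt_le_trans h /h]; rewrite ltxx.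
rewrite big_nat_recr//= IH !indicE.
set a := t * j%:R / m%:R; set b := t * j.+1%:R / m%:R.
have a0 : 0 <= a by rewrite divr_ge0// mulr_ge0.
have ab : a <= b by rewrite ler_wpM2r ?invr_ge0// ler_wpM2l// ler_nat.
rewrite !mem_setE !in_itv/=; case: (ltP 0 x) => x0 /=; last first.
  by rewrite [a < x]ltNge (le_trans x0 a0)/= addr0.
by case: (leP x a) => xa /=; rewrite ?(le_trans xa ab) ?addr0 ?add0r.
Qed.

Lemma uniform_radius (g : R -> nat -> R) t (e : R) n :
  (forall k x, 0 <= x -> x <= t -> {for x, continuous (g ^~ k)}) -> 0 < e ->
  exists2 q : R, 0 < q & forall k, (k < n)%N -> forall x y, 0 <= x -> x <= t ->
    `|x - y| < q -> `|g x k - g y k| <= e.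
Proof.
move=> cg e0; elim: n => [|n [q q0 Hq]]; first by exists 1.
have [r r0 Hr] := segment_uniform_continuous (cg n) e0.
exists (Num.min q r); first by rewrite lt_min q0.
move=> k; rewrite ltnS leq_eqVlt => /predU1P[->|kn] x y x0 xt; rewrite lt_min => /andP[h1 h2].
  exact: Hr.
exact: Hq.
Qed.

(** The step function keeps the first n coordinates, sampled at the right end of each cell of a fine
    uniform grid; the dropped coordinates are the tails on the right. For [I] the coordinate errors
    integrate to at most t times the pointwise ones. *)
Lemma step_approx r t (g : R -> nat -> R) (I : nat -> R) n : 0 <= t ->
  (forall k x, 0 <= x -> x <= t -> {for x, continuous (g ^~ k)}) ->
  (forall k, I k = \int[mu]_(x in `[0, t]) g x k) ->
  exists s, [/\ step_in lam r s,
    forall x, 0 < x -> x <= t -> (hnorm2 lam r (g x - step_val s x)%R <=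
      (n.+1%:R^-1)%:E + \sum_(n <= k <oo) (lam k `^ (2 * r) * g x k ^+ 2)%:E)%E &
    (hnorm2 lam r (I - step_int t s)%R <=
      (t ^+ 2 * n.+1%:R^-1)%:E + \sum_(n <= k <oo) (lam k `^ (2 * r) * I k ^+ 2)%:E)%E].
Proof.
move=> t0 cg IE.
pose W := \sum_(0 <= k < n) lam k `^ (2 * r).
have W0 : 0 <= W by rewrite sumr_ge0// => k _; exact: powR_ge0.
have W1 : 0 < 1 + W by rewrite ltr_pwDl.
(* Chosen so that an error of at most [e] in each of the first n coordinates costs at most 1 / (n +
   1) in squared norm. *)
pose e := Num.sqrt (n.+1%:R^-1 / (1 + W)).
have n0 : 0 < n.+1%:R :> R by rewrite ltr0n.
have e2 : e ^+ 2 = n.+1%:R^-1 / (1 + W) by rewrite sqr_sqrtr// divr_ge0 ?invr_ge0// ltW.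
have e0 : 0 < e by rewrite sqrtr_gt0 divr_gt0// invr_gt0.
have We2 : W * e ^+ 2 <= n.+1%:R^-1.
  rewrite e2 mulrCA ger_pMr ?invr_gt0// ler_pdivrMr// mul1r; lra.
have [q q0 Hq] := uniform_radius n cg e0.
have qt : 0 < q / (t + 1) by rewrite divr_gt0// ltr_wpDl.
have [m _ /(_ m (leqnn m))/= Hm] := near_infty_natSinv_lt (PosNum qt).
have m0 : 0 < m.+1%:R :> R by rewrite ltr0n.
have mesh : t / m.+1%:R < q.
  rewrite mulrC; move: Hm; rewrite ltr_pdivlMr ?ltr_wpDl// => Hm; apply: le_lt_trans Hm.
  by rewrite ler_wpM2l ?invr_ge0 ?(ltW m0)// lerDl.
pose A i : set R := `](t * i%:R / m.+1%:R), (t * i.+1%:R / m.+1%:R)]%classic.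
pose v i : nat -> R := fun k => if (k < n)%N then g (t * i.+1%:R / m.+1%:R) k else 0.
pose s := [seq (A i, v i) | i <- iota 0 m.+1].
have sval x k : step_val s x k = \sum_(0 <= i < m.+1) \1_(A i) x * v i k.
  by rewrite /step_val fct_sumZE big_map -[in RHS](subn0 m.+1).
have vn i k : (n <= k)%N -> v i k = 0 by rewrite /v leqNgt => /negbTE ->.
have sn x k : (n <= k)%N -> step_val s x k = 0.
  by move=> nk; rewrite sval big1// => i _; rewrite vn// mulr0.
have hs : step_in lam r s.
  move=> p /mapP[i _ ->]/=; split; first exact: measurable_itv.
  rewrite /hscale/= (hnorm2_split _ _ _ n) (_ : (\sum_(_ <= k <oo) _)%E = 0%E) ?adde0 ?ltry//.
  rewrite -(@nneseries_addn _ (fun k => (lam k `^ (2 * r) * v i k ^+ 2)%:E))//.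
  by rewrite eseries0// => k _ _; rewrite vn ?leq_addl// expr0n mulr0.
have close x k : 0 < x -> x <= t -> (k < n)%N -> `|g x k - step_val s x k| <= e.
  move=> x0 xt kn.
  have one : \sum_(0 <= i < m.+1) (\1_(A i) x : R) = 1.
    rewrite (cells_cover m.+1 m.+1 x t0) mulfK ?gt_eqF// indicE.
    by rewrite mem_setE in_itv/= x0 xt.
  rewrite sval -[g x k]mul1r -one mulr_suml -sumrB.
  apply: le_trans (ler_norm_sum _ _ _) _.
  rewrite -[leRHS]mul1r -one mulr_suml; apply: ler_sum => i _.
  rewrite -mulrBr normrM indicE mem_setE in_itv/=.
  case: (boolP (_ < x <= _)) => [/andP[h1 h2]|_]; last by rewrite normr0 !mul0r.
  rewrite normr1 !mul1r /v kn; apply: Hq => //; first exact: ltW.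
  rewrite distrC ger0_norm ?subr_ge0//; apply: le_lt_trans mesh.
  have -> : t / m.+1%:R = t * i.+1%:R / m.+1%:R - t * i%:R / m.+1%:R.
    by rewrite -mulrBl -mulrBr -natrB// subSnn mulr1.
  by rewrite lerD2l lerN2 ltW.
exists s; split => //.
- move=> x x0 xt; rewrite (hnorm2_split _ _ _ n); apply: leeD.
    rewrite lee_fin; apply: le_trans We2; rewrite mulr_suml.
    rewrite !big_nat; apply: ler_sum => k /andP[_ kn]; rewrite ler_wpM2l ?powR_ge0//.
    rewrite -(real_normK (num_real (_ k))) ler_sqr ?nnegrE ?normr_ge0 ?(ltW e0)//.
    exact: close.
  set h := g x - _.
  rewrite -(@nneseries_addn _ (fun k => (lam k `^ (2 * r) * h k ^+ 2)%:E))//.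
  rewrite -(@nneseries_addn _ (fun k => (lam k `^ (2 * r) * g x k ^+ 2)%:E))//.
  by apply: lee_nneseries => // k _; rewrite /h !fctE sn ?leq_addl// subr0.
- have sIn k : (n <= k)%N -> step_int t s k = 0.
    move=> nk; rewrite (step_intE _ _ hs) /Rintegral integral0_eq// => x _.
    by rewrite sn.
  rewrite (hnorm2_split _ _ _ n); apply: leeD.
    rewrite lee_fin; apply: le_trans (ler_wpM2l (sqr_ge0 t) We2).
    rewrite mulrCA -exprMn mulr_suml.
    rewrite !big_nat; apply: ler_sum => k /andP[_ kn]; rewrite ler_wpM2l ?powR_ge0//.
    rewrite -(real_normK (num_real (_ k))) ler_sqr ?nnegrE ?normr_ge0 ?mulr_ge0 ?(ltW e0)//.
    rewrite !fctE IE (step_intE _ _ hs).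
    have ig : mu.-integrable `[0, t] (fun x => (g x k)%:E).
      apply: continuous_compact_integrable; first exact: segment_compact.
      apply/continuous_in_subspaceT => x.
      by rewrite inE/= in_itv/= => /andP[]; exact: cg.
    have is_ := step_val_integrable t k hs.
    have igs : mu.-integrable `[0, t] (EFin \o (fun x => g x k - step_val s x k)).
      rewrite (_ : EFin \o _ = (fun x => (g x k)%:E - (step_val s x k)%:E)%E).
        exact: integrableB.
      by apply/funext => x; rewrite /= EFinB.
    rewrite -RintegralB//.
    apply: le_trans (le_normr_Rintegral _ igs) _ => //.
    have int_le : (\int[mu]_(x in `[0%R, t]) `|g x k - step_val s x k|%:E <= (t * e)%:E)%E.
      apply: (@le_trans _ _ (\int[mu]_(x in `[0%R, t]) (cst e%:E x))%E).
        apply: ae_le_integral_nonneg => //.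
        - by move=> x _; rewrite lee_fin ltW.
        exists [set 0]; split=> //; first exact: lebesgue_measure_set1.
        move=> x /=; apply: contra_notP => x0; rewrite in_itv/= => /andP[x0' xt].
        rewrite lee_fin; apply: close => //; rewrite lt_neqAle x0' andbT eq_sym.
        exact/eqP.
      rewrite integral_cst// muleC EFinM lee_wpmul2r ?lee_fin ?(ltW e0)//.
      rewrite [leLHS](_ : _ = lebesgue_measure [set` `[0, t]%R])//.
      by rewrite lebesgue_measure_itv/= lte_fin; case: ifP => _; rewrite ?sube0 ?lee_fin.
    rewrite -lee_fin /Rintegral fineK//.
    rewrite ge0_fin_numE; first exact: le_lt_trans int_le (ltry _).
    by apply: integral_ge0 => x _; rewrite lee_fin.
  set h := I - _.
  rewrite -(@nneseries_addn _ (fun k => (lam k `^ (2 * r) * h k ^+ 2)%:E))//.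
  rewrite -(@nneseries_addn _ (fun k => (lam k `^ (2 * r) * I k ^+ 2)%:E))//.
  by apply: lee_nneseries => // k _; rewrite /h !fctE sIn ?leq_addl// subr0.
Qed.

(** By Tonelli the integral of the tail is itself the tail of a convergent numerical series. *)
Lemma integral_tail_cvg r t (g : R -> nat -> R) :
  (forall k, measurable_fun `[0, t] (g ^~ k)) ->
  (\int[mu]_(x in `[0%R, t]) hnorm2 lam r (g x) < +oo)%E ->
  (\int[mu]_(x in `[0%R, t]) \sum_(n <= k <oo) (lam k `^ (2 * r) * g x k ^+ 2)%:E)%E
    @[n --> \oo] --> 0%E.
Proof.
move=> mg glt.
have mf k : measurable_fun `[0, t] (fun x => (lam k `^ (2 * r) * g x k ^+ 2)%:E).
  by apply/measurable_EFinP; apply: measurable_funM => //; apply: measurable_funX; exact: mg.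
pose F k := (\int[mu]_(x in `[0%R, t]) (lam k `^ (2 * r) * g x k ^+ 2)%:E)%E.
have F0 k : (0 <= F k)%E by apply: integral_ge0.
have FE n : (\int[mu]_(x in `[0%R, t]) \sum_(n <= k <oo) (lam k `^ (2 * r) * g x k ^+ 2)%:E =
    \sum_(n <= k <oo) F k)%E.
  rewrite -(nneseries_addn n F0) -(@integral_nneseries _ _ _ mu _ _
    (fun k x => (lam (k + n)%N `^ (2 * r) * g x (k + n)%N ^+ 2)%:E))//; last by move=> k; exact: mf.
  apply: eq_integral => x _.
  by rewrite -(@nneseries_addn _ (fun k => (lam k `^ (2 * r) * g x k ^+ 2)%:E) n).
under eq_fun do rewrite FE.
apply: nneseries_tail_cvg => //.
by move: glt; rewrite /hnorm2 integral_nneseries.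
Qed.

(** Only the coordinates are continuous in time; in H^r the function is merely square integrable, so
    its norm may be infinite on a null set of times. The approximants converge wherever the norm is
    finite, and Young's inequality upgrades convergence in mean square to convergence in mean. *)
Lemma bochner_integral_continuous r t (g : R -> nat -> R) (I : nat -> R) : 0 <= t ->
  (forall k x, 0 <= x -> x <= t -> {for x, continuous (g ^~ k)}) ->
  (\int[mu]_(x in `[0%R, t]) hnorm2 lam r (g x) < +oo)%E ->
  hscale lam r I -> (forall k, I k = \int[mu]_(x in `[0, t]) g x k) ->
  bochner_integral lam r t g I.
Proof.
move=> t0 cg glt hI IE; split => //.
have [s Hs] := choice (fun n => @step_approx r t g I n t0 cg IE).
have mg k : measurable_fun `[0, t] (g ^~ k).
  apply: subspace_continuous_measurable_fun => //; apply/continuous_in_subspaceT => x.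
  by rewrite inE/= in_itv/= => /andP[]; exact: cg.
have mt : measurable_fun `[0, t] (fun x => hnorm2 lam r (g x)) by exact: measurable_hnorm2.
have ae0 (Q : R -> Prop) : (forall x, 0 < x -> x <= t -> Q x) ->
    {ae mu, forall x, `[0, t]%classic x -> Q x}.
  move=> hQ; exists [set 0]; split => //; first exact: lebesgue_measure_set1.
  move=> x /=; apply: contra_notP => x0; rewrite in_itv/= => /andP[x0' xt].
  by apply: hQ => //; rewrite lt_neqAle x0' andbT eq_sym; exact/eqP.
have harm : (n.+1%:R^-1 : R) @[n --> \oo] --> (0 : R) by exact: cvg_harmonic.
have add0 (c : R) (h : nat -> \bar R) : h n @[n --> \oo] --> 0%E ->
    ((c * n.+1%:R^-1)%:E + h n)%E @[n --> \oo] --> 0%E.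
  move=> hh; rewrite -[X in _ --> X]adde0; apply: cvgeD => //.
  apply/fine_cvgP; split; first exact: nearW.
  by rewrite /= -(mulr0 c); apply: cvgM => //; exact: cvg_cst.
exists s; split.
- by move=> n; have [] := Hs n.
- have glt_ae : {ae mu, forall x, `[0, t]%classic x -> hnorm2 lam r (g x) \is a fin_num}.
    apply: integrable_ae => //; apply/integrableP; split => //.
    by under eq_integral do rewrite gee0_abs//.
  have h : {ae mu, forall x, `[0, t]%classic x -> forall n,
      (hnorm2 lam r (g x - step_val (s n) x)%R <=
      (n.+1%:R^-1)%:E + \sum_(n <= k <oo) (lam k `^ (2 * r) * g x k ^+ 2)%:E)%E}.
    by apply: ae0 => x x0 xt n; have [_ + _] := Hs n; apply.
  have aeF : Filter (nbhs (almost_everywhere mu)) by exact: ae_filter_ringOfSetsType.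
  move: glt_ae h; apply: filterS2 => x h1 h2 xt.
  have {}h1 := h1 xt; have {}h2 := h2 xt.
  apply/hnorm_cvg0; apply: (@squeeze_cvge _ _ _ _ (cst 0%E) _
    (fun n => (1 * n.+1%:R^-1)%:E + \sum_(n <= k <oo) (lam k `^ (2 * r) * g x k ^+ 2)%:E)%E).
  + by apply: nearW => n; rewrite hnorm2_ge0 mul1r h2.
  + exact: cvg_cst.
  + apply: add0; apply: hnorm2_tail_cvg.
    by rewrite /hscale/= ltey_eq h1.
- have tc := integral_tail_cvg mg glt.
  apply/cvge0P => [n|e e0]; first by apply: integral_ge0 => x _; exact: hnorm_ge0.
  (* Young's inequality with weight [q] costs q t < e / 2, and the squared part is made smaller than
     q (e / 2) before division by q. *)
  pose q := e / (2 * (t + 1)).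
  have t1 : 0 < t + 1 by rewrite ltr_wpDl.
  have q0 : 0 < q by rewrite divr_gt0// mulr_gt0.
  have bt0 n : (0 <= (t * n.+1%:R^-1)%:E + \int[mu]_(x in `[0%R, t])
      \sum_(n <= k <oo) (lam k `^ (2 * r) * g x k ^+ 2)%:E)%E.
    rewrite adde_ge0 ?lee_fin ?mulr_ge0 ?invr_ge0//.
    by apply: integral_ge0 => x _; apply: nneseries_ge0.
  have qe : 0 < q * (e / 2) by rewrite mulr_gt0// divr_gt0.
  have := (@cvge0P _ _ \oo eventually_filter _ bt0).1 (add0 t _ tc) _ qe.
  apply: filterS => n hn.
  have mtail : measurable_fun `[0, t] (fun x => \sum_(n <= k <oo) (lam k `^ (2 * r) * g x k ^+ 2)%:E)%E.
    rewrite (_ : (fun x => _) = (fun x =>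
        \sum_(0 <= k <oo) (lam (k + n)%N `^ (2 * r) * g x (k + n)%N ^+ 2)%:E)%E); last first.
      by apply/funext => x; rewrite -(@nneseries_addn _ (fun k => (lam k `^ (2 * r) * g x k ^+ 2)%:E) n).
    apply: (ge0_emeasurable_sum (P := xpredT)) => [//|k _].
    by apply/measurable_EFinP; apply: measurable_funM => //; exact: measurable_funX.
  apply: (@le_lt_trans _ _ (\int[mu]_(x in `[0%R, t]) (q%:E + (q^-1)%:E * ((n.+1%:R^-1)%:E +
      \sum_(n <= k <oo) (lam k `^ (2 * r) * g x k ^+ 2)%:E)))%E).
    apply: ae_le_integral_nonneg => //.
    + by move=> x _; exact: hnorm_ge0.
    + move=> x _; rewrite adde_ge0 ?lee_fin ?(ltW q0)// mule_ge0 ?lee_fin ?invr_ge0 ?(ltW q0)//.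
      by rewrite adde_ge0 ?lee_fin ?invr_ge0//; apply: nneseries_ge0.
    + apply: emeasurable_funD => //; apply: emeasurable_funM => //.
      exact: emeasurable_funD.
    apply: ae0 => x x0 xt; apply: le_trans (hnorm_le_hnorm2 _ _ _ q0) _.
    rewrite leeD2l// lee_wpmul2l ?lee_fin ?invr_ge0 ?(ltW q0)//.
    by have [_ + _] := Hs n; apply.
  have cstE c : (\int[mu]_(x in `[0%R, t]) (cst c%:E x) = (c * t)%:E)%E.
    rewrite integral_cst// EFinM; congr (_ * _)%E.
    rewrite [LHS](_ : _ = lebesgue_measure [set` `[0, t]%R])//.
    rewrite lebesgue_measure_itv/= lte_fin; case: ltP => [_|]; first by rewrite -EFinB subr0.
    by move=> t0'; congr (_%:E); apply/eqP; rewrite eq_le t0 t0'.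
  have nt0 x : (0 <= \sum_(n <= k <oo) (lam k `^ (2 * r) * g x k ^+ 2)%:E)%E.
    by apply: nneseries_ge0.
  rewrite ge0_integralD//; last 3 first.
  + by move=> x _; rewrite lee_fin ltW.
  + by move=> x _; rewrite mule_ge0 ?lee_fin ?invr_ge0 ?(ltW q0)// adde_ge0// lee_fin invr_ge0.
  + by apply: emeasurable_funM => //; exact: emeasurable_funD.
  rewrite ge0_integralZl//; last 3 first.
  + exact: emeasurable_funD.
  + by move=> x _; rewrite adde_ge0// lee_fin invr_ge0.
  + by rewrite lee_fin invr_ge0 ltW.
  rewrite ge0_integralD//.
  rewrite (cstE q) (cstE n.+1%:R^-1) mulrC [(_^-1 * t)%R]mulrC.
  have -> : e = t * q + (e - t * q) by ring.
  rewrite EFinD lee_ltD//.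
  apply: (@le_lt_trans _ _ ((q^-1)%:E * (q * (e / 2))%:E)%E).
    by rewrite lee_wpmul2l ?lee_fin ?invr_ge0 ?(ltW q0)// ltW// mulrC.
  rewrite -EFinM lte_fin (mulKf (lt0r_neq0 q0)).
  suff : t * q < e / 2 by lra.
  have -> : e / 2 = (t + 1) * q by rewrite /q; field; rewrite gt_eqF.
  by rewrite ltr_pM2r// ltrDl.
- apply/hnorm_cvg0; apply: (@squeeze_cvge _ _ _ _ (cst 0%E) _
    (fun n => (t ^+ 2 * n.+1%:R^-1)%:E + \sum_(n <= k <oo) (lam k `^ (2 * r) * I k ^+ 2)%:E)%E).
  + by apply: nearW => n; rewrite hnorm2_ge0/=; have [_ _ ->] := Hs n.
  + exact: cvg_cst.
  + by apply: add0; exact: hnorm2_tail_cvg.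
Qed.

End bochner.

(** * Continuous Brownian paths and the Ornstein-Uhlenbeck process *)

Section caratheodory.
Context {R : realType} {d : measure_display} {T : measurableType d}.

(** Rounding time down to multiples of 1 / (n + 1) gives functions that are measurable on each of
    countably many slabs; continuity in time makes them converge pointwise. *)
Lemma measurable_fun_continuous_section (f : T -> R -> R) :
  (forall x, continuous (f x)) -> (forall s, measurable_fun setT (f ^~ s)) ->
  measurable_fun setT (fun z : T * measurableTypeR R => f z.1 z.2).
Proof.
move=> cf mf.
pose g n (z : T * measurableTypeR R) : R :=
  f z.1 ((Num.floor (n.+1%:R * (z.2 : R)))%:~R / n.+1%:R).
apply: (measurable_fun_cvg (h := g)) => [n|z _]; last first.
  apply: (cvg_comp _ (f z.1)); last exact: cf.
  apply/cvgrPdist_lt => e e0.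
  near=> n.
  have n0 : 0 < n.+1%:R :> R by rewrite ltr0n.
  have h1 : n.+1%:R^-1 < e by near: n; exact: (near_infty_natSinv_lt (PosNum e0)).
  apply: le_lt_trans h1.
  have /andP[h2 h3] := floor_itv (n.+1%:R * (z.2 : R)).
  have -> : (z.2 : R) - (Num.floor (n.+1%:R * (z.2 : R)))%:~R / n.+1%:R =
    (n.+1%:R * (z.2 : R) - (Num.floor (n.+1%:R * (z.2 : R)))%:~R) / n.+1%:R.
    by rewrite mulrBl mulrAC divff ?mul1r// gt_eqF.
  rewrite normrM [`|_^-1|]ger0_norm ?invr_ge0 ?(ltW n0)//.
  rewrite ler_piMl ?invr_ge0 ?(ltW n0)// ger0_norm ?subr_ge0//.
  by rewrite intrD1 in h3; lra.
move=> _ B mB; rewrite setTI.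
have n0 : 0 < n.+1%:R :> R by rewrite ltr0n.
rewrite (_ : _ @^-1` B = \bigcup_(k : int)
    ((f ^~ (k%:~R / n.+1%:R)) @^-1` B `*`
     (`[(k%:~R / n.+1%:R), ((k + 1)%:~R / n.+1%:R)[%classic : set (measurableTypeR R)))).
  apply: countable_bigcupT_measurable => [|k]; first exact: countableP.
  apply: measurableX; last exact: measurable_itv.
  by rewrite -[X in measurable X]setTI; exact: mf.
have flE (y : R) (k : int) : y \in `[(k%:~R / n.+1%:R), ((k + 1)%:~R / n.+1%:R)[ ->
    Num.floor (n.+1%:R * y) = k.
  rewrite in_itv/= ler_pdivrMr// ltr_pdivlMr// ![y * _]mulrC => h.
  exact: floor_def.
apply/seteqP; split => [z zB|z [k _ [zB /= /flE zk]]].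
  exists (Num.floor (n.+1%:R * (z.2 : R))) => //; split => //=.
  rewrite in_itv/= ler_pdivrMr// ltr_pdivlMr// ![z.2 * _]mulrC.
  exact: floor_itv (n.+1%:R * (z.2 : R)).
by rewrite /g/= zk.
Unshelve. all: by end_near. Qed.

End caratheodory.

Section dyadic_measurability.
Context {R : realType} {d : measure_display} {T : measurableType d}.

Lemma measurable_dyadic_sup (f : R -> T -> R) t : 0 <= t ->
  (forall s, 0 <= s -> measurable_fun setT (f s)) ->
  measurable_fun setT
    (fun x => ereal_sup (range (fun n => (dyadic_sup (f ^~ x) t n)%:E))).
Proof.
move=> t0 mf.
apply: (emeasurable_fun_cvg (fun n x => (dyadic_sup (f ^~ x) t n)%:E)) => [n|x _].
  apply/measurable_EFinP/measurable_bigmax => i; apply: measurable_funX; apply: mf.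
  by rewrite divr_ge0// mulr_ge0.
by apply: ereal_nondecreasing_cvgn => m n mn; rewrite lee_fin; exact: dyadic_sup_nd.
Qed.

End dyadic_measurability.

Section adapted_path.
Context {R : realType} {d : measure_display} {T : measurableType d}.
Variable P : probability T R.

Lemma measurable_wrt_ae G (X Y : T -> R) : sigma_algebra setT G ->
  P.-negligible `<=` G -> measurable_wrt G X -> {ae P, forall x, X x = Y x} ->
  measurable_wrt G Y.
Proof.
move=> sG nG mX XY _ B mB.
have GE : <<s G >> = G by exact: sigma_algebra_id.
have mP A : P.-negligible A -> measurable (A : set (g_sigma_algebraType G)).
  by move=> /nG; rewrite -[X in X A -> _]GE.
have mN : measurable ([set x | X x <> Y x] : set (g_sigma_algebraType G)) by exact: mP.
rewrite setTI (_ : Y @^-1` B = (X @^-1` B `\` [set x | X x <> Y x]) `|`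
    (Y @^-1` B `&` [set x | X x <> Y x])).
  apply: measurableU; last by apply: mP; apply: negligibleS XY => x [].
  by apply: measurableD => //; have := mX measurableT B mB; rewrite setTI.
apply/seteqP; split => [x /= xB|x /= [[xB /contrapT <-//]|[]//]].
have [XY'|XY'] := pselect (X x = Y x); last by right.
by left; split; rewrite ?XY'// => /(_ XY').
Qed.

Lemma measurable_wrt_cvg G (X : nat -> T -> R) Y :
  (forall n, measurable_wrt G (X n)) -> (forall x, X n x @[n --> \oo] --> Y x) ->
  measurable_wrt G Y.
Proof. by move=> mX XY; apply: (measurable_fun_cvg mX) => x _; exact: XY. Qed.

(* A continuous version of [w], vanishing on the negative half-line; the paths
   that are not continuous or do not start at [0] are replaced by [0]. *)
Definition bpath (w : R -> T -> R) x (s : R) : R :=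
  if `[< continuous (fun r : R => w (Num.max 0 r) x) /\ w 0 x = 0 >]
  then w (Num.max 0 s) x else 0.

Lemma bpath_continuous w x : continuous (bpath w x).
Proof.
rewrite /bpath; case: asboolP => [[]//|_]; exact: cst_continuous.
Qed.

Lemma bpath_le0 w x s : s <= 0 -> bpath w x s = 0.
Proof. by rewrite /bpath; case: asboolP => // -[_ w0] s0; rewrite max_l. Qed.

Variables (F : R -> set (set T)) (w : R -> T -> R).
Hypothesis basisF : usual_stochastic_basis P F.
Hypothesis wB : brownian_motion P F w.

Lemma bpath_ae : {ae P, forall x, forall t, 0 <= t -> bpath w x t = w t x}.
Proof.
have := bm_zero wB; have := bm_continuous wB; apply: filterS2 => x cw w0 t t0.
rewrite /bpath asboolT ?max_r//; split => // s.
have max0 : `[0, +oo[%classic (Num.max 0 s) by rewrite /= in_itv/= le_max lexx.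
apply: (cvg_comp (fun r : R => Num.max 0 r) (w ^~ x) _
  ((subspace_continuousP _ (w ^~ x)).1 cw _ max0)).
move=> A; rewrite /within/= => -[e/= e0 He]; exists e => //= y sy; apply: He => /=.
  apply: le_lt_trans sy.
  rewrite ler_norml; have := ler_norm (s - y); have := ler_norm (- (s - y)); rewrite normrN.
  by rewrite /Num.max; case: ltP => h1; case: ltP => h2 h3 h4; apply/andP; split; lra.
by rewrite in_itv/= le_max lexx.
Qed.

(** The test in [bpath] inspects the whole path and so looks into the future, but it alters [w s]
    only on a null set, and [F t] contains the null sets. *)
Lemma bpath_adapted s t : 0 <= s -> s <= t -> measurable_wrt (F t) (fun x => bpath w x s).
Proof.
move=> s0 st; have t0 := le_trans s0 st.
apply: (measurable_wrt_ae (X := w s)).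
- exact: sb_sigma_algebra basisF _ t0.
- exact: subset_trans (sb_null basisF) (sb_nondecreasing basisF (lexx 0) t0).
- exact: (brownian_adapted (sb_nondecreasing basisF) wB).
- by apply: filterS bpath_ae => x /(_ _ s0).
Qed.

Lemma bpath_measurable s : measurable_fun setT (fun x => bpath w x s).
Proof.
have [s0|s0] := leP 0 s.
  by apply: (measurable_wrt_measurable (sb_sub basisF s0)); exact: bpath_adapted.
rewrite (_ : (fun x => _) = cst 0); first exact: measurable_cst.
by apply/funext => x; rewrite bpath_le0// ltW.
Qed.

Lemma measurable_wrt_ou_sum G a t n (v : R -> T -> R) : 0 <= t ->
  (forall s, 0 <= s -> s <= t -> measurable_wrt G (v s)) ->
  measurable_wrt G (fun x => ou_sum a (v ^~ x) t n.+1).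
Proof.
move=> t0 mv; apply: measurable_sum => i; apply: measurable_funM => //.
have n0 : 0 < n.+1%:R :> R by rewrite ltr0n.
have le1 j : (j <= n.+1)%N -> t * j%:R / n.+1%:R <= t.
  by move=> jn; rewrite ler_pdivrMr// ler_wpM2l// ler_nat.
apply: measurable_funB; apply: mv; rewrite ?le1 ?divr_ge0 ?mulr_ge0//.
exact: ltnW.
Qed.

Lemma ou_adapted a t : 0 < a -> 0 <= t ->
  measurable_wrt (F t) (fun x => ou a (bpath w x) t).
Proof.
move=> a0 t0.
apply: (@measurable_wrt_cvg _ (fun n x => ou_sum a (bpath w x) t n.+1)) => [n|x].
  by apply: (measurable_wrt_ou_sum a n (v := fun s x => bpath w x s)) => // s s0 st; exact: bpath_adapted.
by apply: ou_sum_cvg => // [|s]; [exact: bpath_continuous|exact: bpath_le0].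
Qed.

Lemma ou_measurable a t : 0 < a -> 0 <= t ->
  measurable_fun setT (fun x => ou a (bpath w x) t).
Proof.
move=> a0 t0; apply: (measurable_wrt_measurable (sb_sub basisF t0)).
exact: ou_adapted.
Qed.

Definition bsup t x := ereal_sup (range (fun n => (dyadic_sup (bpath w x) t n)%:E)).

Lemma bsup_ge0 t x : (0 <= bsup t x)%E.
Proof.
apply: ereal_sup_ge; exists (dyadic_sup (bpath w x) t 0)%:E; first by exists 0%N.
by rewrite lee_fin dyadic_sup_ge0.
Qed.

Lemma measurable_bsup t : 0 <= t -> measurable_fun setT (bsup t).
Proof.
move=> t0; apply: (measurable_dyadic_sup (f := fun s x => bpath w x s)) => // s _.
exact: bpath_measurable.
Qed.

Lemma bsup_le t : 0 < t -> (\int[P]_x bsup t x <= (48 * t)%:E)%E.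
Proof.
move=> t0.
have h := brownian_dyadic_sup (sb_sigma_algebra basisF) (sb_sub basisF) (sb_nondecreasing basisF) wB t0.
apply: le_trans h.
apply: ae_le_integral_nonneg => //.
- by move=> x _; exact: bsup_ge0.
- by move=> x _; apply: ereal_sup_ge; exists (dyadic_sup (w ^~ x) t 0)%:E; [exists 0%N|rewrite lee_fin dyadic_sup_ge0].
- apply: measurable_dyadic_sup; first exact: ltW.
  move=> s; exact: (brownian_measurable (sb_sub basisF) (sb_nondecreasing basisF) wB).
- apply: filterS bpath_ae => x wE; rewrite /bsup (_ : dyadic_sup (bpath w x) t = dyadic_sup (w ^~ x) t)//.
  apply/funext => n; apply: eq_bigr => i _; rewrite wE// divr_ge0// mulr_ge0//; exact: ltW.
Qed.

Lemma bpath_sqr_le t x s : 0 < t -> 0 <= s -> s <= t ->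
  ((bpath w x s ^+ 2)%:E <= bsup t x)%E.
Proof. by move=> t0; apply: sqr_le_dyadic_sup => //; exact: bpath_continuous. Qed.

Lemma ou_path_sqr_le a t x s : 0 < a -> 0 < t -> 0 <= s -> s <= t ->
  ((ou a (bpath w x) s ^+ 2)%:E <= 4%:E * bsup t x)%E.
Proof.
move=> a0 t0 s0 st.
have := fun r => @bpath_sqr_le t x r t0; have := bsup_ge0 t x.
case: (bsup t x) => [M M0 HM||//]; last first.
  by move=> _ _; rewrite gt0_muley ?leey// lte_fin.
rewrite -EFinM lee_fin; apply: ou_sqr_le => //.
- exact: bpath_continuous.
- by move=> r; exact: bpath_le0.
- by move=> r r0 rs; have := HM r r0 (le_trans rs st); rewrite lee_fin.
Qed.

Definition ou_sum_variance a t n : R :=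
  \sum_(i < n.+1) expR (- (a * (t - t * i%:R / n.+1%:R))) ^+ 2 * (t / n.+1%:R).

(** The sum over the first j cells is known at time [tau j], hence independent of the next
    increment. Gaussian laws here have positive variance, so the induction starts from one term. *)
Lemma ou_sum_gaussian a t n : 0 < t ->
  gaussian P (fun x => ou_sum a (w ^~ x) t n.+1) (ou_sum_variance a t n).
Proof.
move=> t0; pose tau i : R := t * i%:R / n.+1%:R.
have n0 : 0 < n.+1%:R :> R by rewrite ltr0n.
have tau0 i : 0 <= tau i by rewrite divr_ge0 ?mulr_ge0 ?(ltW t0).
have tauS i : tau i < tau i.+1 by rewrite ltr_pM2r ?invr_gt0// ltr_pM2l// ltr_nat.
have tau_le i j : (i <= j)%N -> tau i <= tau j.
  by move=> ij; rewrite ler_pM2r ?invr_gt0// ler_pM2l// ler_nat.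
have dtau i : tau i.+1 - tau i = t / n.+1%:R.
  by rewrite -mulrBl -mulrBr -natrB ?leqnSn// subSnn mulr1.
pose e i := expR (- (a * (t - tau i))).
pose S j x := \sum_(i < j) e i * (w (tau i.+1) x - w (tau i) x).
have mS j : measurable_wrt (F (tau j)) (S j).
  apply: measurable_sum => i; apply: measurable_funM => //.
  by apply: measurable_funB; apply: (brownian_adapted (sb_nondecreasing basisF) wB) => //;
    apply: tau_le => //; exact: ltnW.
have incr i : gaussian P (fun x => e i * (w (tau i.+1) x - w (tau i) x)) (e i ^+ 2 * (t / n.+1%:R)).
  apply: gaussian_scale; first exact: expR_gt0.
  by rewrite -(dtau i); exact: (bm_increment wB).
suff H j : gaussian P (S j.+1) (\sum_(i < j.+1) e i ^+ 2 * (t / n.+1%:R)) by exact: H.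
elim: j => [|j IH].
  rewrite big_ord1 (_ : S 1%N = fun x => e 0%N * (w (tau 1%N) x - w (tau 0%N) x)) //.
  by apply/funext => x; rewrite /S big_ord1.
rewrite big_ord_recr/=.
rewrite (_ : S j.+2 = fun x => S j.+1 x + e j.+1 * (w (tau j.+2) x - w (tau j.+1) x)); last first.
  by apply/funext => x; rewrite /S big_ord_recr.
apply: (gaussian_add IH (incr j.+1)) => A B mA mB.
have sF := sb_sigma_algebra basisF (tau0 j.+1).
have mB' : measurable ((fun y : R => e j.+1 * y) @^-1` B).
  rewrite -[X in measurable X]setTI.
  have mf : measurable_fun setT (fun y : R => e j.+1 * y) by exact: measurable_funM.
  exact: mf.
exact: (independent2_preimages sF (bm_independent wB (tau0 j.+1) (tauS j.+1)) (mS j.+1) mA mB').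
Qed.

(** The geometric sum equals the limit times h / (exp(h) - 1) with h = 2 a t / (n + 1), and this
    factor lies between exp(-h) and 1. *)
Lemma ou_sum_variance_cvg a t : 0 < a -> 0 < t ->
  ou_sum_variance a t n @[n --> \oo] --> (1 - expR (- (2 * a * t))) / (2 * a).
Proof.
move=> a0 t0; pose h n : R := 2 * a * t / n.+1%:R.
have h0 n : 0 < h n by rewrite divr_gt0// !mulr_gt0.
have E1 n : 0 < expR (h n) - 1 by rewrite subr_gt0 expR_gt1.
have VE n : ou_sum_variance a t n =
    (1 - expR (- (2 * a * t))) / (2 * a) * (h n / (expR (h n) - 1)).
  have n0 : n.+1%:R != 0 :> R by rewrite pnatr_eq0.
  rewrite /ou_sum_variance -mulr_suml.
  rewrite (eq_bigr (fun i : 'I_n.+1 => expR (- (2 * a * t)) * expR (h n) ^+ i)); last first.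
    move=> i _; rewrite -!expRM_natl -expRD; congr expR; rewrite /h; field.
    by rewrite nat1r.
  have := subrX1 (expR (h n)) n.+1; rewrite -expRM_natl.
  rewrite (_ : n.+1%:R * h n = 2 * a * t); last by rewrite mulrC /h divfK.
  move=> /esym gE; rewrite -mulr_sumr.
  have -> : \sum_(i < n.+1) expR (h n) ^+ i = (expR (2 * a * t) - 1) / (expR (h n) - 1).
    by rewrite -gE mulrAC divff ?mul1r// gt_eqF.
  rewrite mulrA mulrBr -expRD addNr expR0 mulr1 /h; field.
  by rewrite !gt_eqF ?E1.
have hc : h n @[n --> \oo] --> 0.
  by rewrite -(mulr0 (2 * a * t)); apply: cvgM; [exact: cvg_cst|exact: cvg_harmonic].
rewrite (_ : ou_sum_variance a t = fun n => (1 - expR (- (2 * a * t))) / (2 * a) *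
  (h n / (expR (h n) - 1))); last exact/funext.
suff lim2 : h n / (expR (h n) - 1) @[n --> \oo] --> (1 : R).
  by rewrite -[X in _ --> X]mulr1; apply: cvgM => //; exact: cvg_cst.
have lim1 : expR (- h n) @[n --> \oo] --> (1 : R).
  rewrite -expR0; apply: continuous_cvg; first exact: continuous_expR.
  by rewrite -oppr0; exact: cvgN.
have lim3 : (fun _ : nat => 1 : R) @ \oo --> (1 : R) by exact: cvg_cst.
apply: (squeeze_cvgr _ lim1 lim3); apply: nearW => n; apply/andP; split.
  rewrite ler_pdivlMr// mulrBr -expRD addNr expR0 mulr1.
  by have := expR_ge1Dx (- h n); lra.
by rewrite ler_pdivrMr// mul1r; have := expR_ge1Dx (h n); lra.
Qed.

Lemma ou_sum_ae_cvg a t : 0 < a -> 0 <= t ->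
  {ae P, forall x, ou_sum a (w ^~ x) t n.+1 @[n --> \oo] --> ou a (bpath w x) t}.
Proof.
move=> a0 t0; apply: filterS bpath_ae => x wE.
rewrite (_ : (fun n => _) = fun n => ou_sum a (bpath w x) t n.+1).
  by apply: ou_sum_cvg => // [|s]; [exact: bpath_continuous|exact: bpath_le0].
by apply/funext => n; apply: eq_bigr => i _; rewrite !wE// divr_ge0// mulr_ge0.
Qed.

Lemma ou_variance_gt0 (a t : R) : 0 < a -> 0 < t -> 0 < (1 - expR (- (2 * a * t))) / (2 * a).
Proof.
move=> a0 t0; rewrite divr_gt0 ?mulr_gt0// subr_gt0 -expR0 ltr_expR oppr_lt0.
by rewrite !mulr_gt0.
Qed.

(** Any measurable version [Z] is allowed, since the result serves both for the modified path and
    for the upper limit of the sums. *)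
Lemma ou_cvg_gaussian a t (Z : T -> R) : 0 < a -> 0 < t -> measurable_fun setT Z ->
  {ae P, forall x, Z x = ou a (bpath w x) t} ->
  gaussian P Z ((1 - expR (- (2 * a * t))) / (2 * a)).
Proof.
move=> a0 t0 mZ ZE.
apply: (gaussian_cvg (fun n => @ou_sum_gaussian a t n t0)) => //.
- exact: ou_variance_gt0.
- exact: ou_sum_variance_cvg.
- have := ou_sum_ae_cvg a0 (ltW t0); move: ZE; apply: filterS2 => x ->; exact.
Qed.

(** The variance is at most 1 / (2 a), and a Gaussian second moment is bounded by six times the
    variance. *)
Lemma ou_path_integral_sqr_le a t : 0 < a -> 0 <= t ->
  (\int[P]_x (ou a (bpath w x) t ^+ 2)%:E <= (3 / a)%:E)%E.
Proof.
move=> a0; rewrite le_eqVlt => /predU1P[<-|t0].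
  rewrite integral0_eq => [|x _]; first by rewrite lee_fin divr_ge0// ltW.
  by rewrite ou_le0 ?expr0n// => s; exact: bpath_le0.
have mou := ou_measurable a0 (ltW t0).
have := gaussian_sqr_le (ou_cvg_gaussian a0 t0 mou (aeW P (fun x => erefl))).
move=> /le_trans; apply; rewrite lee_fin.
rewrite (_ : 3 / a = 6 * (1 / (2 * a))); last by field; rewrite gt_eqF.
rewrite ler_pM2l// ler_pM2r ?invr_gt0 ?mulr_gt0//.

Qed.

(* Almost surely the Ornstein-Uhlenbeck process, but measurable with respect to
   the path of [w] without completion. *)
Definition ou_limit a t x : R := fine (limn_esup (fun n => (ou_sum a (w ^~ x) t n.+1)%:E)).

Lemma ou_limit_ae a t : 0 < a -> 0 <= t ->
  {ae P, forall x, ou_limit a t x = ou a (bpath w x) t}.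
Proof.
move=> a0 t0; apply: filterS (ou_sum_ae_cvg a0 t0) => x h.
have hE : (ou_sum a (w ^~ x) t n.+1)%:E @[n --> \oo] --> (ou a (bpath w x) t)%:E.
  by apply: cvg_EFin => //; exact: nearW.
by rewrite /ou_limit limn_esup_lim (cvg_lim _ (cvg_esups hE)).
Qed.

Lemma measurable_wrt_ou_limit G a t : 0 <= t ->
  (forall s, 0 <= s -> s <= t -> measurable_wrt G (w s)) ->
  measurable_wrt G (ou_limit a t).
Proof.
move=> t0 mw; apply: measurableT_comp => //.
apply: measurable_fun_limn_esup => n; apply/measurable_EFinP.
exact: measurable_wrt_ou_sum.
Qed.

End adapted_path.

(** * Existence, uniqueness and the energy estimate *)

Section strip.
Context {R : realType} {d1 d2 : measure_display} {T1 : measurableType d1} {T2 : measurableType d2}.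
Variables (m1 : {sigma_finite_measure set T1 -> \bar R}).
Variables (m2 : {sigma_finite_measure set T2 -> \bar R}).
Variables (D : set T2) (f : T1 * T2 -> \bar R).
Hypothesis mD : measurable D.
Hypothesis mf : measurable_fun setT f.
Hypothesis f0 : forall z, (0 <= f z)%E.

Let stripE z : (f \_ (setT `*` D)) z = ((fun y => f (z.1, y)) \_ D) z.2.
Proof. rewrite /patch (_ : (z \in setT `*` D) = (z.2 \in D)); first by case: z.
by apply/idP/idP; rewrite !inE/= => // -[]. Qed.

Let mstrip : measurable_fun setT (f \_ (setT `*` D)).
Proof.
apply/(measurable_restrictT _ _).1; first exact: measurableX.
exact: measurable_funS mf.
Qed.

Let strip_ge0 z : (0 <= (f \_ (setT `*` D)) z)%E.
Proof. exact: erestrict_ge0. Qed.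

Lemma integral_strip1 :
  (\int[m1 \x m2]_(z in setT `*` D) f z = \int[m1]_x \int[m2]_(y in D) f (x, y))%E.
Proof.
rewrite integral_mkcond fubini_tonelli1//; apply: eq_integral => x _.
rewrite [RHS]integral_mkcond; apply: eq_integral => y _; exact: stripE.
Qed.

Lemma integral_strip2 :
  (\int[m1 \x m2]_(z in setT `*` D) f z = \int[m2]_(y in D) \int[m1]_x f (x, y))%E.
Proof.
rewrite integral_mkcond fubini_tonelli2// [RHS]integral_mkcond.
apply: eq_integral => y _; rewrite /fubini_G [RHS]/patch.
under eq_integral do rewrite stripE/= /patch.
by case: ifP => // _; rewrite integral0.
Qed.

Lemma measurable_strip1 : measurable_fun setT (fun x => \int[m2]_(y in D) f (x, y))%E.
Proof.
rewrite (_ : (fun x => _) = fubini_F m2 (f \_ (setT `*` D))); last first.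
    apply/funext => x; rewrite /fubini_F [LHS]integral_mkcond; apply: eq_integral => y _.
  by rewrite stripE.
exact: measurable_fun_fubini_tonelli_F.
Qed.

End strip.

Section hcut_facts.
Context {R : realType}.
Variable lam : nat -> R.

Lemma hnorm2_hcut_le s r f : (hnorm2 lam s (hcut lam r f) <= hnorm2 lam s f)%E.
Proof. by rewrite /hcut; case: asboolP => // _; rewrite hnorm2_0 hnorm2_ge0. Qed.

Lemma measurable_hcut d (T : measurableType d) r (X : T -> nat -> R) :
  (forall k, 0 < lam k) -> (forall k, measurable_fun setT (X ^~ k)) ->
  forall k, measurable_fun setT (fun x => hcut lam r (X x) k).
Proof.
by move=> lam_gt0 mX k; apply: measurable_hcut_coord => // U; exact: hopen_measurable.
Qed.

(** The Laplacian is an isometry from H^(r+1) to H^(r-1); the energy estimate thereby gives square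
    integrability of the drift of the equation. *)
Lemma hnorm2_hlaplace r f : (forall k, 0 < lam k) ->
  hnorm2 lam (r - 1) (hlaplace lam f) = hnorm2 lam (r + 1) f.
Proof.
move=> lam_gt0; apply: eq_eseriesr => k _; congr (_%:E).
have := lam_gt0 k => l0; rewrite /hlaplace exprMn sqrrN mulrA; congr (_ * _).
rewrite -exprM -powR_mulrn ?ltW// -powRD; last by rewrite [lam k == 0]gt_eqF ?implybT.
by congr powR; ring.
Qed.

End hcut_facts.

Section exponential_integral.
Context {R : realType}.
Local Notation mu := (@lebesgue_measure R).

(** The scalar equation with zero noise and initial value 1 reads exp(-a t) = 1 - a times the
    integral. *)
Lemma integral_expR_decay (a t : R) : 0 < a -> 0 <= t ->
  (\int[mu]_(s in `[0%R, t]) (expR (- (a * s)))%:E <= (a^-1)%:E)%E.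
Proof.
move=> a0 t0.
have c0 : continuous (cst 0 : R -> R) by exact: cst_continuous.
have := @ou_equation R a (cst 0) a0 c0 (fun _ _ => erefl) t 1 0 t0.
rewrite !mulr1 !mul0r !addr0.
under eq_Rintegral do rewrite mulr1 mul0r addr0.
move=> E.
have ce : continuous (fun s => expR (- (a * s))).
  move=> s; apply: continuous_comp; last exact: continuous_expR.
  by apply: cvgN; apply: cvgM; [exact: cvg_cst|exact: cvg_id].
have /integrableP[_ fin] := continuous_segment_integrable 0 t ce.
have ge0 : (0 <= \int[mu]_(s in `[0%R, t]) (expR (- (a * s)))%:E)%E.
  by apply: integral_ge0 => s _; rewrite lee_fin expR_ge0.
rewrite -[leLHS]fineK; last first.
  rewrite ge0_fin_numE//; apply: le_lt_trans fin; apply: le_integral_nonneg => s _ /=.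
    by rewrite lee_fin expR_ge0.
  by rewrite ger0_norm ?expR_ge0.
rewrite lee_fin -[fine _]/(\int[mu]_(s in `[0, t]) expR (- (a * s))).
rewrite -[_^-1]mul1r ler_pdivlMr// mulrC.
by have := expR_ge0 (- (a * t)); lra.
Qed.

End exponential_integral.

Section mild_solution.
Context {R : realType} {d : measure_display} {T : measurableType d}.
Variables (P : probability T R) (F : R -> set (set T)) (w : nat -> R -> T -> R).
Variables (lam : nat -> R) (nu sigma r : R) (phi : T -> nat -> R).
Hypothesis basisF : usual_stochastic_basis P F.
Hypothesis wB : forall k, brownian_motion P F (w k).
Hypothesis lam_gt0 : forall k, 0 < lam k.
Hypothesis lam_ge : forall k, lam 0%N <= lam k.
Hypothesis weight_lty : (\sum_(0 <= k <oo) (lam k `^ (2 * r))%:E < +oo)%E.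
Hypothesis nu_gt0 : 0 < nu.
Hypothesis phiL2 : in_L2 lam P setT r phi.
Hypothesis phi_adapted : hmeasurable lam (F 0) r phi.
Local Notation mu := (@lebesgue_measure R).
Local Notation hn := (hnorm2 lam).
Local Notation a k := (nu * lam k ^+ 2).

Let a_gt0 k : 0 < a k.
Proof. by rewrite mulr_gt0// exprn_gt0. Qed.

(** The trace of the covariance of W(1) in H^r. *)
Definition weight : R := fine (\sum_(0 <= k <oo) (lam k `^ (2 * r))%:E)%E.

Lemma weightE : (\sum_(0 <= k <oo) (lam k `^ (2 * r))%:E)%E = weight%:E.
Proof.
rewrite /weight fineK// ge0_fin_numE//.
by apply: nneseries_ge0 => k _ _; rewrite lee_fin powR_ge0.
Qed.

Lemma weight_ge0 : 0 <= weight.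
Proof.
by rewrite -lee_fin -weightE; apply: nneseries_ge0 => k _ _; rewrite lee_fin powR_ge0.
Qed.

Lemma powR_succ k : lam k `^ (2 * (r + 1)) = lam k `^ (2 * r) * lam k ^+ 2.
Proof.
rewrite mulrDr mulr1 powRD; first by rewrite -[2]/(2%:R) powR_mulrn// ltW.
by rewrite [lam k == 0]gt_eqF ?implybT.
Qed.

Definition phi0 x := hcut lam r (phi x).

Lemma phi0_ae : {ae P, forall x, phi0 x = phi x}.
Proof.
have [Y [hY _ phiY _]] := phiL2; apply: filterS phiY => x /(_ I) phiE.
by rewrite /phi0 hcutE// phiE; exact: hY.
Qed.

Lemma phi0_adapted k : measurable_wrt (F 0) (phi0 ^~ k).
Proof.
apply: (@measurable_hcut_coord R lam lam_gt0 _ (g_sigma_algebraType (F 0)) r phi k) => U hU.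
exact: sub_sigma_algebra (phi_adapted hU).
Qed.

Lemma phi0_measurable k : measurable_fun setT (phi0 ^~ k).
Proof. by apply: (measurable_wrt_measurable (sb_sub basisF (lexx 0))); exact: phi0_adapted. Qed.

Lemma phi0_hscale x : hscale lam r (phi0 x).
Proof. exact: hcut_hscale. Qed.

Lemma phi0_le : (\int[P]_x hn r (phi0 x) <= \int[P]_x hn r (phi x))%E.
Proof.
apply: le_integral_nonneg => x _; [exact: hnorm2_ge0|exact: hnorm2_hcut_le].
Qed.

Lemma phi0_lty : (\int[P]_x hn r (phi0 x) < +oo)%E.
Proof.
have [Y [hY mY phiY Ylty]] := phiL2; apply: le_lt_trans Ylty.
have mYc k : measurable_fun setT (Y ^~ k).
  have := @measurable_hcut_coord R lam lam_gt0 _ T r Y k.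
  rewrite (_ : (fun x => hcut lam r (Y x) k) = Y ^~ k); first apply.
    by move=> U hU; rewrite -[X in measurable X]setTI; exact: mY.
  by apply/funext => x; rewrite hcutE//; exact: hY.
apply: ae_le_integral_nonneg => //.
- exact: measurable_hnorm2.
- by move: phi0_ae phiY; apply: filterS2 => x -> /(_ I) ->.
Qed.

Definition mild_path (t : R) x : nat -> R :=
  fun k => expR (- (a k * t)) * phi0 x k + sigma * ou (a k) (bpath (w k) x) t.

Lemma mild_path_adapted t k : 0 <= t -> measurable_wrt (F t) (fun x => mild_path t x k).
Proof.
move=> t0; apply: measurable_funD; apply: measurable_funM => //.
  by apply: (sub_measurable_wrt (sb_nondecreasing basisF (lexx 0) t0)); exact: phi0_adapted.
exact: (ou_adapted basisF (wB k)).
Qed.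

Lemma mild_path_measurable t k : 0 <= t -> measurable_fun setT (fun x => mild_path t x k).
Proof.
by move=> t0; apply: (measurable_wrt_measurable (sb_sub basisF t0)); exact: mild_path_adapted.
Qed.

Lemma mild_path_continuous x k : continuous (fun s : R => mild_path (Num.max 0 s) x k).
Proof.
move=> s; have cmax : {for s, continuous (fun s : R => Num.max 0 s)}.
  by apply: (@continuous_max _ _ (fun=> 0) id s); [exact: cst_continuous|exact: cvg_id].
have ge0 : -1 < Num.max 0 s by rewrite lt_max; apply/orP; left; lra.
have ce : continuous (fun s => expR (- (a k * s))).
  move=> y; apply: continuous_comp; last exact: continuous_expR.
  by apply: cvgN; apply: cvgM; [exact: cvg_cst|exact: cvg_id].
have c1 : {for s, continuous (fun s : R => expR (- (a k * Num.max 0 s)))}.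
  exact: (@continuous_comp _ _ _ (fun s : R => Num.max 0 s) (fun s => expR (- (a k * s))) s cmax (ce _)).
have c2 : {for s, continuous (fun s : R => ou (a k) (bpath (w k) x) (Num.max 0 s))}.
  apply: (@continuous_comp _ _ _ (fun s : R => Num.max 0 s) (ou (a k) (bpath (w k) x)) s cmax).
  by apply: ou_continuous => //; exact: bpath_continuous.
by apply: cvgD; apply: cvgM; [exact: c1|exact: cvg_cst|exact: cvg_cst|exact: c2].
Qed.

Lemma mild_path_joint k :
  measurable_fun setT (fun z : T * measurableTypeR R => mild_path (Num.max 0 (z.2 : R)) z.1 k).
Proof.
apply: (@measurable_fun_continuous_section _ _ _ (fun x s => mild_path (Num.max 0 s) x k)).
  by move=> x; exact: mild_path_continuous.
by move=> s; apply: mild_path_measurable; rewrite le_max lexx.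
Qed.

Let sig_ge0 c : 0 <= c -> 0 <= c * sigma ^+ 2.
Proof. by move=> c0; rewrite mulr_ge0// sqr_ge0. Qed.

Let sqrD (x y : R) : (x + y) ^+ 2 <= 2 * x ^+ 2 + 2 * y ^+ 2.
Proof. by have := sqr_ge0 (x - y); nra. Qed.

Let expR_decay_le1 k t : 0 <= t -> expR (- (a k * t)) <= 1.
Proof. by move=> t0; rewrite -expR0 ler_expR oppr_le0 mulr_ge0// ltW. Qed.

Lemma mild_path_sqr_le1 t x k : 0 <= t ->
  mild_path t x k ^+ 2 <= 2 * phi0 x k ^+ 2 + 2 * (sigma ^+ 2 * ou (a k) (bpath (w k) x) t ^+ 2).
Proof.
move=> t0; apply: le_trans (sqrD _ _) _; rewrite !exprMn lerD2r ler_pM2l//.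
rewrite ler_piMl ?sqr_ge0// expr_le1// ?expR_ge0//; exact: expR_decay_le1.
Qed.

(** The constant 8 is 2, from the square of a sum, times 4, from the bound on Ornstein-Uhlenbeck
    paths. *)
Lemma mild_path_sqr_le t s x k : 0 < t -> 0 <= s -> s <= t ->
  ((mild_path s x k ^+ 2)%:E <=
   (2 * phi0 x k ^+ 2)%:E + (8 * sigma ^+ 2)%:E * bsup (w k) t x)%E.
Proof.
move=> t0 s0 st; apply: (@le_trans _ _ (2 * phi0 x k ^+ 2 +
  2 * (sigma ^+ 2 * ou (a k) (bpath (w k) x) s ^+ 2))%:E).
  by rewrite lee_fin mild_path_sqr_le1.
rewrite EFinD leeD2l// mulrA EFinM.
apply: (@le_trans _ _ ((2 * sigma ^+ 2)%:E * (4%:E * bsup (w k) t x))%E).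
  by rewrite lee_wpmul2l ?lee_fin ?sig_ge0//; exact: ou_path_sqr_le.
rewrite muleA -EFinM (_ : 2 * sigma ^+ 2 * 4 = 8 * sigma ^+ 2)//; ring.
Qed.

(** A random majorant of the squared H^r norms of all the Brownian paths, uniform on [0, t] and of
    finite mean. *)
Definition noise_bound t x := (\sum_(0 <= k <oo) (lam k `^ (2 * r))%:E * bsup (w k) t x)%E.

Let nterm_ge0 t x k : (0 <= (lam k `^ (2 * r))%:E * bsup (w k) t x)%E.
Proof. by rewrite mule_ge0 ?bsup_ge0// lee_fin powR_ge0. Qed.

Lemma noise_bound_ge0 t x : (0 <= noise_bound t x)%E.
Proof. by apply: nneseries_ge0. Qed.

Let mbsup k t : 0 <= t -> measurable_fun setT (bsup (w k) t).
Proof. by move=> t0; exact: (measurable_bsup basisF (wB k)). Qed.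

Lemma noise_bound_measurable t : 0 <= t -> measurable_fun setT (noise_bound t).
Proof.
move=> t0; apply: (ge0_emeasurable_sum (P := xpredT)) => [k x _ _|k _]; first exact: nterm_ge0.
by apply: measurable_funeM; exact: mbsup.
Qed.

Lemma noise_bound_le t : 0 < t ->
  (\int[P]_x noise_bound t x <= (48 * t * weight)%:E)%E.
Proof.
move=> t0; rewrite integral_nneseries//; last first.
  by move=> k; apply: measurable_funeM; exact: (mbsup _ (ltW t0)).
rewrite EFinM -weightE -nneseriesZl => [|k _]; last by rewrite lee_fin powR_ge0.
apply: lee_nneseries => [k _ _|k _].
  by apply: integral_ge0 => x _; exact: nterm_ge0.
rewrite ge0_integralZl_EFin ?powR_ge0//.
- rewrite muleC lee_wpmul2r ?lee_fin ?powR_ge0//.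
  exact: (bsup_le basisF (wB k)).
- by move=> x _; exact: bsup_ge0.
- exact: (mbsup _ (ltW t0)).
Qed.

Lemma noise_bound_lty :
  {ae P, forall x, forall n : nat, (noise_bound n.+1%:R x < +oo)%E}.
Proof.
apply/ae_foralln => n.
have n0 : 0 < n.+1%:R :> R by rewrite ltr0n.
have mN := noise_bound_measurable (ltW n0).
have : P.-integrable setT (noise_bound n.+1%:R).
  apply/integrableP; split => //.
  under eq_integral do rewrite gee0_abs ?noise_bound_ge0//.
  exact: le_lt_trans (noise_bound_le n0) (ltry _).
move/(integrable_ae measurableT); apply: filterS => x /(_ I).
by rewrite ge0_fin_numE// noise_bound_ge0.
Qed.

Lemma mild_path_norm_le t s x : 0 < t -> 0 <= s -> s <= t ->
  (hn r (mild_path s x) <= 2%:E * hn r (phi0 x) + (8 * sigma ^+ 2)%:E * noise_bound t x)%E.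
Proof.
move=> t0 s0 st; rewrite /hnorm2 /noise_bound -!nneseriesZl//.
rewrite -nneseriesD; last 2 first.
- by move=> k _ _; rewrite mule_ge0// hterm_ge0.
- by move=> k _ _; rewrite mule_ge0// lee_fin sig_ge0.
apply: lee_nneseries => [k _ _|k _]; first exact: hterm_ge0.
rewrite EFinM; apply: (@le_trans _ _ ((lam k `^ (2 * r))%:E *
  ((2 * phi0 x k ^+ 2)%:E + (8 * sigma ^+ 2)%:E * bsup (w k) t x))%E).
  by rewrite lee_wpmul2l ?lee_fin ?powR_ge0//; exact: mild_path_sqr_le.
rewrite ge0_muleDr; last 2 first.
- by rewrite lee_fin mulr_ge0// sqr_ge0.
- by rewrite mule_ge0 ?bsup_ge0// lee_fin sig_ge0.
by rewrite [X in (_ + X <= _)%E]muleCA -!EFinM mulrCA.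
Qed.

(** The majorant for the Weierstrass test, serving both the solution and W(t). Integer horizons give
    one null set for all t; the extra 1 in its coefficient covers the Brownian coordinates. *)
Lemma mild_path_dominated : {ae P, forall x, forall t, 0 < t -> exists b : nat -> R,
  (\sum_(0 <= k <oo) (lam k `^ (2 * r) * b k)%:E < +oo)%E /\
  forall s k, 0 <= s -> s <= t -> mild_path s x k ^+ 2 <= b k /\ bpath (w k) x s ^+ 2 <= b k}.
Proof.
apply: filterS noise_bound_lty => x Hx t t0.
have [n tn] : exists n : nat, t <= n.+1%:R.
  exists (Num.truncn t); apply/ltW; exact: truncnS_gt.
have {Hx} := Hx n; set t1 : R := n.+1%:R => Hx.
have t10 : 0 < t1 by rewrite ltr0n.
(* A finite series with positive weights has only finite terms. *)
have fin k : bsup (w k) t1 x \is a fin_num.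
  rewrite ge0_fin_numE ?bsup_ge0// ltNge leye_eq; apply/negP => /eqP E.
  move: Hx; rewrite /noise_bound (nneseriesD1 (n := k))// E gt0_muley ?lte_fin ?powR_gt0//.
  by rewrite addye// gt_eqF// (lt_le_trans (ltNyr 0))//; apply: nneseries_ge0.
exists (fun k => 2 * phi0 x k ^+ 2 + (8 * sigma ^+ 2 + 1) * fine (bsup (w k) t1 x)); split.
  have c0 : 0 <= 8 * sigma ^+ 2 + 1 by rewrite addr_ge0// mulr_ge0// sqr_ge0.
  rewrite (_ : (\sum_(0 <= k <oo) _)%E =
      (2%:E * hn r (phi0 x) + (8 * sigma ^+ 2 + 1)%:E * noise_bound t1 x)%E); last first.
    rewrite /hnorm2 /noise_bound -!nneseriesZl// -nneseriesD; last 2 first.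
    - by move=> k _ _; rewrite mule_ge0// hterm_ge0.
    - by move=> k _ _; rewrite mule_ge0// lee_fin.
    apply: eq_eseriesr => k _; rewrite -[in RHS](fineK (fin k)) -!EFinM -EFinD; congr (_%:E).
    ring.
  by rewrite lte_add_pinfty// lte_mul_pinfty//; exact: phi0_hscale.
move=> s k s0 st; have st1 := le_trans st tn.
have B0 : 0 <= fine (bsup (w k) t1 x) by rewrite fine_ge0// bsup_ge0.
split.
  have h := mild_path_sqr_le x k t10 s0 st1; rewrite -(fineK (fin k)) -EFinM -EFinD lee_fin in h.
  by apply: le_trans h _; lra.
have h := bpath_sqr_le (w k) x t10 s0 st1; rewrite -(fineK (fin k)) lee_fin in h.
apply: le_trans h _; have := mulr_ge0 (sqr_ge0 sigma) B0; have := sqr_ge0 (phi0 x k); lra.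
Qed.

Let m k : R := fine (\int[P]_x (phi0 x k ^+ 2)%:E)%E.

Let phi0_norm_series : (\int[P]_x hn r (phi0 x) =
  \sum_(0 <= k <oo) (lam k `^ (2 * r))%:E * \int[P]_x (phi0 x k ^+ 2)%:E)%E.
Proof.
rewrite /hnorm2 integral_nneseries//; last first.
  move=> k; apply/measurable_EFinP; apply: measurable_funM => //.
  by apply: measurable_funX; exact: phi0_measurable.
apply: eq_eseriesr => k _; under eq_integral do rewrite EFinM.
rewrite ge0_integralZl_EFin ?powR_ge0//; last first.
  by apply/measurable_EFinP; apply: measurable_funX; exact: phi0_measurable.
by move=> x _; rewrite lee_fin sqr_ge0.
Qed.

Let mE k : (\int[P]_x (phi0 x k ^+ 2)%:E = (m k)%:E)%E.
Proof.
have ge0 j : (0 <= \int[P]_x (phi0 x j ^+ 2)%:E)%E.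
  by apply: integral_ge0 => x _; rewrite lee_fin sqr_ge0.
rewrite /m fineK// ge0_fin_numE// ltNge leye_eq; apply/negP => /eqP E.
have := phi0_lty; rewrite phi0_norm_series (nneseriesD1 (n := k))//; last first.
  by move=> j _; rewrite mule_ge0// lee_fin powR_ge0.
rewrite E gt0_muley ?lte_fin ?powR_gt0// addye// gt_eqF// (lt_le_trans (ltNyr 0))//.
by apply: nneseries_ge0 => j _ _; rewrite mule_ge0// lee_fin powR_ge0.
Qed.

Let m_ge0 k : 0 <= m k.
Proof. by rewrite fine_ge0//; apply: integral_ge0 => x _; rewrite lee_fin sqr_ge0. Qed.

Let weight_m : (\sum_(0 <= k <oo) (lam k `^ (2 * r) * m k)%:E)%E = (\int[P]_x hn r (phi0 x))%E.
Proof. by rewrite phi0_norm_series; apply: eq_eseriesr => k _; rewrite EFinM mE. Qed.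

Lemma noise_integral_sqr_le t k : 0 <= t ->
  (\int[P]_x ((sigma * ou (a k) (bpath (w k) x) t) ^+ 2)%:E <= (3 * sigma ^+ 2 / a k)%:E)%E.
Proof.
move=> t0; under eq_integral do rewrite exprMn EFinM.
rewrite ge0_integralZl_EFin ?sqr_ge0//.
- rewrite (_ : 3 * sigma ^+ 2 / a k = sigma ^+ 2 * (3 / a k)); last by ring.
  rewrite [leRHS]EFinM lee_wpmul2l ?lee_fin ?sqr_ge0//.
  exact: (ou_path_integral_sqr_le basisF (wB k)).
- by move=> x _; rewrite lee_fin sqr_ge0.
- apply/measurable_EFinP; apply: measurable_funX; exact: (ou_measurable basisF (wB k)).
Qed.

(** The exponential in front of the initial moment is kept because it pays for the additional factor
    lam_k^2 of H^(r+1), at a fixed time as well as after integration in time. *)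
Lemma mild_path_integral_sqr_le t k : 0 <= t ->
  (\int[P]_x (mild_path t x k ^+ 2)%:E <=
   (2 * expR (- (2 * a k * t)) * m k + 6 * sigma ^+ 2 / a k)%:E)%E.
Proof.
move=> t0; have mou := ou_measurable basisF (wB k) (a_gt0 k) t0.
apply: (@le_trans _ _ (\int[P]_x ((2 * expR (- (2 * a k * t)))%:E * (phi0 x k ^+ 2)%:E +
    2%:E * ((sigma * ou (a k) (bpath (w k) x) t) ^+ 2)%:E))%E).
  apply: le_integral_nonneg => x _; first by rewrite lee_fin sqr_ge0.
  rewrite -!EFinM -EFinD lee_fin; apply: le_trans (sqrD _ _) _.
  rewrite lerD2r le_eqVlt; apply/orP; left; apply/eqP.
  by rewrite exprMn -expRM_natl mulrN !mulrA.
have c0 : 0 <= 2 * expR (- (2 * a k * t)) by rewrite mulr_ge0// expR_ge0.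
have mp : measurable_fun setT (fun x => (phi0 x k ^+ 2)%:E).
  by apply/measurable_EFinP; apply: measurable_funX; exact: phi0_measurable.
have mz : measurable_fun setT (fun x => ((sigma * ou (a k) (bpath (w k) x) t) ^+ 2)%:E).
  by apply/measurable_EFinP; apply: measurable_funX; exact: measurable_funM.
rewrite ge0_integralD//; last 4 first.
- by move=> x _; rewrite -EFinM lee_fin mulr_ge0// sqr_ge0.
- exact: measurable_funeM.
- by move=> x _; rewrite -EFinM lee_fin mulr_ge0// sqr_ge0.
- exact: measurable_funeM.
rewrite !ge0_integralZl_EFin//; try by move=> x _; rewrite lee_fin sqr_ge0.
rewrite mE [leRHS]EFinD; apply: leeD; first by rewrite -EFinM.
rewrite (_ : 6 * _ / _ = 2 * (3 * sigma ^+ 2 / a k)); last by ring.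
by rewrite EFinM lee_wpmul2l// noise_integral_sqr_le.
Qed.

Lemma mild_path_integral_norm_le t : 0 <= t ->
  (\int[P]_x hn (r + 1) (mild_path t x) <=
   \sum_(0 <= k <oo) (lam k `^ (2 * r) * (2 * (lam k ^+ 2 * expR (- (2 * a k * t))) * m k +
      6 * sigma ^+ 2 / nu))%:E)%E.
Proof.
move=> t0; rewrite /hnorm2 integral_nneseries//; last first.
  move=> k; apply/measurable_EFinP; apply: measurable_funM => //.
  by apply: measurable_funX; exact: mild_path_measurable.
apply: lee_nneseries => [k _ _|k _].
  by apply: integral_ge0 => x _; exact: hterm_ge0.
under eq_integral do rewrite EFinM.
rewrite ge0_integralZl_EFin ?powR_ge0//; last 2 first.
- by move=> x _; rewrite lee_fin sqr_ge0.
- by apply/measurable_EFinP; apply: measurable_funX; exact: mild_path_measurable.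
apply: (@le_trans _ _ ((lam k `^ (2 * (r + 1)))%:E *
   (2 * expR (- (2 * a k * t)) * m k + 6 * sigma ^+ 2 / a k)%:E)%E).
  by rewrite lee_wpmul2l ?lee_fin ?powR_ge0// mild_path_integral_sqr_le.
rewrite -EFinM lee_fin powR_succ le_eqVlt; apply/orP; left; apply/eqP.
by field; rewrite gt_eqF//= gt_eqF.
Qed.

(** Parabolic smoothing: x exp(-x) <= 1 at x = 2 a_k t bounds 2 lam_k^2 exp(-2 a_k t) by 1 / (nu t),
    uniformly in k. *)
Lemma mild_path_integral_norm_lty t : 0 < t -> (\int[P]_x hn (r + 1) (mild_path t x) < +oo)%E.
Proof.
move=> t0; apply: le_lt_trans (mild_path_integral_norm_le (ltW t0)) _.
have nt0 : 0 < nu * t by rewrite mulr_gt0.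
have c0 : 0 <= 6 * sigma ^+ 2 / nu by rewrite divr_ge0 ?sig_ge0// ltW.
apply: (@le_lt_trans _ _ (((nu * t)^-1)%:E * (\int[P]_x hn r (phi0 x)) +
  (6 * sigma ^+ 2 / nu)%:E * weight%:E)%E); last first.
  rewrite lte_add_pinfty//; last exact: ltry.
  by rewrite lte_mul_pinfty ?lee_fin ?invr_ge0 ?(ltW nt0)// phi0_lty.
rewrite -weight_m -weightE -!nneseriesZl; last 2 first.
- by move=> k _; rewrite lee_fin powR_ge0.
- by move=> k _; rewrite lee_fin mulr_ge0// powR_ge0.
rewrite -nneseriesD; last 2 first.
- by move=> k _ _; rewrite -EFinM lee_fin (mulr_ge0 _ (mulr_ge0 (powR_ge0 _ _) (m_ge0 k)))// invr_ge0 ltW.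
- by move=> k _ _; rewrite -EFinM lee_fin (mulr_ge0 c0) ?powR_ge0.
apply: lee_nneseries => [k _ _|k _].
  rewrite lee_fin mulr_ge0 ?powR_ge0// addr_ge0// mulr_ge0 ?m_ge0// mulr_ge0//.
  by rewrite mulr_ge0 ?sqr_ge0 ?expR_ge0.
rewrite -!EFinM -EFinD lee_fin mulrDr lerD//; last by rewrite mulrC.
rewrite [leRHS]mulrCA ler_wpM2l ?powR_ge0// ler_wpM2r//.
rewrite -[leRHS]div1r ler_pdivlMr// expRN.
have h := expR_ge1Dx (2 * a k * t); have e0 := expR_gt0 (2 * a k * t).
rewrite [leLHS](_ : _ = 2 * a k * t / expR (2 * a k * t)); last by ring.
by rewrite ler_pdivrMr// mul1r; apply: le_trans h; rewrite lerDr.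
Qed.

(** The time integral of exp(-2 a_k s) is at most 1 / (2 a_k), which turns 2 lam_k^2 into 1 / nu;
    the noise term is constant in time and contributes the factor t. *)
Lemma mild_path_energy_le t : 0 < t ->
  (\int[mu]_(s in `[0%R, t]) \int[P]_x hn (r + 1) (mild_path s x) <=
   (nu^-1)%:E * \int[P]_x hn r (phi0 x) + (6 * sigma ^+ 2 * t / nu * weight)%:E)%E.
Proof.
move=> t0.
pose B k s : R := lam k `^ (2 * r) * (2 * (lam k ^+ 2 * expR (- (2 * a k * s))) * m k +
      6 * sigma ^+ 2 / nu).
have c0 : 0 <= 6 * sigma ^+ 2 / nu by rewrite divr_ge0 ?sig_ge0// ltW.
have B0 k s : 0 <= B k s.
  by rewrite mulr_ge0 ?powR_ge0// addr_ge0// !mulr_ge0 ?expR_ge0 ?(ltW (lam_gt0 _)).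
have ce k : continuous (fun s => expR (- (2 * a k * s))).
  move=> y; apply: continuous_comp; last exact: continuous_expR.
  by apply: cvgN; apply: cvgM; [exact: cvg_cst|exact: cvg_id].
have mexp k : measurable_fun `[0, t] (fun s => expR (- (2 * a k * s))).
  by apply: measurable_funTS; exact: continuous_measurable_fun.
have mB k : measurable_fun `[0, t] (fun s => (B k s)%:E).
  apply/measurable_EFinP; apply: measurable_funM => //; apply: measurable_funD => //.
  by apply: measurable_funM => //; apply: measurable_funM => //; apply: measurable_funM.
apply: (@le_trans _ _ (\int[mu]_(s in `[0%R, t]) \sum_(0 <= k <oo) (B k s)%:E)%E).
  apply: le_integral_nonneg => s; first by move=> _; apply: integral_ge0 => x _; exact: hnorm2_ge0.
  by rewrite /= in_itv/= => /andP[s0 _]; exact: mild_path_integral_norm_le.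
rewrite integral_nneseries//; last by move=> k s _; rewrite lee_fin.
rewrite -weight_m EFinM -weightE.
rewrite -nneseriesZl => [|k _]; last by rewrite lee_fin mulr_ge0// powR_ge0.
rewrite -nneseriesZl => [|k _]; last by rewrite lee_fin powR_ge0.
have tn0 : 0 <= 6 * sigma ^+ 2 * t / nu.
  by rewrite divr_ge0 ?(ltW nu_gt0)// mulr_ge0 ?sig_ge0 ?(ltW t0).
rewrite -nneseriesD; last 2 first.
- by move=> k _ _; rewrite -EFinM lee_fin !mulr_ge0 ?powR_ge0// invr_ge0 ltW.
- by move=> k _ _; rewrite -EFinM lee_fin (mulr_ge0 tn0) ?powR_ge0.
apply: lee_nneseries => [k _ _|k _]; first by apply: integral_ge0 => s _; rewrite lee_fin.
have BE s : (B k s)%:E =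
  ((2 * lam k `^ (2 * r) * lam k ^+ 2 * m k)%:E * (expR (- (2 * a k * s)))%:E +
   cst (lam k `^ (2 * r) * (6 * sigma ^+ 2 / nu))%:E s)%E.
  by rewrite /= -EFinM -EFinD; congr (_%:E); rewrite /B; ring.
have c1 : 0 <= 2 * lam k `^ (2 * r) * lam k ^+ 2 * m k.
  by rewrite mulr_ge0// mulr_ge0 ?sqr_ge0// mulr_ge0 ?powR_ge0.
under eq_integral do rewrite BE.
rewrite ge0_integralD//; last 3 first.
- by move=> s _; rewrite -EFinM lee_fin (mulr_ge0 c1) ?expR_ge0.
- by apply: measurable_funeM; apply/measurable_EFinP; exact: mexp.
- by move=> s _; rewrite lee_fin mulr_ge0 ?powR_ge0.
rewrite ge0_integralZl_EFin//; last by apply/measurable_EFinP; exact: mexp.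
apply: leeD.
  apply: (@le_trans _ _ ((2 * lam k `^ (2 * r) * lam k ^+ 2 * m k)%:E * ((2 * a k)^-1)%:E)%E).
    rewrite lee_wpmul2l ?lee_fin//.
    by apply: integral_expR_decay; [rewrite mulr_gt0|exact: ltW].
  rewrite -!EFinM lee_fin le_eqVlt; apply/orP; left; apply/eqP.
  by field; rewrite gt_eqF//= gt_eqF.
rewrite integral_cst//.
rewrite [X in (_ * X)%E](_ : _ = lebesgue_measure [set` `[0, t]%R])//.
rewrite lebesgue_measure_itv/= lte_fin t0 sube0 -!EFinM lee_fin le_eqVlt.
by apply/orP; left; apply/eqP; ring.
Qed.

Definition mild_path_pair (z : T * R) := mild_path (Num.max 0 z.2) z.1.

Lemma mild_path_energy t :
  (\int[P \x mu]_(z in setT `*` `[0%R, t]%classic) hn (r + 1) (mild_path_pair z) =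
   \int[mu]_(s in `[0%R, t]) \int[P]_x hn (r + 1) (mild_path s x))%E /\
  (\int[P]_x \int[mu]_(s in `[0%R, t]) hn (r + 1) (mild_path_pair (x, s)) =
   \int[mu]_(s in `[0%R, t]) \int[P]_x hn (r + 1) (mild_path s x))%E.
Proof.
pose f (z : T * measurableTypeR R) := hn (r + 1) (mild_path_pair z).
have mf : measurable_fun setT f by apply: measurable_hnorm2 => k; exact: mild_path_joint.
have f0 z : (0 <= f z)%E by exact: hnorm2_ge0.
have mI : measurable (`[0, t]%classic : set (measurableTypeR R)) by exact: measurable_itv.
have E : (\int[mu]_(s in `[0%R, t]) \int[P]_x f (x, s) =
    \int[mu]_(s in `[0%R, t]) \int[P]_x hn (r + 1) (mild_path s x))%E.
  by apply: eq_integral => s; rewrite inE/= in_itv/= => /andP[s0 _]; rewrite /f /mild_path_pair/= max_r.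
split; first by rewrite -E -(integral_strip2 P mu mI mf f0).
by rewrite -E -(integral_strip2 P mu mI mf f0) (integral_strip1 P mu mI mf f0).
Qed.

Let pair_measurable s : measurable_fun setT (fun z : T * measurableTypeR R => hn s (mild_path_pair z)).
Proof. by apply: measurable_hnorm2 => k; exact: mild_path_joint. Qed.

Lemma mild_path_energy_lty t : 0 < t ->
  (\int[mu]_(s in `[0%R, t]) \int[P]_x hn (r + 1) (mild_path s x) < +oo)%E.
Proof.
move=> t0; apply: le_lt_trans (mild_path_energy_le t0) _.
by rewrite lte_add_pinfty ?ltry// lte_mul_pinfty ?lee_fin ?invr_ge0 ?(ltW nu_gt0)// phi0_lty.
Qed.

Lemma mild_path_energy_ae : {ae P, forall x, forall n : nat,
  (\int[mu]_(s in `[0%R, n.+1%:R]) hn (r + 1) (mild_path_pair (x, s)) < +oo)%E}.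
Proof.
apply/ae_foralln => n; have n0 : 0 < n.+1%:R :> R by rewrite ltr0n.
have mI : measurable (`[0, n.+1%:R]%classic : set (measurableTypeR R)) by exact: measurable_itv.
have ge0 x : (0 <= \int[mu]_(s in `[0%R, n.+1%:R]) hn (r + 1) (mild_path_pair (x, s)))%E.
  by apply: integral_ge0 => s _; exact: hnorm2_ge0.
have : P.-integrable setT (fun x => \int[mu]_(s in `[0%R, n.+1%:R]) hn (r + 1) (mild_path_pair (x, s)))%E.
  apply/integrableP; split.
    exact: (measurable_strip1 mu mI (pair_measurable (r + 1)) (fun z => hnorm2_ge0 lam (r + 1) (mild_path_pair z))).
  under eq_integral do rewrite gee0_abs//.
  by have [_ ->] := mild_path_energy n.+1%:R; exact: mild_path_energy_lty.
move/(integrable_ae measurableT); apply: filterS => x /(_ I).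
by rewrite ge0_fin_numE.
Qed.

Let bpath_ae_all : {ae P, forall x, forall k t, 0 <= t -> bpath (w k) x t = w k t x}.
Proof. by apply/ae_foralln => k; exact: (bpath_ae (wB k)). Qed.

Lemma mild_path_equation x k t : 0 <= t -> mild_path t x k =
  phi0 x k - a k * (\int[mu]_(s in `[0, t]) mild_path s x k) + sigma * bpath (w k) x t.
Proof.
move=> t0; apply: ou_equation => //; first exact: bpath_continuous.
by move=> s; exact: bpath_le0.
Qed.

(* Each coordinate of a solution solves a scalar Volterra equation. *)
Lemma solution_unique u : is_solution P lam nu sigma F w r phi u ->
  {ae P, forall x, forall t, 0 <= t -> u t x = mild_path t x}.
Proof.
move=> su; have aeF : Filter (nbhs (almost_everywhere P)) by exact: ae_filter_ringOfSetsType.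
have h1 := @filterI T _ aeF _ _ bpath_ae_all phi0_ae.
have h2 := @filterI T _ aeF _ _ (sol_continuous su) (sol_equation su).
move: h1 h2; apply: filterS2 => x [bE pE] [cu eu] t t0.
apply/funext => k.
have cuk s : 0 < s -> {for s, continuous (fun s => u s x k)}.
  move=> s0; have [_ hc] := cu s s0.
  apply/cvgrPdist_lt => e e0; have el : 0 < lam k `^ r * e by rewrite mulr_gt0 ?powR_gt0.
  have hc0 i : (0 <= hnorm lam r (u i x - u s x)%R)%E by exact: hnorm_ge0.
  have sF : Filter (nbhs s) by exact: nbhs_filter.
  have := (@cvge0P _ _ (nbhs s) sF _ hc0).1 hc _ el; apply: filterS => i hi.
  rewrite distrC -(ltr_pM2l (powR_gt0 r (lam_gt0 k))) -lte_fin.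
  exact: le_lt_trans (hterm_le_hnorm r (u i x - u s x) (lam_gt0 k)) hi.
(* Continuity is known at positive times only, so the point 0 is split off. *)
have mu_ (t' : R) : measurable_fun `[0, t'] (fun s => u s x k).
  have sub : `[0, t']%classic `<=` [set 0] `|` `]0, t']%classic.
    move=> s /=; rewrite !in_itv/= => /andP[s0 ->]; move: s0.
    by rewrite le_eqVlt => /predU1P[<-|->]; [left|right].
  apply: (measurable_funS _ sub); first exact: measurableU.
  apply/measurable_funU => //; split; first exact: measurable_fun_set1.
  apply: subspace_continuous_measurable_fun => //; apply/continuous_in_subspaceT => s.
  by rewrite inE/= in_itv/= => /andP[s0 _]; exact: cuk.
have key t' : 0 <= t' -> mu.-integrable `[0, t'] (fun s => (u s x k)%:E) /\
    u t' x k = phi0 x k - a k * (\int[mu]_(s in `[0, t']) u s x k) + sigma * bpath (w k) x t'.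
  move=> t'0; have [_ [I hI E]] := eu t' t'0.
  have ml : measurable_fun `[0, t'] (fun s => hlaplace lam (u s x) k).
    by apply: measurable_funM => //; exact: measurable_cst.
  have [il Ik] := bochner_integral_coord lam_gt0 hI ml.
  have l0 : lam k != 0 by rewrite gt_eqF.
  have iu : mu.-integrable `[0, t'] (fun s => (u s x k)%:E).
    rewrite (_ : (fun s => _) = (fun s => (- (lam k ^+ 2)^-1)%:E * (hlaplace lam (u s x) k)%:E)%E).
      exact: integrableZl.
    apply/funext => s; rewrite -EFinM /hlaplace; congr (_%:E); field.
    by rewrite l0.
  split => //; rewrite E !fctE Ik pE bE//; congr (_ + _); congr (_ + _).
  rewrite /hlaplace RintegralZl//; set J := Rintegral _ _ _.
  by rewrite -[LHS]/(nu * (- lam k ^+ 2 * J)); ring.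
have cr := @mild_path_continuous x k.
(* Initial value and noise cancel in this difference, leaving the homogeneous Volterra equation. *)
pose f s := u s x k - mild_path (Num.max 0 s) x k.
have rE t' : 0 <= t' -> (\int[mu]_(s in `[0, t']) mild_path s x k) =
    \int[mu]_(s in `[0, t']) mild_path (Num.max 0 s) x k.
  move=> _; apply: eq_Rintegral => s; rewrite inE/= in_itv/= => /andP[s0 _].
  by rewrite max_r.
have fE t' : 0 <= t' -> f t' = - (a k * \int[mu]_(s in `[0, t']) f s).
  move=> t'0; have [iu E] := key t' t'0.
  rewrite /f RintegralB//; last exact: continuous_segment_integrable.
  rewrite E max_r// mild_path_equation// rE//; ring.
have fint t' : 0 < t' -> mu.-integrable `[0, t'] (EFin \o f).
  move=> /ltW t'0; have [iu _] := key t' t'0.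
  rewrite (_ : EFin \o f = (fun s => (u s x k)%:E - (mild_path (Num.max 0 s) x k)%:E)%E).
    by apply: integrableB => //; exact: continuous_segment_integrable.
  by apply/funext => s; rewrite /= EFinB.
by have := volterra_unique fint fE t0; rewrite /f max_r// => /eqP; rewrite subr_eq0 => /eqP.
Qed.

(* The values off [H^r] are junk; freezing the path before time [0] makes it
   continuous at [0] from both sides. *)
Definition mild (t : R) x := hcut lam r (mild_path (Num.max 0 t) x).

Let max_ge0 (t : R) : 0 <= Num.max 0 t. Proof. by rewrite le_max lexx. Qed.

Lemma mild_adapted (t : R) : 0 <= t -> hmeasurable lam (F t) r (mild t).
Proof.
move=> t0 U hU.
have mc k : measurable_fun (setT : set (g_sigma_algebraType (F t))) (mild t ^~ k).
  apply: (@measurable_hcut R lam _ (g_sigma_algebraType (F t)) r (mild_path (Num.max 0 t))) => // j.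
  by rewrite max_r//; exact: mild_path_adapted.
have := @hopen_measurable R lam _ (g_sigma_algebraType (F t)) r (mild t) mc U hU.
by rewrite /measurable/= sigma_algebra_id//; exact: sb_sigma_algebra basisF _ t0.
Qed.

Lemma mild_L2 (t1 : R) : 0 < t1 ->
  in_L2 lam (P \x mu)%E (setT `*` `[0, t1]) (r + 1) (fun z => mild z.2 z.1).
Proof.
(* The representative must lie in H^(r+1) everywhere, so it is cut at that level; where the energy
   density is finite, this cut and the one at level [r] are both inactive. *)
move=> t10; exists (fun z => hcut lam (r + 1) (mild_path_pair z)).
have mD : measurable ((setT `*` `[0, t1]) : set (T * measurableTypeR R)).
  by apply: measurableX => //; exact: measurable_itv.
have fin : (\int[P \x mu]_(z in setT `*` `[0%R, t1]%classic) hn (r + 1) (mild_path_pair z) < +oo)%E.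
  by have [-> _] := mild_path_energy t1; exact: mild_path_energy_lty.
split.
- by move=> z _; exact: hcut_hscale.
- move=> U hU; apply: measurableI => //.
  apply: (@hopen_measurable _ _ _ (T * measurableTypeR R)%type) hU => k.
  by apply: (@measurable_hcut _ _ _ (T * measurableTypeR R)%type) => // j; exact: mild_path_joint.
- have : (P \x mu)%E.-integrable (setT `*` `[0, t1]) (fun z => hn (r + 1) (mild_path_pair z)).
    apply/integrableP; split; first exact: measurable_funTS.
    by under eq_integral do rewrite gee0_abs ?hnorm2_ge0//.
  move/(integrable_ae mD); apply: filterS => z hz /hz.
  rewrite ge0_fin_numE ?hnorm2_ge0// => hs.
  rewrite /mild -/(mild_path_pair (z.1, z.2)) (_ : (z.1, z.2) = z); last by case: z {hz hs}.
  rewrite !hcutE//; apply: (hscale_le (lam_gt0 0) lam_ge _ hs); lra.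
- by apply: le_lt_trans fin; apply: le_integral_nonneg => z _; [exact: hnorm2_ge0|exact: hnorm2_hcut_le].
Qed.

Let dominated_hscale (b : nat -> R) :
  (\sum_(0 <= k <oo) (lam k `^ (2 * r) * b k)%:E < +oo)%E ->
  forall f, (forall k, f k ^+ 2 <= b k) -> hscale lam r f.
Proof.
move=> hb f fb; apply: le_lt_trans hb; apply: lee_nneseries => [k _ _|k _].
  exact: hterm_ge0.
by rewrite lee_fin ler_wpM2l ?powR_ge0.
Qed.

Lemma mild_path_hscale : {ae P, forall x, forall t : R, hscale lam r (mild_path (Num.max 0 t) x)}.
Proof.
apply: filterS mild_path_dominated => x Hx t.
have t1 : 0 < Num.max 0 t + 1 by rewrite ltr_wpDl.
have [b [hb bb]] := Hx _ t1.
apply: (dominated_hscale hb) => k; have [] := bb (Num.max 0 t) k => //.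
by rewrite lerDl.
Qed.

Lemma mildE : {ae P, forall x, forall t : R, mild t x = mild_path (Num.max 0 t) x}.
Proof. by apply: filterS mild_path_hscale => x Hx t; rewrite /mild hcutE. Qed.

Lemma mild_continuous : {ae P, forall x, forall t : R, 0 < t ->
  hscale lam r (mild t x) /\ hnorm lam r (mild s x - mild t x) @[s --> t] --> 0%E}.
Proof.
move: mild_path_dominated mildE; apply: filterS2 => x Hx uE t t0; split; first exact: hcut_hscale.
have t1 : 0 < t + 1 by rewrite ltr_wpDr.
have [b [hb bb]] := Hx _ t1.
(* The factor 4 comes from (x - y)^2 <= 2 x^2 + 2 y^2 with both squares below [b k]. *)
apply/hnorm_cvg0; apply: (hnorm2_cvg_dominated (b := fun k => 4 * b k)).
- rewrite (_ : (\sum_(0 <= k <oo) _)%E = (4%:E * \sum_(0 <= k <oo) (lam k `^ (2 * r) * b k)%:E)%E).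
    by rewrite lte_mul_pinfty.
  rewrite -nneseriesZl => [|k _]; first by apply: eq_eseriesr => k _; rewrite -EFinM mulrCA.
  rewrite lee_fin mulr_ge0 ?powR_ge0//.
  by apply: le_trans (bb 0 k (lexx 0) (ltW t1)).1; exact: sqr_ge0.
- have : \forall s \near t, 0 < s /\ s < t + 1.
    near=> s; split; near: s; first exact: lt_nbhsr.
    by apply: lt_nbhsl; rewrite ltrDl.
  apply: filterS => s [s0 st] k; rewrite !fctE !uE !max_r ?(ltW s0) ?(ltW t0)//.
  apply: le_trans (sqrD _ _) _; rewrite sqrrN.
  have [+ _] := bb s k (ltW s0) (ltW st).
  have t't : t <= t + 1 by rewrite lerDl.
  by have [+ _] := bb t k (ltW t0) t't; lra.
- move=> k; rewrite (_ : (fun s => _) = (fun s => mild_path (Num.max 0 s) x k - mild_path (Num.max 0 t) x k)).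
    rewrite -[X in _ --> X](subrr (mild_path (Num.max 0 t) x k)).
    by apply: cvgB; [exact: mild_path_continuous|exact: cvg_cst].
  by apply/funext => s; rewrite !fctE !uE.
Unshelve. all: by end_near. Qed.

(** The supremum runs over uncountably many times; comparison with a measurable majorant is enough.
    Taking any [u] that agrees with the mild path lets the bound serve both for existence and for
    the final estimate. *)
Lemma mild_path_sup_le (t1 : R) (u : R -> T -> nat -> R) : 0 < t1 ->
  {ae P, forall x, forall t, 0 <= t -> u t x = mild_path t x} ->
  (\int[P]_x ereal_sup [set hn r (u t x) | t in `]0%R, t1[] <=
   2%:E * \int[P]_x hn r (phi0 x) + (8 * sigma ^+ 2 * (48 * t1 * weight))%:E)%E.
Proof.
move=> t10 uE.
have mphi : measurable_fun setT (fun x => hn r (phi0 x)).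
  by apply: measurable_hnorm2 => k; exact: phi0_measurable.
have mnoise := noise_bound_measurable (ltW t10).
apply: (@le_trans _ _ (\int[P]_x (2%:E * hn r (phi0 x) + (8 * sigma ^+ 2)%:E * noise_bound t1 x))%E).
  apply: ae_le_integral_nonneg => //.
  - move=> x _; apply: ereal_sup_ge; exists (hn r (u (t1 / 2) x)); last exact: hnorm2_ge0.
    by exists (t1 / 2) => //=; rewrite in_itv/=; apply/andP; split; lra.
  - by move=> x _; rewrite adde_ge0// mule_ge0 ?hnorm2_ge0 ?noise_bound_ge0// lee_fin sig_ge0.
  - by apply: emeasurable_funD; exact: measurable_funeM.
  - apply: filterS uE => x {}uE _; apply: ge_ereal_sup => y [t /=].
    rewrite in_itv/= => /andP[t0 tt1] <-; rewrite uE ?(ltW t0)//.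
    by apply: mild_path_norm_le => //; exact: ltW.
rewrite ge0_integralD//; last 4 first.
- by move=> x _; rewrite mule_ge0 ?hnorm2_ge0.
- exact: measurable_funeM.
- by move=> x _; rewrite mule_ge0 ?noise_bound_ge0// lee_fin sig_ge0.
- exact: measurable_funeM.
rewrite ge0_integralZl_EFin//.
rewrite ge0_integralZl_EFin//; last 2 first.
- by move=> x _; exact: noise_bound_ge0.
- exact: sig_ge0.
rewrite leeD2l//; apply: (@le_trans _ _ ((8 * sigma ^+ 2)%:E * (48 * t1 * weight)%:E)%E).
  by rewrite lee_wpmul2l ?lee_fin ?sig_ge0// noise_bound_le.
by rewrite -EFinM.
Qed.

Lemma mild_equation : {ae P, forall x, forall t : R, 0 <= t ->
  hscale lam (r - 1) (mild t x) /\
  exists2 I, bochner_integral lam (r - 1) t (fun s => hlaplace lam (mild s x)) I &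
    mild t x = phi x + nu *: I + sigma *: (fun k => w k t x)}.
Proof.
have r1 : r - 1 <= r by lra.

have aeF : Filter (nbhs (almost_everywhere P)) by exact: ae_filter_ringOfSetsType.
have h1 := @filterI T _ aeF _ _ bpath_ae_all phi0_ae.
have h2 := @filterI T _ aeF _ _ mildE mild_path_energy_ae.
move: h1 mild_path_dominated h2; apply: filterS3 => x [bE pE] Hx [uE en] t t0.
have lower f : hscale lam r f -> hscale lam (r - 1) f by exact: (hscale_le (lam_gt0 0) lam_ge r1).
split; first by apply: lower; exact: hcut_hscale.
have t1 : 0 < t + 1 by rewrite ltr_wpDl.
have [b [hb bb]] := Hx _ t1.
have tt1 : t <= t + 1 by rewrite lerDl.
have hw : hscale lam r (fun k => w k t x).
  by apply: (dominated_hscale hb) => k; rewrite -bE//; have [] := bb t k t0 tt1.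
(* The integral is read off from the equation. It thus lies in H^(r-1) at once, and its coordinates
   agree with the scalar integrals by the scalar equations. *)
exists (nu^-1 *: (mild t x - phi x - sigma *: (fun k => w k t x))); last first.
  rewrite scalerA divff ?gt_eqF// scale1r addrC -addrA; apply/funext => k; rewrite !fctE; ring.
have E : (fun s => hlaplace lam (mild s x)) = fun s => hlaplace lam (mild_path (Num.max 0 s) x).
  by apply/funext => s; rewrite uE.
rewrite E; apply: bochner_integral_continuous => //.
- move=> k s s0 st; apply: cvgM; first exact: cvg_cst.
  exact: mild_path_continuous.
- under eq_integral do rewrite hnorm2_hlaplace//.
  have [n tn] : exists n : nat, t <= n.+1%:R.
    exists (Num.truncn t); apply/ltW; exact: truncnS_gt.
  apply: le_lt_trans (en n); apply: ge0_subset_integral => //.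
  + by apply: measurable_hnorm2 => k; apply: measurable_funTS; apply: continuous_measurable_fun; exact: mild_path_continuous.
  + by move=> s /=; rewrite !in_itv/= => /andP[-> /le_trans]; exact.
- apply: hscaleZ; apply: hscaleB; last by apply: lower; exact: hscaleZ.
  by apply: lower; apply: hscaleB; [exact: hcut_hscale|rewrite -pE; exact: phi0_hscale].
move=> k; rewrite !fctE uE max_r// mild_path_equation// -pE bE//.
rewrite /hlaplace RintegralZl//; last by apply: continuous_segment_integrable; exact: mild_path_continuous.
rewrite -[LHS]/(nu^-1 * (phi0 x k - a k * (\int[mu]_(s in `[0, t]) mild_path s x k) + sigma * w k t x -
  phi0 x k - sigma * w k t x)) (_ : (\int[mu]_(s in `[0, t]) mild_path s x k) = \int[mu]_(s in `[0, t]) mild_path (Num.max 0 s) x k).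
  by field; rewrite gt_eqF.
by apply: eq_Rintegral => s; rewrite inE/= in_itv/= => /andP[s0 _]; rewrite max_r.
Qed.

Lemma mild_solution : is_solution P lam nu sigma F w r phi mild.
Proof.
split.
- exact: mild_adapted.
- exact: mild_L2.
- exact: mild_continuous.
- move=> t1 t10.
  have uE : {ae P, forall x, forall t, 0 <= t -> mild t x = mild_path t x}.
    by apply: filterS mildE => x E t t0; rewrite E max_r.
  apply: le_lt_trans (mild_path_sup_le t10 uE) _.
  by rewrite lte_add_pinfty ?ltry// lte_mul_pinfty ?phi0_lty.
- exact: mild_equation.
Qed.

(** The supremum contributes 2 and the energy 1 / nu as coefficients of the initial moment; the
    remaining terms bound the noise in the two estimates. *)
Definition energy_constant (t : R) : R :=
  2 + nu^-1 + (8 * sigma ^+ 2 * (48 * t * weight) + 6 * sigma ^+ 2 * t / nu * weight).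

Lemma solution_estimate u (t : R) : 0 < t -> is_solution P lam nu sigma F w r phi u ->
  (\int[P]_x ereal_sup [set hn r (u s x) | s in `]0%R, t[] +
   \int[P]_x \int[mu]_(s in `[0%R, t]) hn (r + 1) (u s x) <=
   (energy_constant t)%:E * (1 + \int[P]_x hn r (phi x)))%E.
Proof.
move=> t0 su; have uE := solution_unique su.
have E2 : (\int[P]_x \int[mu]_(s in `[0%R, t]) hn (r + 1) (u s x) <=
    (nu^-1)%:E * \int[P]_x hn r (phi0 x) + (6 * sigma ^+ 2 * t / nu * weight)%:E)%E.
  apply: le_trans (mild_path_energy_le t0); have [_ <-] := mild_path_energy t.
  apply: ae_le_integral_nonneg => //.
  - by move=> x _; apply: integral_ge0 => s _; exact: hnorm2_ge0.
  - by move=> x _; apply: integral_ge0 => s _; exact: hnorm2_ge0.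
  - have mI : measurable (`[0, t]%classic : set (measurableTypeR R)) by exact: measurable_itv.
    exact: (measurable_strip1 mu mI (pair_measurable (r + 1)) (fun z => hnorm2_ge0 lam (r + 1) (mild_path_pair z))).
  - apply: filterS uE => x E _; apply: le_integral_nonneg => s; first by move=> _; exact: hnorm2_ge0.
    rewrite /= in_itv/= => /andP[s0 _]; rewrite (E s s0).
    by rewrite (_ : mild_path_pair (x, s) = mild_path s x)// /mild_path_pair/= max_r.
apply: le_trans (leeD (mild_path_sup_le t0 uE) E2) _.
have := phi0_le; have := phi0_lty.
have : (0 <= \int[P]_x hn r (phi0 x))%E by apply: integral_ge0 => x _; exact: hnorm2_ge0.
have W0 := weight_ge0; have s0 := sqr_ge0 sigma; have n0 : 0 <= nu^-1 by rewrite invr_ge0 ltW.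
have B1 : 0 <= 8 * sigma ^+ 2 * (48 * t * weight).
  by rewrite mulr_ge0 ?sig_ge0// (mulr_ge0 _ W0)// mulr_ge0// ltW.
have B2 : 0 <= 6 * sigma ^+ 2 * t / nu * weight.
  by rewrite (mulr_ge0 _ W0)// (mulr_ge0 _ n0)// mulr_ge0 ?sig_ge0 ?(ltW t0).
case: (\int[P]_x hn r (phi0 x))%E => [e e0 _||//]; last by [].
case: (\int[P]_x hn r (phi x))%E => [e'|_|//]; last first.
  rewrite addey// gt0_muley ?leey// lte_fin /energy_constant.
  by rewrite ltr_wpDr ?addr_ge0// ltr_wpDr.
rewrite lee_fin => ee'.
rewrite -[leLHS]/((2 * e + 8 * sigma ^+ 2 * (48 * t * weight) +
  (nu^-1 * e + 6 * sigma ^+ 2 * t / nu * weight))%:E).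
rewrite -[leRHS]/((energy_constant t * (1 + e'))%:E) lee_fin /energy_constant.
rewrite lee_fin in e0; have e'0 := le_trans e0 ee'.
have := mulr_ge0 n0 e0; have := ler_wpM2l n0 ee'; have := mulr_ge0 B1 e'0; have := mulr_ge0 B2 e'0.
lra.
Qed.

End mild_solution.

(** * The noise part of the solution *)

Section L2_criteria.
Context {R : realType} {d : measure_display} {T : measurableType d}.
Variable lam : nat -> R.
Hypothesis lam_gt0 : forall k, 0 < lam k.
Local Notation hn := (hnorm2 lam).

Lemma in_L2_ae (mu : {measure set T -> \bar R}) s (X X' : T -> nat -> R) :
  (forall k, measurable_fun setT (X ^~ k)) ->
  (\int[mu]_x hn s (X x) < +oo)%E -> {ae mu, forall x, X' x = X x} ->
  in_L2 lam mu setT s X'.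
Proof.
move=> mX Xlty XE; have mh : measurable_fun setT (fun x => hn s (X x)) by exact: measurable_hnorm2.
exists (fun x => hcut lam s (X x)); split.
- by move=> x _; exact: hcut_hscale.
- move=> U hU; rewrite setTI; apply: hopen_measurable hU => k.
  exact: measurable_hcut.
- have : mu.-integrable setT (fun x => hn s (X x)).
    apply/integrableP; split => //.
    by under eq_integral do rewrite gee0_abs ?hnorm2_ge0//.
  move/(integrable_ae measurableT); move: XE; apply: filterS2 => x -> /(_ I) + _.
  by rewrite ge0_fin_numE ?hnorm2_ge0// => hs; rewrite hcutE.
- apply: le_lt_trans Xlty; apply: le_integral_nonneg => x _; first exact: hnorm2_ge0.
  exact: hnorm2_hcut_le.
Qed.

Lemma integral_hnorm2 (mu : {measure set T -> \bar R}) s (X : T -> nat -> R) :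
  (forall k, measurable_fun setT (X ^~ k)) ->
  (\int[mu]_x hn s (X x) =
   \sum_(0 <= k <oo) (lam k `^ (2 * s))%:E * \int[mu]_x (X x k ^+ 2)%:E)%E.
Proof.
move=> mX; have mX2 k : measurable_fun setT (fun x => (X x k ^+ 2)%:E).
  by apply/measurable_EFinP; exact: measurable_funX.
rewrite /hnorm2 integral_nneseries//; last first.
  by move=> k; apply/measurable_EFinP; apply: measurable_funM => //; exact: measurable_funX.
apply: eq_eseriesr => k _; under eq_integral do rewrite EFinM.
rewrite ge0_integralZl_EFin ?powR_ge0//.
by move=> x _; rewrite lee_fin sqr_ge0.
Qed.

Lemma hbasis_sumE n (c : nat -> R) j :
  (\sum_(k < n) c k *: hbasis k) j = if (j < n)%N then c j else 0.
Proof.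
rewrite fct_sumZE /hbasis; case: ltnP => jn.
  rewrite (bigD1 (Ordinal jn))//= eqxx mulr1 big1 ?addr0// => i ij.
  rewrite (_ : (j == i) = false) ?mulr0//; apply: contraNF ij => /eqP ji.
  by apply/eqP/val_inj.
rewrite big1// => i _; rewrite (_ : (j == i) = false) ?mulr0//.
by apply/eqP => ji; have := ltn_ord i; rewrite -ji ltnNge jn.
Qed.

(** The error of the n-th partial sum is the sequence with its first n coordinates erased, whose
    mean square is the tail of a convergent series. *)
Lemma L2_series_coord (P : probability T R) s (X X' : T -> nat -> R) (c : nat -> T -> R) :
  (forall k, measurable_fun setT (X ^~ k)) ->
  (\int[P]_x hn s (X x) < +oo)%E -> {ae P, forall x, X' x = X x} ->
  (forall k, {ae P, forall x, c k x = X x k}) -> L2_series lam P s c X'.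
Proof.
move=> mX Xlty XE cE; split; first exact: in_L2_ae XE.
pose u k := ((lam k `^ (2 * s))%:E * \int[P]_x (X x k ^+ 2)%:E)%E.
have u0 k : (0 <= u k)%E.
  by rewrite mule_ge0 ?lee_fin ?powR_ge0//; apply: integral_ge0 => x _; rewrite lee_fin sqr_ge0.
have tail : (\sum_(n <= k <oo) u k)%E @[n --> \oo] --> 0%E.
  by apply: nneseries_tail_cvg => //; rewrite -integral_hnorm2.
pose Z n x : nat -> R := fun k => if (n <= k)%N then X x k else 0.
have mZ n k : measurable_fun setT (Z n ^~ k).
  by rewrite /Z; case: (n <= k)%N => //; exact: measurable_cst.
have ZE n : (\int[P]_x hn s (Z n x) = \sum_(n <= k <oo) u k)%E.
  rewrite integral_hnorm2// (nneseries_split 0 n)//; last first.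
    by move=> k _; rewrite mule_ge0 ?lee_fin ?powR_ge0//; apply: integral_ge0 => x _; rewrite lee_fin sqr_ge0.
  rewrite add0n big1_seq ?add0e.
    rewrite -[LHS](@nneseries_addn _ (fun k => (lam k `^ (2 * s))%:E * \int[P]_x (Z n x k ^+ 2)%:E)%E); last first.
      by move=> k; rewrite mule_ge0 ?lee_fin ?powR_ge0//; apply: integral_ge0 => x _; rewrite lee_fin sqr_ge0.
    rewrite -(nneseries_addn n u0); apply: eq_eseriesr => k _; rewrite /u /Z.
    by under eq_integral do rewrite leq_addl.
  move=> k /andP[_]; rewrite mem_index_iota => /andP[_ kn]; rewrite /Z.
  under eq_integral do rewrite leqNgt kn/= expr0n/=.
  by rewrite integral0 mule0.
apply: (@squeeze_cvge _ _ _ _ (cst 0%E) _ (fun n => \sum_(n <= k <oo) u k)%E) => //; last exact: cvg_cst.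
apply: nearW => n; apply/andP; split; first by apply: integral_ge0 => x _; exact: hnorm2_ge0.
rewrite -ZE; apply: ae_le_integral_nonneg => //.
- exact: measurable_hnorm2.
have /ae_foralln cE' := cE; move: XE cE'; apply: filterS2 => x -> cx _.
rewrite (_ : X x - _ = Z n x)//; apply/funext => j.
rewrite -[LHS]/(X x j - (\sum_(k < n) c k x *: hbasis k) j) (hbasis_sumE n (fun k => c k x)) /Z.
by case: ltnP => jn; rewrite ?cx ?subrr ?subr0.
Qed.

End L2_criteria.

Section noise_series.
Context {R : realType} {d : measure_display} {T : measurableType d}.
Variables (P : probability T R) (F : R -> set (set T)) (w : nat -> R -> T -> R).
Variables (lam : nat -> R) (nu sigma r : R) (phi : T -> nat -> R).
Hypothesis basisF : usual_stochastic_basis P F.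
Hypothesis wB : forall k, brownian_motion P F (w k).
Hypothesis w_indep : mutually_independent P (fun k => sigma_process (w k)).
Hypothesis lam_gt0 : forall k, 0 < lam k.
Hypothesis weight_lty : (\sum_(0 <= k <oo) (lam k `^ (2 * r))%:E < +oo)%E.
Hypothesis nu_gt0 : 0 < nu.
Hypothesis sigma_gt0 : 0 < sigma.
Hypothesis phiL2 : in_L2 lam P setT r phi.
Hypothesis phi_adapted : hmeasurable lam (F 0) r phi.
Local Notation hn := (hnorm2 lam).
Local Notation a k := (nu * lam k ^+ 2).

Let a_gt0 k : 0 < a k.
Proof. by rewrite mulr_gt0// exprn_gt0. Qed.

Definition noise (t : R) k x : R := sigma * ou_limit (w k) (a k) t x.

Lemma noise_wrt t k : 0 <= t -> measurable_wrt (sigma_process (w k)) (noise t k).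
Proof.
move=> t0; apply: measurable_funM => //; apply: measurable_wrt_ou_limit => // s s0 _.
apply: measurable_wrt_sigma_of => A hA; apply: sub_sigma_algebra.
by exists s => //=; rewrite in_itv/= andbT.
Qed.

Lemma noise_measurable t k : 0 <= t -> measurable_fun setT (noise t k).
Proof.
move=> t0; apply: measurable_funM => //.
apply: (measurable_wrt_measurable (sb_sub basisF t0)); apply: measurable_wrt_ou_limit => // s s0 st.
exact: (brownian_adapted (sb_nondecreasing basisF) (wB k)).
Qed.

Lemma noise_ae t k : 0 <= t ->
  {ae P, forall x, noise t k x = sigma * ou (a k) (bpath (w k) x) t}.
Proof. by move=> t0; apply: filterS (ou_limit_ae (wB k) (a_gt0 k) t0) => x; rewrite /noise => ->. Qed.

Lemma noise_independent t : 0 <= t -> mutually_independent P (fun k => sigma_of (noise t k)).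
Proof.
move=> t0 J A uJ hA; apply: w_indep => // j jJ; have [B mB <-] := hA j jJ.
rewrite setTI; apply: measurable_wrt_preimage mB; last exact: noise_wrt.
exact: smallest_sigma_algebra.
Qed.

Lemma noise_gaussian t k : 0 < t -> gaussian P (noise t k)
  (sigma ^+ 2 / (2 * nu * lam k ^+ 2) * (1 - expR (- (2 * nu * lam k ^+ 2 * t)))).
Proof.
move=> t0; have mZ : measurable_fun setT (ou_limit (w k) (a k) t).
  apply: (measurable_wrt_measurable (sb_sub basisF (ltW t0))).
  apply: measurable_wrt_ou_limit => // [|s s0 st]; first exact: ltW.
  exact: (brownian_adapted (sb_nondecreasing basisF) (wB k)).
have := gaussian_scale sigma_gt0
  (ou_cvg_gaussian basisF (wB k) (a_gt0 k) t0 mZ (ou_limit_ae (wB k) (a_gt0 k) (ltW t0))).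
rewrite (_ : sigma ^+ 2 * _ = sigma ^+ 2 / (2 * nu * lam k ^+ 2) *
  (1 - expR (- (2 * nu * lam k ^+ 2 * t))))//.
by rewrite !mulrA mulrAC.
Qed.

Definition noise_path (t : R) x : nat -> R := fun k => sigma * ou (a k) (bpath (w k) x) t.

Lemma noise_path_measurable t k : 0 <= t -> measurable_fun setT (noise_path t ^~ k).
Proof. by move=> t0; apply: measurable_funM => //; exact: (ou_measurable basisF (wB k)). Qed.

Lemma noise_path_lty t : 0 <= t -> (\int[P]_x hn (r + 1) (noise_path t x) < +oo)%E.
Proof.
move=> t0; rewrite (integral_hnorm2 lam P (r + 1) (fun k => noise_path_measurable k t0)).
apply: (@le_lt_trans _ _ ((3 * sigma ^+ 2 / nu)%:E *
    \sum_(0 <= k <oo) (lam k `^ (2 * r))%:E)%E); last first.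
  by rewrite lte_mul_pinfty ?lee_fin// divr_ge0 ?(ltW nu_gt0)// mulr_ge0// sqr_ge0.
rewrite -nneseriesZl => [|k _]; last by rewrite lee_fin powR_ge0.
apply: lee_nneseries => [k _ _|k _].
  by rewrite mule_ge0 ?lee_fin ?powR_ge0//; apply: integral_ge0 => x _; rewrite lee_fin sqr_ge0.
apply: (@le_trans _ _ ((lam k `^ (2 * (r + 1)))%:E * (3 * sigma ^+ 2 / a k)%:E)%E).
  rewrite lee_wpmul2l ?lee_fin ?powR_ge0//.
  exact: (noise_integral_sqr_le sigma basisF wB lam_gt0 nu_gt0).
rewrite -!EFinM lee_fin powR_succ// le_eqVlt; apply/orP; left; apply/eqP.
by field; rewrite !gt_eqF.
Qed.

Variable u : R -> T -> nat -> R.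
Hypothesis u_sol : is_solution P lam nu sigma F w r phi u.

Lemma solution_in_L2 t : 0 < t -> in_L2 lam P setT (r + 1) (u t).
Proof.
move=> t0; apply: (@in_L2_ae _ _ _ lam lam_gt0 P (r + 1) (mild_path w lam nu sigma r phi t)).
- by move=> k; exact: (@mild_path_measurable R d T P F w lam nu sigma r phi basisF wB lam_gt0 nu_gt0 phi_adapted t k (ltW t0)).
- exact: (mild_path_integral_norm_lty sigma basisF wB lam_gt0 weight_lty nu_gt0 phiL2 phi_adapted).
- apply: filterS (solution_unique wB lam_gt0 nu_gt0 phiL2 u_sol) => x; apply; exact: ltW.
Qed.

Lemma solution_noise t : 0 <= t ->
  {ae P, forall x, u t x - heat_semigroup lam nu t (phi x) = noise_path t x}.
Proof.
move=> t0; move: (solution_unique wB lam_gt0 nu_gt0 phiL2 u_sol) (phi0_ae phiL2).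
apply: filterS2 => x uE pE; rewrite uE// -pE; apply/funext => k; rewrite !fctE /mild_path /heat_semigroup.
rewrite (_ : - lam k ^+ 2 * nu * t = - (a k * t)); last by ring.
by rewrite addrAC subrr add0r.
Qed.

Lemma solution_noise_series t : 0 < t -> L2_series lam P (r + 1) (noise t)
  (fun x => u t x - heat_semigroup lam nu t (phi x)).
Proof.
move=> /ltW t0; apply: (L2_series_coord lam_gt0 (X := noise_path t)).
- by move=> k; exact: noise_path_measurable.
- exact: noise_path_lty.
- exact: solution_noise.
- by move=> k; exact: noise_ae.
Qed.

End noise_series.

(** * Convergence in law *)

Section sequence_space.
Context {R : realType}.

(** Finite-dimensional rectangles, a generating family stable under intersection for the product
    sigma-algebra on sequences. *)
Definition cylinder : set (set (nat -> R)) := [set A | exists n (B : nat -> set R),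
  (forall k, measurable (B k)) /\ A = [set f | forall k, (k < n)%N -> B k (f k)]].

Definition seqspace := g_sigma_algebraType cylinder.

Lemma cylinder_setI : setI_closed cylinder.
Proof.
move=> _ _ [n [B [mB ->]]] [m [C [mC ->]]].
exists (maxn n m), (fun k => (if (k < n)%N then B k else setT) `&` (if (k < m)%N then C k else setT)).
split; first by move=> k; apply: measurableI; case: ifP.
apply/seteqP; split => f /=.
  by move=> [h1 h2] k _; split; case: ifP => // kn; [exact: h1|exact: h2].
by move=> h; split => k kn; have := h k; rewrite leq_max kn ?orbT => /(_ isT)[].
Qed.

Lemma measurable_seq d (T : measurableType d) (X : T -> nat -> R) :
  (forall k, measurable_fun setT (X ^~ k)) -> measurable_fun setT (X : T -> seqspace).
Proof.
move=> mX; apply: (@measurability _ _ _ seqspace _ _ cylinder) => // _ [_ [n [B [mB ->]]] <-].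
rewrite setTI (_ : _ @^-1` _ = \bigcap_(k in `I_n) ((X ^~ k) @^-1` B k))//.
apply: bigcap_measurableType => k _; rewrite -[X in measurable X]setTI.
exact: mX.
Qed.

Lemma measurable_coord k : measurable_fun setT (fun f : seqspace => f k).
Proof.
move=> _ B mB; rewrite setTI; apply: sub_sigma_algebra.
exists k.+1, (fun j => if j == k then B else setT); split; first by move=> j; case: ifP.
apply/seteqP; split => f /=; first by move=> h j _; case: eqP => // ->.
by move=> /(_ k (ltnSn k)); rewrite eqxx.
Qed.

Variables (d1 d2 : measure_display) (T : measurableType d1) (S : measurableType d2).
Variables (P : probability T R) (Q : probability S R).

(** Independence and the marginal laws fix the probabilities of all rectangles, hence the law of the
    whole sequence. *)
Lemma eq_law_independent (X : T -> nat -> R) (Y : S -> nat -> R) (f : seqspace -> \bar R) :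
  (forall k, measurable_fun setT (X ^~ k)) -> (forall k, measurable_fun setT (Y ^~ k)) ->
  mutually_independent P (fun k => sigma_of (X ^~ k)) ->
  mutually_independent Q (fun k => sigma_of (Y ^~ k)) ->
  (forall k B, measurable B -> P ((X ^~ k) @^-1` B) = Q ((Y ^~ k) @^-1` B)) ->
  measurable_fun setT f -> (forall g, (0 <= f g)%E) ->
  (\int[P]_x f (X x) = \int[Q]_y f (Y y))%E.
Proof.
move=> mX mY iX iY XY mf f0.
have mX' := measurable_seq mX; have mY' := measurable_seq mY.
rewrite -(integral_law P mX' mf f0) -(integral_law Q mY' mf f0).
apply: eq_measure_integral => A mA _.
apply: (@measure_unique _ R seqspace cylinder (fun=> setT)) => //.
- exact: cylinder_setI.
- by move=> _; exists 0%N, (fun=> setT); split => //; apply/seteqP; split.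
- by apply/seteqP; split => // x _; exists 0%N.
- move=> _ [n [B [mB ->]]].
  have E U (Z : U -> nat -> R) : Z @^-1` [set f0 | forall k, (k < n)%N -> B k (f0 k)] =
      \bigcap_(j in [set` iota 0 n]) ((Z ^~ j) @^-1` B j).
    by apply/seteqP; split => x /= h k; have := h k; rewrite /= mem_iota add0n.
  set C := [set f0 | _]; rewrite -[LHS]/(P (X @^-1` C)) -[RHS]/(Q (Y @^-1` C)) /C !E (iX _ _ (iota_uniq 0 n)); last by move=> j _; exists (B j) => //; rewrite setTI.
  rewrite (iY _ _ (iota_uniq 0 n)); last by move=> j _; exists (B j) => //; rewrite setTI.
  by apply: eq_bigr => j _; exact: XY.
- by move=> _; rewrite (le_lt_trans (probability_le1 _ _)) ?ltry.
Qed.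

End sequence_space.

Lemma integral_cst_probability {R : realType} d (T : measurableType d) (P : probability T R)
    (c : \bar R) : (\int[P]_x cst c x = c)%E.
Proof.
rewrite integral_cst// [X in (_ * X)%E](_ : _ = 1%E) ?mule1//.
exact: probability_setT.
Qed.

Section continuous_functional.
Context {R : realType}.
Variables (lam : nat -> R) (s : R) (F : (nat -> R) -> R).
Hypothesis lam_gt0 : forall k, 0 < lam k.
Hypothesis cF : hcontinuous lam s F.

Lemma measurable_hcontinuous d (T : measurableType d) (X : T -> nat -> R) :
  (forall k, measurable_fun setT (X ^~ k)) ->
  measurable_fun setT (fun x => F (hcut lam s (X x))).
Proof.
move=> mX; apply: (measurability _ (RGenOInfty.measurableE R)) => //.
move=> _ [_ [c ->] <-]; rewrite setTI.
rewrite (_ : _ @^-1` _ = (fun x => hcut lam s (X x)) @^-1` [set f | hscale lam s f /\ c < F f]).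
  apply: (@hopen_measurable _ lam _ _ s) => [k|]; first exact: measurable_hcut.
  split; first by move=> f [].
  move=> f [hf cf]; have e0 : 0 < F f - c by rewrite subr_gt0.
  have [q q0 Hq] := cF hf e0; exists q => // g hg gf; split => //.
  by have := Hq g hg gf; rewrite ltr_norml => /andP[+ _]; lra.
apply/seteqP; split => x /=; rewrite in_itv/= andbT => //; last by case.
by move=> h; split => //; exact: hcut_hscale.
Qed.

Lemma hcontinuous_cvg (I : Type) (G : set_system I) {GG : Filter G} (f : I -> nat -> R) g :
  hscale lam s g -> hnorm2 lam s (f i - g)%R @[i --> G] --> 0%E ->
  F (hcut lam s (f i)) @[i --> G] --> F g.
Proof.
move=> hg /hnorm_cvg0 fg; apply/cvgrPdist_lt => e e0.
have [q q0 Hq] := cF hg e0.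
have h0 i : (0 <= hnorm lam s (f i - g)%R)%E by exact: hnorm_ge0.
have := (@cvge0P _ _ G GG _ h0).1 fg _ q0; apply: filterS => i hi.
have hfg : hscale lam s (f i - g).
  by move: hi; rewrite hnorm_ltE// => /lt_trans; apply; exact: ltry.
have hf : hscale lam s (f i) by rewrite -(subrK g (f i)); exact: hscaleD.
by rewrite hcutE// distrC; exact: Hq.
Qed.

End continuous_functional.

Section stationary_limit.
Context {R : realType} {d : measure_display} {T : measurableType d}.
Variables (P : probability T R) (F : R -> set (set T)) (w : nat -> R -> T -> R).
Variables (lam : nat -> R) (nu sigma r : R) (phi : T -> nat -> R).
Hypothesis basisF : usual_stochastic_basis P F.
Hypothesis wB : forall k, brownian_motion P F (w k).
Hypothesis w_indep : mutually_independent P (fun k => sigma_process (w k)).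
Hypothesis lam_gt0 : forall k, 0 < lam k.
Hypothesis weight_lty : (\sum_(0 <= k <oo) (lam k `^ (2 * r))%:E < +oo)%E.
Hypothesis nu_gt0 : 0 < nu.
Hypothesis sigma_gt0 : 0 < sigma.
Hypothesis phiL2 : in_L2 lam P setT r phi.
Hypothesis phi_adapted : hmeasurable lam (F 0) r phi.
Hypothesis phi_indep : independent2 P
  <<s preimage_set_system setT phi (hopen lam r) >> (sigma_cylindrical w).
Context {dS : measure_display} {S : measurableType dS}.
Variables (Q : probability S R) (zeta : nat -> S -> R) (Wbar : S -> nat -> R).
Hypothesis zeta_gaussian : forall k, gaussian Q (zeta k) 1.
Hypothesis zeta_indep : mutually_independent Q (fun k => sigma_of (zeta k)).
Hypothesis WbarE : L2_series lam Q (r + 1) (fun k x => zeta k x / lam k) Wbar.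
Hypothesis Wbar_hscale : forall y, hscale lam (r + 1) (Wbar y).
Hypothesis Wbar_hmeasurable : hmeasurable lam measurable (r + 1) Wbar.
Local Notation hn := (hnorm2 lam).
Local Notation s := (r + 1).
Local Notation a k := (nu * lam k ^+ 2).
Local Notation c := (sigma * (2 * nu) `^ (- 2^-1)).
Local Notation phi0 := (phi0 lam r phi).
Local Notation noise t := (noise w lam nu sigma t).

Let a_gt0 k : 0 < a k.
Proof. by rewrite mulr_gt0// exprn_gt0. Qed.

Let c_sqr : c ^+ 2 = sigma ^+ 2 / (2 * nu).
Proof.
have n2 : 0 < 2 * nu by rewrite mulr_gt0.
rewrite exprMn; congr (_ * _).
by rewrite -powR_mulrn ?powR_ge0// -powRrM mulNr mulVf ?pnatr_eq0// powR_inv1// ltW.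
Qed.

Let c_gt0 : 0 < c. Proof. by apply: mulr_gt0 => //; apply: powR_gt0; exact: mulr_gt0. Qed.

Lemma gff_measurable k : measurable_fun setT (Wbar ^~ k).
Proof.
have := @measurable_hcut_coord R lam lam_gt0 _ S s Wbar k.
rewrite (_ : (fun x => hcut lam s (Wbar x) k) = Wbar ^~ k); first exact.
by apply/funext => y; rewrite hcutE.
Qed.

(** Once n exceeds k, the k-th coordinate of the n-th partial sum no longer changes. The mean square
    of its distance to [Wbar] is therefore a constant bounded by a sequence tending to 0. *)
Lemma gff_coord : {ae Q, forall y, forall k, Wbar y k = zeta k y / lam k}.
Proof.
apply/ae_foralln => k.
have mz : measurable_fun setT (zeta k) by have [] := zeta_gaussian k.
pose h y := (lam k `^ (2 * s) * (Wbar y k - zeta k y / lam k) ^+ 2)%:E.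
have mh : measurable_fun setT h.
  apply/measurable_EFinP; apply: measurable_funM => //; apply: measurable_funX.
  by apply: measurable_funB; [exact: gff_measurable|exact: measurable_funM].
have h0 y : (0 <= h y)%E by rewrite lee_fin mulr_ge0 ?powR_ge0 ?sqr_ge0.
have [_ Wcvg] := WbarE.
have ih0 : (\int[Q]_y h y = 0)%E.
  apply/eqP; rewrite eq_le integral_ge0// andbT; apply/lee_addgt0Pr => e e0; rewrite add0e.
  have ge0 n : (0 <= \int[Q]_x hn s (Wbar x - \sum_(k0 < n) (zeta k0 x / lam k0) *: hbasis k0)%R)%E.
    by apply: integral_ge0 => x _; exact: hnorm2_ge0.
  have [n _ Hn] := (@cvge0P _ _ \oo eventually_filter _ ge0).1 Wcvg _ e0.
  have /ltW := Hn (maxn n k.+1) (leq_maxl _ _); apply: le_trans.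
  apply: le_integral_nonneg => y _; first exact: h0.
  apply: le_trans (hnorm2_ge_term lam s _ k).
  rewrite /h -[X in (_ <= (_ * X ^+ 2)%:E)%E]/(Wbar y k - (\sum_(k0 < maxn n k.+1) (zeta k0 y / lam k0) *: hbasis k0) k).
  by rewrite (hbasis_sumE _ (fun j => zeta j y / lam j)) leq_max ltnSn orbT.
have : ae_eq Q setT h (cst 0%E).
  by apply/(ae_eq_integral_abs Q measurableT mh); under eq_integral do rewrite gee0_abs//.
apply: filterS => y /(_ I) [] /eqP; rewrite mulf_eq0 gt_eqF ?powR_gt0//= sqrf_eq0 subr_eq0.
by move=> /eqP.
Qed.

(** The ratio of the standard deviation of the k-th noise coordinate at time t to its stationary
    value. *)
Definition damping (t : R) k : R := Num.sqrt (1 - expR (- (2 * a k * t))).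

Definition damped_field t y : nat -> R := fun k => damping t k * (c * (zeta k y / lam k)).

Lemma damped_field_measurable t k : measurable_fun setT (damped_field t ^~ k).
Proof.
have [_ mz _] := zeta_gaussian k.
by apply: measurable_funM => //; apply: measurable_funM => //; exact: measurable_funM.
Qed.

Lemma damping_gt0 t k : 0 < t -> 0 < damping t k.
Proof.
move=> t0; rewrite sqrtr_gt0 subr_gt0 -expR0 ltr_expR oppr_lt0.
by rewrite !mulr_gt0// exprn_gt0.
Qed.

Lemma damped_field_gaussian t k : 0 < t -> gaussian Q (damped_field t ^~ k)
  (sigma ^+ 2 / (2 * nu * lam k ^+ 2) * (1 - expR (- (2 * nu * lam k ^+ 2 * t)))).
Proof.
move=> t0; have dt := damping_gt0 k t0.
have b0 : 0 < damping t k * c / lam k by apply: divr_gt0 => //; exact: mulr_gt0.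
have := gaussian_scale b0 (zeta_gaussian k).
rewrite (_ : (fun x => _ * zeta k x) = damped_field t ^~ k); last first.
  by apply/funext => y; rewrite /damped_field; ring.
rewrite mulr1 exprMn [(damping t k * _) ^+ 2]exprMn exprVn c_sqr sqr_sqrtr.
  rewrite (_ : 2 * nu * lam k ^+ 2 * t = 2 * a k * t); last by ring.
  set q := 1 - _; rewrite (_ : q * _ * _ = sigma ^+ 2 / (2 * nu * lam k ^+ 2) * q)//.
  by field; rewrite !gt_eqF.
by move: dt; rewrite sqrtr_gt0 => /ltW.
Qed.

Lemma damped_field_independent t : mutually_independent Q (fun k => sigma_of (damped_field t ^~ k)).
Proof.
move=> J A uJ hA; apply: zeta_indep => // j jJ; have [B mB <-] := hA j jJ.
exists ((fun x : R => damping t j * (c * (x / lam j))) @^-1` B) => //.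
rewrite -[X in measurable X]setTI.
have mf : measurable_fun setT (fun x : R => damping t j * (c * (x / lam j))).
  by apply: measurable_funM => //; apply: measurable_funM => //; exact: measurable_funM.
exact: mf.
Qed.

Lemma integral_noise_law t (f : @seqspace R -> \bar R) : 0 < t ->
  measurable_fun setT f -> (forall g, (0 <= f g)%E) ->
  (\int[P]_x f (fun k => noise t k x) = \int[Q]_y f (damped_field t y))%E.
Proof.
move=> t0 mf f0; apply: (eq_law_independent (X := fun x k => noise t k x)) => //.
- by move=> k; apply: (noise_measurable lam nu sigma basisF wB); exact: ltW.
- by move=> k; exact: damped_field_measurable.
- by apply: noise_independent => //; exact: ltW.
- exact: damped_field_independent.
- move=> k B mB.
  have [_ _ ->//] := noise_gaussian basisF wB lam_gt0 nu_gt0 sigma_gt0 k t0.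
  by have [_ _ ->//] := damped_field_gaussian k t0.
Qed.

(** Each side is a measurable function of its own data: the cut initial value of the open-set events
    of [phi], the noise of the unmodified Brownian paths. *)
Lemma initial_noise_independent t (A B : set (@seqspace R)) : 0 <= t ->
  measurable A -> measurable B ->
  (P (phi0 @^-1` A `&` (fun x k => noise t k x) @^-1` B) =
   P (phi0 @^-1` A) * P ((fun x k => noise t k x) @^-1` B))%E.
Proof.
move=> t0 mA mB; apply: phi_indep.
  pose G := preimage_set_system setT phi (hopen lam r).
  have := @measurable_seq R _ (g_sigma_algebraType G) phi0.
  rewrite -[X in <<s G >> X]setTI; apply => // k.
  apply: (@measurable_hcut_coord R lam lam_gt0 _ (g_sigma_algebraType G)) => U hU.
  by apply: sub_sigma_algebra; exists U => //; rewrite setTI.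
pose G := \bigcup_k sigma_process (w k).
have := @measurable_seq R _ (g_sigma_algebraType G) (fun x k => noise t k x).
rewrite /sigma_cylindrical -[X in <<s _ >> X]setTI; apply => // k.
apply: (@sub_measurable_wrt _ _ _ (sigma_process (w k))); first by move=> C hC; exists k.
exact: noise_wrt.
Qed.

(** For t >= 1, exp(-2 a_k t) <= 1 / a_k, which lets the H^r norm of the initial value dominate its
    evolution in H^(r+1). The field part is dominated because the damping stays between 0 and 1. *)
Lemma solution_law_cvg_pointwise x y : (forall k, Wbar y k = zeta k y / lam k) ->
  hn s (heat_semigroup lam nu t (phi0 x) + damped_field t y - c *: Wbar y)
    @[t --> +oo] --> 0%E.
Proof.
move=> WE.
have fieldE t k : (heat_semigroup lam nu t (phi0 x) + damped_field t y - c *: Wbar y) k =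
    expR (- (a k * t)) * phi0 x k + (damping t k - 1) * (c * Wbar y k).
  rewrite -[LHS]/(expR (- lam k ^+ 2 * nu * t) * phi0 x k +
    damping t k * (c * (zeta k y / lam k)) - c * Wbar y k) -WE.
  by rewrite (_ : - lam k ^+ 2 * nu * t = - (a k * t)); ring.
have c0 : 0 <= 2 * c ^+ 2 by rewrite mulr_ge0// sqr_ge0.
have n0 : 0 <= 2 / nu by rewrite divr_ge0// ltW.
apply: (hnorm2_cvg_dominated (b := fun k => 2 / a k * phi0 x k ^+ 2 + 2 * c ^+ 2 * Wbar y k ^+ 2)).
- rewrite (_ : (\sum_(0 <= k <oo) _)%E = ((2 / nu)%:E * hn r (phi0 x) + (2 * c ^+ 2)%:E * hn s (Wbar y))%E).
    rewrite lte_add_pinfty// lte_mul_pinfty ?lee_fin//; first exact: phi0_hscale.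
    exact: Wbar_hscale.
  rewrite /hnorm2 -nneseriesZl => [|k _]; last exact: hterm_ge0.
  rewrite -nneseriesZl => [|k _]; last exact: hterm_ge0.
  rewrite -nneseriesD; last 2 first.
  - by move=> k _ _; rewrite mule_ge0 ?hterm_ge0.
  - by move=> k _ _; rewrite mule_ge0 ?hterm_ge0.
  apply: eq_eseriesr => k _; rewrite -!EFinM -EFinD; congr (_%:E); rewrite powR_succ//.
  by field; rewrite !gt_eqF.
- near=> t; move=> k; have t1 : 1 <= t by near: t; exact: nbhs_pinfty_ge.
  have t0 : 0 < t by exact: lt_le_trans t1.
  have q1 : expR (- (2 * a k * t)) <= 1.
    by rewrite -expR0 ler_expR oppr_le0 mulr_ge0 ?(ltW t0)// mulr_ge0 ?(ltW (a_gt0 k)).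
  rewrite fieldE.
  set A := _ * phi0 x k; set B := (_ - 1) * _.
  apply: (@le_trans _ _ (2 * A ^+ 2 + 2 * B ^+ 2)); first by have := sqr_ge0 (A - B); nra.
  rewrite lerD//.
    rewrite /A exprMn mulrA ler_wpM2r ?sqr_ge0// ler_pM2l// -expRM_natl.
    rewrite mulrN expRN -[leRHS]div1r -[leLHS]div1r ler_pM2l// lef_pV2 ?posrE ?expR_gt0//.
    apply: le_trans (expR_ge1Dx _); have := ler_wpM2l (ltW (a_gt0 k)) t1.
    by have := mulr_gt0 (a_gt0 k) t0; lra.
  rewrite (_ : 2 * B ^+ 2 = 2 * (damping t k - 1) ^+ 2 * (c ^+ 2 * Wbar y k ^+ 2)); last first.
    by rewrite /B; ring.
  rewrite [leRHS](_ : _ = 2 * 1 * (c ^+ 2 * Wbar y k ^+ 2)); last by ring.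
  apply: ler_wpM2r; first by rewrite mulr_ge0 ?sqr_ge0.
  rewrite ler_pM2l//.
  have d0 : 0 <= damping t k by exact: sqrtr_ge0.
  have d1 : damping t k <= 1.
    by rewrite -sqrtr1 ler_sqrt// gerBl expR_ge0.
  by nra.
- move=> k; rewrite (_ : (fun t => _) = (fun t : R => expR (- (a k * t)) * phi0 x k +
      (damping t k - 1) * (c * Wbar y k))); last by apply/funext => t; rewrite fieldE.
  have decay (b : R) : 0 < b -> expR (- (b * t)) @[t --> +oo] --> (0 : R).
    move=> b0; apply: (cvg_comp _ _ _ (@cvgr_expR R)).
    by apply: gt0_cvgMry => //; exact: cvg_id.
  have dcvg : damping t k @[t --> +oo] --> (1 : R).
    rewrite -[X in _ --> X]sqrtr1; apply: continuous_cvg; first exact: sqrt_continuous.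
    rewrite -[X in _ --> X]subr0; apply: cvgB; first exact: cvg_cst.
    by apply: decay; rewrite mulr_gt0.
  rewrite -[X in _ --> X](_ : 0 * phi0 x k + (1 - 1) * (c * Wbar y k) = 0); last by rewrite subrr !mul0r addr0.
  apply: cvgD; apply: cvgM; [exact: decay|exact: cvg_cst| |exact: cvg_cst].
  by apply: cvgB => //; exact: cvg_cst.
Unshelve. all: by end_near. Qed.

Section functional.
Variables (G : (nat -> R) -> R) (M : R).
Hypothesis cG : hcontinuous lam s G.
Hypothesis G_le : forall f, hscale lam s f -> `|G f| <= M.

(** Adding the bound [M] makes the functional nonnegative, as the independence and Tonelli lemmas
    require; [M] is subtracted again after integration over a probability. *)
Let Phi f : \bar R := (G (hcut lam s f) + M)%:E.

Let G_bounds f : - M <= G (hcut lam s f) /\ G (hcut lam s f) <= M.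
Proof. by have := G_le (hcut_hscale lam s f); rewrite ler_norml => /andP[]. Qed.

Let Phi_ge0 f : (0 <= Phi f)%E.
Proof. by rewrite lee_fin; have [] := G_bounds f; lra. Qed.

Let Phi_le f : (`|Phi f| <= (2 * M)%:E)%E.
Proof. by rewrite gee0_abs// lee_fin; have [] := G_bounds f; lra. Qed.

Let Phi_measurable d' (U : measurableType d') (X : U -> nat -> R) :
  (forall k, measurable_fun setT (X ^~ k)) -> measurable_fun setT (fun x => Phi (X x)).
Proof.
move=> mX; apply/measurable_EFinP; apply: measurable_funD => //.
exact: measurable_hcontinuous.
Qed.

Let integral_Phi d' (U : measurableType d') (L : probability U R) (X : U -> nat -> R) :
  (forall k, measurable_fun setT (X ^~ k)) ->
  (\int[L]_x (G (hcut lam s (X x)))%:E = \int[L]_x Phi (X x) - M%:E)%E.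
Proof.
move=> mX; have mG : measurable_fun setT (fun x => (G (hcut lam s (X x)))%:E).
  by apply/measurable_EFinP; exact: measurable_hcontinuous.
have iM : L.-integrable setT (cst M%:E) by exact: finite_measure_integrable_cst.
have iG : L.-integrable setT (fun x => (G (hcut lam s (X x)))%:E).
  apply: (le_integrable measurableT mG _ iM) => x _ /=; rewrite lee_fin.
  by apply: le_trans (G_le (hcut_hscale lam s (X x))) (ler_norm _).
rewrite (_ : (fun x => Phi (X x)) = (fun x => (G (hcut lam s (X x)))%:E + cst M%:E x)%E)//.
by rewrite integralD// integral_cst_probability addeK.
Qed.

Variable u : R -> T -> nat -> R.
Hypothesis u_sol : is_solution P lam nu sigma F w r phi u.

(* By independence of [phi] and [W], the noise can be replaced by a copy of it
   on the probability space of the free field. *)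
Lemma integral_solution t : 0 < t ->
  (\int[P]_x (G (u t x))%:E =
   \int[P]_x \int[Q]_y Phi (heat_semigroup lam nu t (phi0 x) + damped_field t y)%R - M%:E)%E.
Proof.
move=> t0; have t0' := ltW t0.
pose V x := heat_semigroup lam nu t (phi0 x) + (fun k => noise t k x).
have mnoise k : measurable_fun setT (noise t k) by exact: (noise_measurable lam nu sigma basisF wB).
have mphi k : measurable_fun setT (phi0 ^~ k) by exact: (phi0_measurable basisF lam_gt0 phi_adapted).
have mV k : measurable_fun setT (V ^~ k).
  by apply: measurable_funD => //; exact: measurable_funM.
have [Y [hY _ YE _]] := solution_in_L2 basisF wB lam_gt0 weight_lty nu_gt0 phiL2 phi_adapted u_sol t0.
have aeF : Filter (nbhs (almost_everywhere P)) by exact: ae_filter_ringOfSetsType.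
have uV : {ae P, forall x, u t x = V x}.
  have /ae_foralln nE := fun k => noise_ae sigma wB lam_gt0 nu_gt0 k t0'.
  have h1 := @filterI T _ aeF _ _ nE (phi0_ae phiL2).
  move: h1 (solution_noise wB lam_gt0 nu_gt0 phiL2 u_sol t0').
  apply: filterS2 => x [nEx pE] uE; rewrite -(subrK (heat_semigroup lam nu t (phi x)) (u t x)) uE.
  by rewrite /V pE addrC; congr (_ + _); apply/funext => k; rewrite nEx.
have GE : ae_eq P setT (fun x => (G (hcut lam s (V x)))%:E) (fun x => (G (u t x))%:E).
  by move: uV YE; apply: filterS2 => x uVx /(_ I) uY _; rewrite -uVx hcutE// uY; exact: hY.
have mGV : measurable_fun setT (fun x => (G (hcut lam s (V x)))%:E).
  by apply/measurable_EFinP; exact: measurable_hcontinuous.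
(* The solution agrees only almost everywhere with the measurable [V]; completeness of [P] makes the
   functional of the solution measurable as well. *)
have mGu := ae_measurable_fun (sb_complete basisF) GE mGV.
transitivity (\int[P]_x (G (hcut lam s (V x)))%:E)%E.
  by apply: ae_eq_integral => //; exact: ae_eq_sym.
rewrite integral_Phi//; congr (_ - _)%E.
pose f (z : @seqspace R * @seqspace R) := Phi (heat_semigroup lam nu t z.1 + z.2).
have mf : measurable_fun setT f.
  apply: (Phi_measurable (X := fun z : @seqspace R * @seqspace R => heat_semigroup lam nu t z.1 + z.2)) => k.
  apply: measurable_funD; last exact: (measurableT_comp (measurable_coord k) measurable_snd).
  apply: measurable_funM => //; exact: (measurableT_comp (measurable_coord k) measurable_fst).
have f0 z : (0 <= f z)%E by exact: Phi_ge0.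
have mp' := measurable_seq mphi; have mn' := measurable_seq (X := fun x k => noise t k x) mnoise.
rewrite [LHS](integral_independent mp' mn' _ mf f0); last first.
  by move=> A B mA mB; exact: initial_noise_independent.
apply: eq_integral => x _; apply: (integral_noise_law (f := fun g => f (phi0 x, g))) => //.
exact: (measurableT_comp mf (pair1_measurable _)).
Qed.

Lemma solution_law_cvg :
  (\int[P]_x (G (u t x))%:E)%E @[t --> +oo] --> (\int[Q]_y (G (c *: Wbar y))%:E)%E.
Proof.
pose H t := (\int[P]_x \int[Q]_y Phi (heat_semigroup lam nu t (phi0 x) + damped_field t y)%R)%E.
have mW k : measurable_fun setT ((fun y => c *: Wbar y) ^~ k).
  by apply: measurable_funM => //; exact: gff_measurable.
have -> : (\int[Q]_y (G (c *: Wbar y))%:E = \int[Q]_y Phi (c *: Wbar y)%R - M%:E)%E.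
  rewrite -integral_Phi//; apply: eq_integral => y _; rewrite hcutE//; exact: hscaleZ.
suff Hcvg : H t @[t --> +oo] --> (\int[Q]_y Phi (c *: Wbar y)%R)%E.
  have HM : (H t - M%:E)%E @[t --> +oo] --> (\int[Q]_y Phi (c *: Wbar y)%R - M%:E)%E.
    by apply: cvgeB; [exact: fin_num_adde_defl|exact: Hcvg|exact: cvg_cst].
  apply: cvg_trans HM; apply: near_eq_cvg; near=> t.
  by rewrite /= integral_solution//; near: t; exact: nbhs_pinfty_gt.
(* Reduction to sequences of times, for which dominated convergence is available: it is applied over
   the field for fixed [x], and again over [x], with the constant 2 M as majorant. *)
apply/cvge_pinftyP => t tcvg.
have mphi k : measurable_fun setT (phi0 ^~ k) by exact: (phi0_measurable basisF lam_gt0 phi_adapted).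
have mpair q : measurable_fun setT (fun z : T * S => Phi (heat_semigroup lam nu q (phi0 z.1) + damped_field q z.2)).
  apply: (Phi_measurable (X := fun z : T * S => heat_semigroup lam nu q (phi0 z.1) + damped_field q z.2)) => k.
  apply: measurable_funD; last exact: (measurableT_comp (damped_field_measurable q k) measurable_snd).
  apply: measurable_funM => //; exact: (measurableT_comp (mphi k) measurable_fst).
have inner x : (\int[Q]_y Phi (heat_semigroup lam nu (t n) (phi0 x) + damped_field (t n) y)%R)%E
    @[n --> \oo] --> (\int[Q]_y Phi (c *: Wbar y)%R)%E.
  have iM : Q.-integrable setT (cst (2 * M)%:E) by exact: finite_measure_integrable_cst.
  pose f_ n y := Phi (heat_semigroup lam nu (t n) (phi0 x) + damped_field (t n) y).
  have m1 n : measurable_fun setT (f_ n).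
    exact: (measurableT_comp (mpair (t n)) (pair1_measurable x)).
  have m2 : measurable_fun setT (fun y => Phi (c *: Wbar y)) by exact: Phi_measurable.
  have f_cvg : {ae Q, forall y, setT y -> f_ n y @[n --> \oo] --> Phi (c *: Wbar y)}.
    apply: filterS gff_coord => y WE _; apply: cvg_EFin; first exact: nearW.
    apply: cvgD; last exact: cvg_cst.
    rewrite [X in _ --> G X](_ : _ = c *: Wbar y); last by rewrite hcutE//; exact: hscaleZ.
    apply: hcontinuous_cvg => //; first exact: hscaleZ.
    exact: (cvg_comp _ _ tcvg (@solution_law_cvg_pointwise x y WE)).
  have f_le : {ae Q, forall y, forall n, setT y -> (`|f_ n y| <= cst (2 * M)%:E y)%E}.
    by apply: aeW => y n _; exact: Phi_le.
  by have [_ _] := dominated_convergence measurableT m1 m2 f_cvg iM f_le.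
have iM : P.-integrable setT (cst (2 * M)%:E) by exact: finite_measure_integrable_cst.
pose h_ n x := (\int[Q]_y Phi (heat_semigroup lam nu (t n) (phi0 x) + damped_field (t n) y)%R)%E.
have m1 n : measurable_fun setT (h_ n).
  exact: (measurable_fun_fubini_tonelli_F _ (mpair (t n))).
have m2 : measurable_fun (setT : set T) (cst (\int[Q]_y Phi (c *: Wbar y)%R)%E).
  exact: measurable_cst.
have h_cvg : {ae P, forall x, setT x -> h_ n x @[n --> \oo] --> cst (\int[Q]_y Phi (c *: Wbar y)%R)%E x}.
  by apply: aeW => x _; exact: inner.
have h_le : {ae P, forall x, forall n, setT x -> (`|h_ n x| <= cst (2 * M)%:E x)%E}.
  apply: aeW => x n _; rewrite gee0_abs; last by apply: integral_ge0 => y _; exact: Phi_ge0.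
  apply: (@le_trans _ _ (\int[Q]_y cst (2 * M)%:E y)%E).
    by apply: le_integral_nonneg => y _; [exact: Phi_ge0|have := Phi_le (heat_semigroup lam nu (t n) (phi0 x) + damped_field (t n) y); rewrite gee0_abs].
  by rewrite integral_cst_probability.
have [_ _] := dominated_convergence measurableT m1 m2 h_cvg iM h_le.
by rewrite integral_cst_probability.
Unshelve. all: by end_near. Qed.

End functional.

End stationary_limit.

Theorem theorem3p5 (R : realType) (d : nat) (d_gt0 : (0 < d)%N)
    (O : set 'rV[R]_d) (D : set ('rV[R]_d -> R))
    (Lap : ('rV[R]_d -> R) -> 'rV[R]_d -> R)
    (h : nat -> 'rV[R]_d -> R) (lam : nat -> R)
    (O_domain : bounded_domain O)
    (Lap_laplacian : homogeneous_laplacian O D Lap)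
    (A1 : eigenbasis O D Lap h lam)
    (A2 : eigenvalue_growth d lam)
    (nu sigma : R) (nu_gt0 : 0 < nu) (sigma_gt0 : 0 < sigma) :
  exists C : R -> R -> R,
  forall gamma : R, d%:R / 2 < gamma ->
  forall (dT : measure_display) (T : measurableType dT) (P : probability T R)
    (F : R -> set (set T)) (w : nat -> R -> T -> R) (phi : T -> nat -> R),
    usual_stochastic_basis P F ->
    cylindrical_brownian_motion P F w ->
    initial_condition P lam F w (- gamma) phi ->
  (exists u, is_solution P lam nu sigma F w (- gamma) phi u) /\
  (forall u v, is_solution P lam nu sigma F w (- gamma) phi u ->
    is_solution P lam nu sigma F w (- gamma) phi v ->
    {ae P, forall x, forall t : R, 0 <= t -> u t x = v t x}) /\
  (forall u, is_solution P lam nu sigma F w (- gamma) phi u ->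
    [/\ forall t1 : R, 0 < t1 ->
          (\int[P]_x ereal_sup
              [set hnorm2 lam (- gamma) (u t x) | t in `]0%R, t1[]
            + \int[P]_x \int[lebesgue_measure]_(t in `[0%R, t1])
                hnorm2 lam (1 - gamma) (u t x)
          <= (C gamma t1)%:E * (1 + \int[P]_x hnorm2 lam (- gamma) (phi x)))%E,
        forall t : R, 0 < t ->
          in_L2 lam P setT (1 - gamma) (u t) /\
          exists ubar : nat -> T -> R,
            [/\ mutually_independent P (fun k => sigma_of (ubar k)),
                forall k, gaussian P (ubar k)
                  (sigma ^+ 2 / (2 * nu * lam k ^+ 2) *
                    (1 - expR (- (2 * nu * lam k ^+ 2 * t)))) &
                L2_series lam P (1 - gamma) ubar
                  (fun x => u t x - heat_semigroup lam nu t (phi x))] &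
        forall (dS : measure_display) (S : measurableType dS)
          (Q : probability S R) (Wbar : S -> nat -> R),
          gaussian_free_field Q d lam Wbar ->
          cvg_in_law lam P Q (1 - gamma) u
            (fun y => (sigma * (2 * nu) `^ (- 2^-1)) *: Wbar y)]).
Proof.
(* The constant is fixed before the probability space and the initial value; the eigenvalues enter
   it only through the trace [weight]. *)
exists (fun gamma t => energy_constant lam nu sigma (- gamma) t).
move=> gamma gamma_gt dT T P F w phi basisF [wB w_indep] [phiL2 phi_adapted phi_indep].
have lam_gt0 k : 0 < lam k by exact: eigenvalue_gt0 A2.
have lam_ge k : lam 0%N <= lam k by exact: eigenvalue_ge_first A2.
have weight_lty : (\sum_(0 <= k <oo) (lam k `^ (2 * - gamma))%:E < +oo)%E.
  by rewrite mulrN; exact: eigenvalue_series_lty A2 gamma_gt.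
have gE : 1 - gamma = - gamma + 1 by rewrite addrC.
split; [|split].
- exists (mild w lam nu sigma (- gamma) phi).
  exact: (mild_solution sigma basisF wB).
- move=> u v usol vsol; move: (solution_unique wB lam_gt0 nu_gt0 phiL2 usol)
    (solution_unique wB lam_gt0 nu_gt0 phiL2 vsol).
  by apply: filterS2 => x uE vE t t0; rewrite uE// vE.
move=> u usol; rewrite gE; split.
- by move=> t t0; exact: (solution_estimate basisF wB).
- move=> t t0; split; first exact: (solution_in_L2 basisF wB lam_gt0 weight_lty nu_gt0 phiL2 phi_adapted usol).
  exists (noise w lam nu sigma t); split.
  + by apply: noise_independent => //; exact: ltW.
  + by move=> k; exact: (noise_gaussian basisF wB).
  + exact: (solution_noise_series basisF wB lam_gt0 weight_lty nu_gt0 phiL2 usol).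
- move=> dS S Q Wbar [[zeta [zeta_gaussian zeta_indep WE]] WH] G cG [M GM].
  have := WE gamma gamma_gt; have [] := WH gamma gamma_gt; rewrite gE => Wh Wm WL2.
  exact: (solution_law_cvg basisF wB w_indep lam_gt0 weight_lty nu_gt0 sigma_gt0 phiL2
    phi_adapted phi_indep zeta_gaussian zeta_indep WL2 Wh Wm cG GM usol).
Qed.
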